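(* The following hold: (1) $\mathsf{OP}+\mathsf{RT}^{4}_{203}$ implies $\mathsf{CRT}$ in $\mathsf{ZF}$. (2) $\mathsf{DF=F}$ is strictly stronger than $\mathsf{CRT}$ in $\mathsf{ZFA}$.
   Context: $\mathsf{ZF}$ is Zermelo–Fraenkel set theory without the Axiom of Choice; $\mathsf{ZFA}$ is $\mathsf{ZF}$ with Extensionality weakened to allow atoms. ''$\Phi$ is strictly stronger than $\Psi$ in $T$'' means that $T$ proves $\Phi\to\Psi$ but $T$ does not prove $\Psi\to\Phi$ (under the usual consistency assumption). $[X]^{m}$ is the set of $m$-element subsets of $X$. $\mathsf{OP}$ (Ordering Principle): every set can be linearly ordered. $\mathsf{RT}^{m}_{n}$: for every infinite set $X$ and every $\chi:[X]^{m}\to n=\{0,\dots,n-1\}$ there is an infinite $Y\subseteq X$ such that $\chi$ is constant on $[Y]^{m}$. $\mathsf{DF=F}$: every Dedekind-finite set is finite ($X$ is Dedekind-finite if there is no injection $\omega\to X$). $\mathsf{CRT}$ (Canonical Ramsey Theorem for pairs): for every infinite set $X$ and every coloring $f:[X]^{2}\to C$, there exists an infinite set $Y\subseteq X$ with a (strict) linear ordering $R$ of $Y$ such that one of the following holds: (a) $f(\{a_{1},b_{1}\})=f(\{a_{2},b_{2}\})$ for all $a_1,b_1,a_2,b_2\in Y$ with $a_1\neq b_1$, $a_2\neq b_2$; (b) for all $a_1,b_1,a_2,b_2\in Y$ with $a_{1}Rb_{1}$ and $a_{2}Rb_{2}$: $f(\{a_{1},b_{1}\})=f(\{a_{2},b_{2}\})$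 iff $a_{1}=a_{2}$; (c) for all $a_1,b_1,a_2,b_2\in Y$ with $a_{1}Rb_{1}$ and $a_{2}Rb_{2}$: $f(\{a_{1},b_{1}\})=f(\{a_{2},b_{2}\})$ iff $b_{1}=b_{2}$; (d) for all $a_1,b_1,a_2,b_2\in Y$ with $a_{1}Rb_{1}$ and $a_{2}Rb_{2}$: $f(\{a_{1},b_{1}\})=f(\{a_{2},b_{2}\})$ iff $a_{1}=a_{2}$ and $b_{1}=b_{2}$. *)

(* Defs.v *)
From Stdlib Require Import Arith List.
Import ListNotations.
Set Implicit Arguments.

(** * First-order logic with equality *)

(* LZF has only the binary membership symbol; LZFA has in addition constants
   for the empty set and for the set of atoms (Jech, "The Axiom of Choice"). *)
Inductive lang : Set := LZF | LZFA.

Inductive zfa_const : Set := c_empty | c_atoms.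

Definition const (L : lang) : Set :=
  match L with LZF => Empty_set | LZFA => zfa_const end.

Inductive term (L : lang) : Set :=
| Var : nat -> term L
| Cst : const L -> term L.
Arguments Var {L} _.
Arguments Cst {L} _.

(* De Bruijn indices: fAll binds index 0. *)
Inductive form (L : lang) : Set :=
| fBot : form L
| fEq : term L -> term L -> form L
| fMem : term L -> term L -> form L
| fImp : form L -> form L -> form L
| fAll : form L -> form L.
Arguments fBot {L}.
Arguments fEq {L} _ _.
Arguments fMem {L} _ _.
Arguments fImp {L} _ _.
Arguments fAll {L} _.

Definition fNot {L} (p : form L) : form L := fImp p fBot.
Definition fAnd {L} (p q : form L) : form L := fNot (fImp p (fNot q)).
Definition fOr {L} (p q : form L) : form L := fImp (fNot p) q.
Definition fIff {L} (p q : form L) : form L := fAnd (fImp p q) (fImp q p).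
Definition fEx {L} (p : form L) : form L := fNot (fAll (fNot p)).

Definition subst_term {L} (s : nat -> term L) (t : term L) : term L :=
  match t with Var n => s n | Cst c => Cst c end.

Definition lift_term {L} (t : term L) : term L :=
  subst_term (fun n => Var (S n)) t.

Definition up {L} (s : nat -> term L) (n : nat) : term L :=
  match n with 0 => Var 0 | S k => lift_term (s k) end.

Fixpoint subst {L} (s : nat -> term L) (p : form L) : form L :=
  match p with
  | fBot => fBot
  | fEq t u => fEq (subst_term s t) (subst_term s u)
  | fMem t u => fMem (subst_term s t) (subst_term s u)
  | fImp q r => fImp (subst s q) (subst s r)
  | fAll q => fAll (subst (up s) q)
  end.

Definition lift {L} (p : form L) : form L := subst (fun n => Var (S n)) p.

Definition inst0 {L} (t : term L) (p : form L) : form L :=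
  subst (fun n => match n with 0 => t | S k => Var k end) p.

Definition term_below {L} (k : nat) (t : term L) : Prop :=
  match t with Var n => n < k | Cst _ => True end.

(* Every free variable of p has index < k. *)
Fixpoint free_below {L} (k : nat) (p : form L) : Prop :=
  match p with
  | fBot => True
  | fEq t u => term_below k t /\ term_below k u
  | fMem t u => term_below k t /\ term_below k u
  | fImp q r => free_below k q /\ free_below k r
  | fAll q => free_below (S k) q
  end.

(** Classical natural deduction. *)
Inductive nd {L} : list (form L) -> form L -> Prop :=
| nd_ax G p : In p G -> nd G p
| nd_impI G p q : nd (p :: G) q -> nd G (fImp p q)
| nd_impE G p q : nd G (fImp p q) -> nd G p -> nd G q
| nd_raa G p : nd (fNot p :: G) fBot -> nd G p
| nd_allI G p : nd (map lift G) p -> nd G (fAll p)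
| nd_allE G p t : nd G (fAll p) -> nd G (inst0 t p)
| nd_refl G t : nd G (fEq t t)
| nd_leibniz G p t u : nd G (fEq t u) -> nd G (inst0 t p) -> nd G (inst0 u p).

Definition theory (L : lang) : Type := form L -> Prop.

Definition proves {L} (T : theory L) (p : form L) : Prop :=
  exists G : list (form L), (forall q, In q G -> T q) /\ nd G p.

Definition consistent {L} (T : theory L) : Prop := ~ proves T fBot.

(** * Named binders on top of de Bruijn indices

   A [tm] or [fm] is a term or formula given as a function of the number of
   binders above it. The binder [mAll] hands its body the variable bound at
   its own level, so that sentences can be written with ordinary bound names. *)

Definition tm (L : lang) : Set := nat -> term L.
Definition fm (L : lang) : Set := nat -> form L.

Definition level {L} (l : nat) : tm L := fun d => Var (d - S l).

Definition mAll {L} (F : tm L -> fm L) : fm L :=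
  fun d => fAll (F (level d) (S d)).
Definition mEx {L} (F : tm L -> fm L) : fm L :=
  fun d => fEx (F (level d) (S d)).
Definition mEq {L} (x y : tm L) : fm L := fun d => fEq (x d) (y d).
Definition mMem {L} (x y : tm L) : fm L := fun d => fMem (x d) (y d).
Definition mBot {L} : fm L := fun _ => fBot.
Definition mNot {L} (p : fm L) : fm L := fun d => fNot (p d).
Definition mAnd {L} (p q : fm L) : fm L := fun d => fAnd (p d) (q d).
Definition mOr {L} (p q : fm L) : fm L := fun d => fOr (p d) (q d).
Definition mImp {L} (p q : fm L) : fm L := fun d => fImp (p d) (q d).
Definition mIff {L} (p q : fm L) : fm L := fun d => fIff (p d) (q d).

Definition mCst {L} (c : const L) : tm L := fun _ => Cst c.

Definition close {L} (p : fm L) : form L := p 0.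

(* p with its variables 0, ..., length ts - 1 replaced by ts; the remaining
   variables are kept as parameters, renumbered from 0 and free in the result. *)
Definition inst {L} (p : form L) (ts : list (tm L)) : fm L :=
  fun d => subst (fun n => nth n (map (fun t : tm L => t d) ts)
                               (Var (d + (n - length ts)))) p.

Declare Scope fm_scope.
Delimit Scope fm_scope with fm.
Bind Scope fm_scope with fm.

Notation "∀ x .. y , p" := (mAll (fun x => .. (mAll (fun y => p)) ..))
  (at level 200, x binder, y binder, right associativity) : fm_scope.
Notation "∃ x .. y , p" := (mEx (fun x => .. (mEx (fun y => p)) ..))
  (at level 200, x binder, y binder, right associativity) : fm_scope.
Notation "x ∈ y" := (mMem x y) (at level 70) : fm_scope.
Notation "x ≐ y" := (mEq x y) (at level 70) : fm_scope.
Notation "¬ p" := (mNot p) (at level 75, right associativity) : fm_scope.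
Notation "p ∧ q" := (mAnd p q) (at level 80, right associativity) : fm_scope.
Notation "p ∨ q" := (mOr p q) (at level 85, right associativity) : fm_scope.
Notation "p ⟶ q" := (mImp p q) (at level 99, right associativity, q at level 200) : fm_scope.
Notation "p ⟷ q" := (mIff p q) (at level 95, no associativity) : fm_scope.
Local Open Scope fm_scope.

(** * Set-theoretic notions *)

(* In ZF every object is a set; in ZFA the sets are the objects that are not
   atoms. *)
Definition is_set {L} : tm L -> fm L :=
  match L with
  | LZF => fun _ => ¬ mBot
  | LZFA => fun x => ¬ (x ∈ @mCst LZFA c_atoms)
  end.

Definition is_empty {L} (x : tm L) : fm L := is_set x ∧ ∀ z, ¬ (z ∈ x).

Definition subset {L} (x y : tm L) : fm L :=
  is_set x ∧ ∀ z, z ∈ x ⟶ z ∈ y.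

(* p = {a, b} *)
Definition is_upair {L} (p a b : tm L) : fm L :=
  ∀ z, z ∈ p ⟷ (z ≐ a ∨ z ≐ b).

(* p = (a, b) = {{a}, {a, b}} *)
Definition is_opair {L} (p a b : tm L) : fm L :=
  ∃ u v, is_upair u a a ∧ is_upair v a b ∧ is_upair p u v.

(* (a, b) ∈ r *)
Definition rel {L} (r a b : tm L) : fm L := ∃ p, is_opair p a b ∧ p ∈ r.

(* s = n ∪ {n} *)
Definition is_succ {L} (s n : tm L) : fm L :=
  ∀ z, z ∈ s ⟷ (z ∈ n ∨ z ≐ n).

Definition is_inductive {L} (w : tm L) : fm L :=
  (∃ e, is_empty e ∧ e ∈ w) ∧ ∀ n, n ∈ w ⟶ ∃ s, is_succ s n ∧ s ∈ w.

Definition is_omega {L} (w : tm L) : fm L :=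
  is_inductive w ∧ ∀ v, is_inductive v ⟶ subset w v.

(* x is the von Neumann numeral n = {0, ..., n-1}. *)
Fixpoint is_numeral {L} (n : nat) (x : tm L) : fm L :=
  match n with
  | 0 => is_empty x
  | S k => ∃ y, is_numeral k y ∧ is_succ x y
  end.

Definition is_relation {L} (r X Y : tm L) : fm L :=
  is_set r ∧ ∀ p, p ∈ r ⟶ ∃ a b, a ∈ X ∧ b ∈ Y ∧ is_opair p a b.

Definition is_function {L} (f X Y : tm L) : fm L :=
  is_relation f X Y ∧
  ∀ a, a ∈ X ⟶ ∃ b, rel f a b ∧ ∀ c, rel f a c ⟶ c ≐ b.

Definition is_injection {L} (f X Y : tm L) : fm L :=
  is_function f X Y ∧ ∀ a b c, rel f a c ∧ rel f b c ⟶ a ≐ b.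

Definition is_bijection {L} (f X Y : tm L) : fm L :=
  is_injection f X Y ∧ ∀ b, b ∈ Y ⟶ ∃ a, rel f a b.

Definition finite {L} (X : tm L) : fm L :=
  is_set X ∧ ∃ w n f, is_omega w ∧ n ∈ w ∧ is_bijection f X n.

Definition infinite {L} (X : tm L) : fm L := is_set X ∧ ¬ finite X.

Definition dedekind_finite {L} (X : tm L) : fm L :=
  is_set X ∧ ¬ ∃ w f, is_omega w ∧ is_injection f w X.

(* s is an m-element subset of X. *)
Definition is_msubset {L} (m : nat) (s X : tm L) : fm L :=
  subset s X ∧ ∃ k f, is_numeral m k ∧ is_bijection f s k.

(* P = [X]^m *)
Definition is_msubsets {L} (m : nat) (P X : tm L) : fm L :=
  is_set P ∧ ∀ s, s ∈ P ⟷ is_msubset m s X.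

Definition strict_linear_order {L} (R Y : tm L) : fm L :=
  is_relation R Y Y ∧
  (∀ a, ¬ rel R a a) ∧
  (∀ a b c, rel R a b ∧ rel R b c ⟶ rel R a c) ∧
  (∀ a b, a ∈ Y ∧ b ∈ Y ⟶ rel R a b ∨ a ≐ b ∨ rel R b a).

(** * The principles *)

Definition OP {L} : form L := close (
  ∀ X, is_set X ⟶ ∃ R, strict_linear_order R X).

Definition RT {L} (m n : nat) : form L := close (
  ∀ X P N chi,
    infinite X ∧ is_msubsets m P X ∧ is_numeral n N ∧ is_function chi P N ⟶
    ∃ Y, subset Y X ∧ infinite Y ∧
      ∃ c, c ∈ N ∧ ∀ s, is_msubset m s Y ⟶ rel chi s c).

Definition DF_eq_F {L} : form L := close (
  ∀ X, dedekind_finite X ⟶ finite X).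

(* f({a1, b1}) = f({a2, b2}) *)
Definition same_color {L} (f a1 b1 a2 b2 : tm L) : fm L :=
  ∃ p q c, is_upair p a1 b1 ∧ is_upair q a2 b2 ∧ rel f p c ∧ rel f q c.

Definition canonical_a {L} (f Y : tm L) : fm L :=
  ∀ a1 b1 a2 b2, a1 ∈ Y ∧ b1 ∈ Y ∧ a2 ∈ Y ∧ b2 ∈ Y ∧
    ¬ (a1 ≐ b1) ∧ ¬ (a2 ≐ b2) ⟶ same_color f a1 b1 a2 b2.

Definition canonical_b {L} (f Y R : tm L) : fm L :=
  ∀ a1 b1 a2 b2, a1 ∈ Y ∧ b1 ∈ Y ∧ a2 ∈ Y ∧ b2 ∈ Y ∧
    rel R a1 b1 ∧ rel R a2 b2 ⟶ (same_color f a1 b1 a2 b2 ⟷ a1 ≐ a2).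

Definition canonical_c {L} (f Y R : tm L) : fm L :=
  ∀ a1 b1 a2 b2, a1 ∈ Y ∧ b1 ∈ Y ∧ a2 ∈ Y ∧ b2 ∈ Y ∧
    rel R a1 b1 ∧ rel R a2 b2 ⟶ (same_color f a1 b1 a2 b2 ⟷ b1 ≐ b2).

Definition canonical_d {L} (f Y R : tm L) : fm L :=
  ∀ a1 b1 a2 b2, a1 ∈ Y ∧ b1 ∈ Y ∧ a2 ∈ Y ∧ b2 ∈ Y ∧
    rel R a1 b1 ∧ rel R a2 b2 ⟶
    (same_color f a1 b1 a2 b2 ⟷ (a1 ≐ a2 ∧ b1 ≐ b2)).

Definition CRT {L} : form L := close (
  ∀ X P C f,
    infinite X ∧ is_msubsets 2 P X ∧ is_set C ∧ is_function f P C ⟶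
    ∃ Y R, subset Y X ∧ infinite Y ∧ strict_linear_order R Y ∧
      (canonical_a f Y ∨ canonical_b f Y R ∨
       canonical_c f Y R ∨ canonical_d f Y R)).

(** * The theories ZF and ZFA *)

Definition extensionality {L} : form L := close (
  ∀ x y, is_set x ∧ is_set y ⟶ (∀ z, z ∈ x ⟷ z ∈ y) ⟶ x ≐ y).

Definition pairing {L} : form L := close (
  ∀ a b, ∃ c, ∀ z, z ∈ c ⟷ (z ≐ a ∨ z ≐ b)).

Definition union {L} : form L := close (
  ∀ x, ∃ u, ∀ z, z ∈ u ⟷ ∃ y, y ∈ x ∧ z ∈ y).

Definition power_set {L} : form L := close (
  ∀ x, ∃ p, ∀ z, z ∈ p ⟷ subset z x).

Definition infinity {L} : form L := close (∃ w, is_inductive w).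

Definition regularity {L} : form L := close (
  ∀ x, (∃ y, y ∈ x) ⟶ ∃ y, y ∈ x ∧ ∀ z, ¬ (z ∈ x ∧ z ∈ y)).

(* In the schemas, p(z) and p(x, y) may contain further variables, which are
   the parameters of the instance. *)
Definition separation {L} (p : form L) : form L := close (
  ∀ x, ∃ y, ∀ z, z ∈ y ⟷ (z ∈ x ∧ inst p [z])).

Definition replacement {L} (p : form L) : form L := close (
  (∀ x y z, inst p [x; y] ∧ inst p [x; z] ⟶ y ≐ z) ⟶
  ∀ X, ∃ Y, ∀ y, y ∈ Y ⟷ ∃ x, x ∈ X ∧ inst p [x; y]).

Definition forall_closure {L} (n : nat) (p : form L) : form L :=
  Nat.iter n fAll p.

Inductive zf_axiom {L} : form L -> Prop :=
| ax_extensionality : zf_axiom extensionality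
| ax_pairing : zf_axiom pairing
| ax_union : zf_axiom union
| ax_power_set : zf_axiom power_set
| ax_infinity : zf_axiom infinity
| ax_regularity : zf_axiom regularity
| ax_separation n p :
    free_below n (separation p) -> zf_axiom (forall_closure n (separation p))
| ax_replacement n p :
    free_below n (replacement p) -> zf_axiom (forall_closure n (replacement p)).

Definition ZF : theory LZF := zf_axiom.

Definition empty_set_axiom : form LZFA := close (
  ∀ x, ¬ (x ∈ mCst (c_empty : const LZFA))).

Definition atoms_axiom : form LZFA := close (
  ∀ z, z ∈ mCst (c_atoms : const LZFA) ⟷
       (¬ (z ≐ mCst (c_empty : const LZFA)) ∧ ¬ ∃ x, x ∈ z)).

Inductive ZFA : theory LZFA :=
| zfa_zf p : zf_axiom p -> ZFA p
| zfa_empty_set : ZFA empty_set_axiom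
| zfa_atoms : ZFA atoms_axiom.

(* The unprovability half is relative to the consistency of ZF. *)
Definition strictly_stronger {L} (T : theory L) (Phi Psi : form L) : Prop :=
  proves T (fImp Phi Psi) /\
  (consistent ZF -> ~ proves T (fImp Psi Phi)).

(* Main.v *)
(** The derivations in ZF and ZFA are obtained semantically, from Gödel's completeness
    theorem. Given a linear order on X, color a < b < c < d by the first of the coincidences
    f(ab) = f(ac), f(ac) = f(bc), f(ab) = f(bc), f(ab) = f(cd), f(ac) = f(bd), f(ad) = f(bc)
    that hold among these points (with the first two kept apart): eight colors suffice, and an
    infinite homogeneous set without its largest element is canonical. For a countable X,
    thinning out makes each f(a, .) constant or injective, then makes all f(., d) follow one
    pattern.

    DF=F does not follow from CRT because of Mostowski's ordered model. It is built inside
    type theory, from Aczel's sets as trees over the reals as atoms, restricted to the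
    hereditarily symmetric ones for the order automorphisms of the reals and finite supports;
    the consistency of ZF is therefore not used. The set of atoms is infinite and
    Dedekind-finite there. If all elements of X have a common support, X has a countable subset
    in the model; otherwise X contains a copy of an interval of atoms, and a coloring of pairs
    supported outside that interval is automatically canonical on it. *)

From Stdlib Require Import Arith Lia List Sorted Cantor Reals Lra.
From Stdlib Require Import Classical ClassicalEpsilon.
From Stdlib Require Import FunctionalExtensionality PropExtensionality.
Require Import Defs.
Import ListNotations.

(** * Tarski semantics *)

Record interp (L : lang) : Type :=
  { dom :> Type; imem : dom -> dom -> Prop; icst : const L -> dom }.
Arguments imem {L} _ _ _.
Arguments icst {L} _ _.

Definition scons {M : Type} (m : M) (v : nat -> M) : nat -> M :=
  fun n => match n with 0 => m | S k => v k end.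
Notation "m .: v" := (scons m v) (at level 60, right associativity).

Definition val {L} (I : interp L) (v : nat -> I) (t : term L) : I :=
  match t with Var n => v n | Cst c => icst I c end.

Fixpoint sat {L} (I : interp L) (v : nat -> I) (p : form L) : Prop :=
  match p with
  | fBot => False
  | fEq t u => val I v t = val I v u
  | fMem t u => imem I (val I v t) (val I v u)
  | fImp q r => sat I v q -> sat I v r
  | fAll q => forall m, sat I (m .: v) q
  end.

Definition models {L} (I : interp L) (T : theory L) : Prop :=
  forall q, T q -> forall v, sat I v q.

Lemma val_subst {L} (I : interp L) v s t :
  val I v (subst_term s t) = val I (fun n => val I v (s n)) t.
Proof. destruct t; reflexivity. Qed.

Lemma sat_subst {L} (I : interp L) p : forall v s,
  sat I v (subst s p) <-> sat I (fun n => val I v (s n)) p.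
Proof.
  induction p; intros v s; cbn; rewrite ?val_subst; try tauto.
  - rewrite IHp1, IHp2. tauto.
  - assert (E : forall m, (fun n => val I (m .: v) (up s n))
                          = m .: (fun n => val I v (s n))).
    { intros m. apply functional_extensionality. intros [|n]; cbn; auto.
      unfold lift_term. now rewrite val_subst. }
    split; intros H m; specialize (H m); apply IHp in H || apply IHp;
      rewrite E in *; exact H.
Qed.

Lemma sat_inst0 {L} (I : interp L) v t p :
  sat I v (inst0 t p) <-> sat I (val I v t .: v) p.
Proof.
  unfold inst0. rewrite sat_subst.
  replace (val I v t .: v) with
    (fun n => val I v match n with 0 => t | S k => Var k end); [tauto|].
  apply functional_extensionality. now intros [|n].
Qed.

Lemma sat_lift {L} (I : interp L) v m p : sat I (m .: v) (lift p) <-> sat I v p.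
Proof. unfold lift. rewrite sat_subst. cbn. tauto. Qed.

Theorem soundness {L} (I : interp L) G p :
  nd G p -> forall v, (forall q, In q G -> sat I v q) -> sat I v p.
Proof.
  induction 1 as [G p Hp|G p q H IH|G p q H1 IH1 H2 IH2|G p H IH|G p H IH|G p t H IH
    |G t|G p t u H1 IH1 H2 IH2]; intros v HG; cbn in *; auto.
  - intros Hp. apply IH. intros r [<-|Hr]; auto.
  - apply NNPP. intros Hp. apply (IH v). intros r [<-|Hr]; auto.
  - intros m. apply IH. intros q Hq. apply in_map_iff in Hq.
    destruct Hq as (r & <- & Hr). apply sat_lift; auto.
  - apply sat_inst0. now apply IH.
  - apply sat_inst0. rewrite <- (IH1 v HG). apply sat_inst0; auto.
Qed.

Lemma proves_sound {L} (T : theory L) (I : interp L) p :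
  models I T -> proves T p -> forall v, sat I v p.
Proof.
  intros HI (G & HG & Hp) v. apply (soundness I _ _ Hp). intros q Hq. now apply HI, HG.
Qed.

Lemma free_below_mono {L} (p : form L) : forall k l, k <= l -> free_below k p -> free_below l p.
Proof.
  induction p; cbn; intros k l Hkl H; auto.
  - destruct t, t0; cbn in *; lia.
  - destruct t, t0; cbn in *; lia.
  - destruct H; split; eauto.
  - eapply IHp; [|exact H]. lia.
Qed.

Definition term_bound {L} (t : term L) : nat :=
  match t with Var n => S n | Cst _ => 0 end.

Fixpoint bound {L} (p : form L) : nat :=
  match p with
  | fBot => 0
  | fEq t u | fMem t u => max (term_bound t) (term_bound u)
  | fImp q r => max (bound q) (bound r)
  | fAll q => bound q
  end.

Lemma free_below_bound {L} (p : form L) : free_below (bound p) p.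
Proof.
  induction p; cbn; auto.
  1,2: destruct t, t0; cbn; lia.
  - split; eapply free_below_mono; [| eassumption | | eassumption]; lia.
  - eapply free_below_mono; [|eassumption]; lia.
Qed.

Lemma sat_below {L} (I : interp L) p : forall k v w,
  (forall n, n < k -> v n = w n) -> free_below k p -> (sat I v p <-> sat I w p).
Proof.
  induction p; cbn; intros k v w H F; try tauto.
  1,2: destruct t, t0; cbn in *; rewrite ?H by lia; tauto.
  - rewrite (IHp1 k v w), (IHp2 k v w); tauto.
  - assert (E : forall m, sat I (m .: v) p <-> sat I (m .: w) p).
    { intros m. apply (IHp (S k)); auto. intros [|n] Hn; cbn; auto. apply H; lia. }
    firstorder.
Qed.

Lemma free_below_forall_closure {L} (p : form L) : forall k m,
  free_below (k + m) p -> free_below m (forall_closure k p).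
Proof.
  unfold forall_closure. induction k; cbn; intros m Hm; auto. apply IHk.
  now replace (k + S m) with (S (k + m)) by lia.
Qed.

Lemma sat_forall_closure {L} (I : interp L) n p :
  (forall v, sat I v p) -> forall v, sat I v (forall_closure n p).
Proof. unfold forall_closure. intros H. induction n; cbn; auto. Qed.

Lemma forall_closure_sat {L} (I : interp L) n (p : form L) v :
  free_below n p -> sat I v (forall_closure n p) -> forall w, sat I w p.
Proof.
  intros F H w.
  assert (G : forall j, j <= n -> forall u, (forall i, i < j -> u i = w (n - j + i)) ->
              sat I u (forall_closure (n - j) p)).
  { induction j as [|j IH]; intros Hj u Hu.
    - rewrite Nat.sub_0_r. apply (sat_below I _ 0 u v); [lia| |exact H].
      apply free_below_forall_closure. now rewrite Nat.add_0_r.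
    - specialize (IH ltac:(lia) (fun i => w (n - j + i)) ltac:(auto)).
      replace (n - j) with (S (n - S j)) in IH by lia.
      specialize (IH (w (n - S j))).
      eapply (sat_below I _ (S j)); [| |exact IH].
      + intros [|i] Hi; cbn; rewrite Hu by lia; f_equal; lia.
      + apply free_below_forall_closure. now replace (n - S j + S j) with n by lia. }
  specialize (G n (le_n n) w). rewrite Nat.sub_diag in G. now apply G.
Qed.

(** * Quotients *)

Section Quotient.
Context {A : Type} (R : A -> A -> Prop).
Hypothesis R_refl : forall x, R x x.
Hypothesis R_sym : forall x y, R x y -> R y x.
Hypothesis R_trans : forall x y z, R x y -> R y z -> R x z.

Definition quot : Type := {P : A -> Prop | exists a, P = R a}.
Definition cls (a : A) : quot := exist _ (R a) (ex_intro _ a eq_refl).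

Lemma cls_surj (q : quot) : exists a, cls a = q.
Proof.
  destruct q as (P & a & ->). exists a. unfold cls. reflexivity.
Qed.

Lemma cls_eq a b : cls a = cls b <-> R a b.
Proof.
  split; intros H.
  - apply (f_equal (@proj1_sig _ _)) in H. cbn in H. rewrite H. apply R_refl.
  - assert (E : R a = R b).
    { apply functional_extensionality. intros c. apply propositional_extensionality.
      split; eauto. }
    unfold cls. generalize (ex_intro (fun a0 => R a = R a0) a eq_refl).
    rewrite E. intros e. f_equal. apply proof_irrelevance.
Qed.
End Quotient.

(** * Substitution in derivations *)

Lemma subst_ext_below {L} (p : form L) : forall k s r,
  (forall n, n < k -> s n = r n) -> free_below k p -> subst s p = subst r p.
Proof.
  assert (T : forall k s r (t : term L), (forall n, n < k -> s n = r n) ->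
              term_below k t -> subst_term s t = subst_term r t).
  { intros k s r [n|c] H F; cbn in *; auto. }
  induction p; cbn; intros k s r H F.
  - reflexivity.
  - destruct F. f_equal; eauto.
  - destruct F. f_equal; eauto.
  - destruct F. f_equal; eauto.
  - f_equal. apply (IHp (S k)); auto. intros [|n] Hn; cbn; auto. rewrite H by lia. reflexivity.
Qed.

Lemma subst_Var {L} (p : form L) : subst Var p = p.
Proof.
  assert (T : forall t : term L, subst_term Var t = t) by (intros [|]; reflexivity).
  assert (U : up (@Var L) = Var)
    by (apply functional_extensionality; intros [|n]; reflexivity).
  induction p; cbn; rewrite ?U, ?T; congruence.
Qed.

Lemma subst_subst {L} (p : form L) : forall s r,
  subst s (subst r p) = subst (fun n => subst_term s (r n)) p.
Proof.
  assert (T : forall s r (t : term L),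
    subst_term s (subst_term r t) = subst_term (fun n => subst_term s (r n)) t)
    by (intros s r [|]; reflexivity).
  induction p; intros s r; cbn; rewrite ?T; try reflexivity.
  { now rewrite IHp1, IHp2. }
  rewrite IHp. f_equal. f_equal. apply functional_extensionality.
  intros [|n]; cbn; auto. unfold lift_term. rewrite !T. reflexivity.
Qed.

Lemma subst_up_lift {L} s (p : form L) : subst (up s) (lift p) = lift (subst s p).
Proof. unfold lift. rewrite !subst_subst. reflexivity. Qed.

Lemma subst_inst0 {L} s t (p : form L) :
  subst s (inst0 t p) = inst0 (subst_term s t) (subst (up s) p).
Proof.
  unfold inst0. rewrite !subst_subst. f_equal. apply functional_extensionality.
  intros [|n]; cbn; auto. destruct (s n); reflexivity.
Qed.

Lemma subst_inst0_up {L} s t (p : form L) :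
  inst0 t (subst (up s) p) = subst (t .: s) p.
Proof.
  unfold inst0. rewrite !subst_subst. f_equal. apply functional_extensionality.
  intros [|n]; cbn; auto. destruct (s n); reflexivity.
Qed.

Lemma nd_weaken {L} (G : list (form L)) p :
  nd G p -> forall G', incl G G' -> nd G' p.
Proof.
  induction 1; intros G' HG.
  - apply nd_ax; auto.
  - apply nd_impI, IHnd. intros r [->|Hr]; cbn; auto.
  - eapply nd_impE; eauto.
  - apply nd_raa, IHnd. intros r [->|Hr]; cbn; auto.
  - apply nd_allI, IHnd. now apply incl_map.
  - apply nd_allE; auto.
  - apply nd_refl.
  - eapply nd_leibniz; eauto.
Qed.

Lemma nd_subst {L} (G : list (form L)) p :
  nd G p -> forall s, nd (map (subst s) G) (subst s p).
Proof.
  induction 1; intros s; cbn in *.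
  - apply nd_ax, in_map; auto.
  - apply nd_impI, IHnd.
  - eapply nd_impE; eauto.
  - apply nd_raa, IHnd.
  - apply nd_allI. rewrite map_map. specialize (IHnd (up s)). rewrite map_map in IHnd.
    erewrite map_ext; [exact IHnd|]. intros q. cbn. now rewrite subst_up_lift.
  - rewrite subst_inst0. apply nd_allE, IHnd.
  - apply nd_refl.
  - rewrite subst_inst0. eapply nd_leibniz; [apply IHnd1|].
    rewrite <- subst_inst0. apply IHnd2.
Qed.

Definition adjoin {L} (S : theory L) (p : form L) : theory L := fun q => S q \/ q = p.

Lemma proves_mono {L} (S S' : theory L) p :
  (forall q, S q -> S' q) -> proves S p -> proves S' p.
Proof. intros H (G & HG & Hp). exists G; split; auto. Qed.

Lemma proves_ax {L} (S : theory L) p : S p -> proves S p.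
Proof.
  intros H. exists [p]; split; [intros q [<-|[]]; auto | apply nd_ax; cbn; auto].
Qed.

Lemma proves_impI {L} (S : theory L) p q : proves (adjoin S p) q -> proves S (fImp p q).
Proof.
  intros (G & HG & Hp).
  assert (E : exists G', (forall r, In r G' -> S r) /\ incl G (p :: G')).
  { clear Hp. induction G as [|r G IH].
    - exists []. split; [intros r []| intros r []].
    - destruct IH as (G' & H1 & H2); [intros; apply HG; cbn; auto|].
      destruct (HG r) as [Hr|Hr]; cbn; auto.
      + exists (r :: G'). split; [intros x [<-|Hx]; auto|].
        intros x [<-|Hx]; cbn; auto. apply H2 in Hx. cbn in Hx. tauto.
      + subst r. exists G'. split; auto. intros x [<-|Hx]; [now left|now apply H2]. }
  destruct E as (G' & H1 & H2). exists G'. split; auto.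
  apply nd_impI. eapply nd_weaken; eauto.
Qed.

Lemma proves_impE {L} (S : theory L) p q : proves S (fImp p q) -> proves S p -> proves S q.
Proof.
  intros (G & HG & Hp) (G' & HG' & Hp'). exists (G ++ G'). split.
  - intros r Hr. apply in_app_or in Hr. destruct Hr; auto.
  - eapply nd_impE; eapply nd_weaken; eauto using incl_appl, incl_appr, incl_refl.
Qed.

Lemma proves_raa {L} (S : theory L) p : proves (adjoin S (fNot p)) fBot -> proves S p.
Proof.
  intros H. apply proves_impI in H. destruct H as (G & HG & H). exists G. split; auto.
  apply nd_raa. eapply nd_impE; [eapply nd_weaken; [exact H|]|apply nd_ax; cbn; auto].
  intros r Hr; cbn; auto.
Qed.

Lemma proves_allE {L} (S : theory L) p t : proves S (fAll p) -> proves S (inst0 t p).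
Proof. intros (G & HG & H). exists G. split; auto. now apply nd_allE. Qed.

Lemma proves_leibniz {L} (S : theory L) p t u :
  proves S (fEq t u) -> proves S (inst0 t p) -> proves S (inst0 u p).
Proof.
  intros (G & HG & Hp) (G' & HG' & Hp'). exists (G ++ G'). split.
  - intros r Hr. apply in_app_or in Hr. destruct Hr; auto.
  - eapply nd_leibniz; eapply nd_weaken; eauto using incl_appl, incl_appr, incl_refl.
Qed.

(* A variable not free in the hypotheses may be renamed to the variable bound by
   the quantifier. *)
Lemma nd_generalize {L} (G : list (form L)) k p :
  (forall q, In q G -> free_below k q) -> free_below (S k) p ->
  nd G (inst0 (Var k) p) -> nd G (fAll p).
Proof.
  intros HG Hp H.
  set (s := fun n => if Nat.eqb n k then Var 0 else Var (L := L) (S n)).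
  apply (nd_subst _ _) with (s := s) in H.
  apply nd_allI.
  replace p with (subst s (inst0 (Var k) p)).
  - erewrite map_ext_in; [exact H|]. intros q Hq. cbn. unfold lift.
    apply (subst_ext_below q k); auto. intros n Hn. unfold s.
    destruct (Nat.eqb_spec n k); auto; lia.
  - unfold inst0. rewrite subst_subst. rewrite <- (subst_Var p) at 2.
    apply (subst_ext_below p (S k)); auto.
    intros [|n] Hn; cbn; unfold s.
    + now rewrite Nat.eqb_refl.
    + destruct (Nat.eqb_spec n k); auto; lia.
Qed.

(** * Enumeration of formulas *)

Definition decode_const (L : lang) (n : nat) : term L :=
  match L with
  | LZF => Var 0
  | LZFA => @Cst LZFA (match n with 0 => c_empty | _ => c_atoms end)
  end.

Definition decode_term (L : lang) (n : nat) : term L :=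
  let (k, m) := of_nat n in
  match k with 0 => Var m | _ => decode_const L m end.

Fixpoint decode (L : lang) (fuel n : nat) : form L :=
  match fuel with
  | 0 => fBot
  | S f =>
      let (k, m) := of_nat n in
      let (a, b) := of_nat m in
      match k with
      | 0 => fBot
      | 1 => fEq (decode_term L a) (decode_term L b)
      | 2 => fMem (decode_term L a) (decode_term L b)
      | 3 => fImp (decode L f a) (decode L f b)
      | _ => fAll (decode L f a)
      end
  end.

Lemma decode_term_surj (L : lang) (t : term L) : exists n, decode_term L n = t.
Proof.
  destruct t as [m|c].
  - exists (to_nat (0, m)). unfold decode_term. now rewrite cancel_of_to.
  - assert (E : exists m, decode_const L m = Cst c).
    { destruct L; [destruct c|]. destruct c; [now exists 0|now exists 1]. }
    destruct E as (m & E). exists (to_nat (1, m)). unfold decode_term.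
    now rewrite cancel_of_to.
Qed.

Lemma decode_surj (L : lang) (p : form L) :
  exists f0 n, forall f, f0 <= f -> decode L f n = p.
Proof.
  induction p as [|t u|t u|p (f1 & n1 & H1) q (f2 & n2 & H2)|p (f1 & n1 & H1)].
  - exists 1, (to_nat (0, 0)). intros [|f] Hf; [lia|]. reflexivity.
  - destruct (decode_term_surj L t) as (a & <-), (decode_term_surj L u) as (b & <-).
    exists 1, (to_nat (1, to_nat (a, b))). intros [|f] Hf; [lia|]. cbn [decode].
    now rewrite !cancel_of_to.
  - destruct (decode_term_surj L t) as (a & <-), (decode_term_surj L u) as (b & <-).
    exists 1, (to_nat (2, to_nat (a, b))). intros [|f] Hf; [lia|]. cbn [decode].
    now rewrite !cancel_of_to.
  - exists (S (max f1 f2)), (to_nat (3, to_nat (n1, n2))). intros [|f] Hf; [lia|].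
    cbn [decode]. rewrite !cancel_of_to, H1, H2 by lia. reflexivity.
  - exists (S f1), (to_nat (4, to_nat (n1, 0))). intros [|f] Hf; [lia|].
    cbn [decode]. rewrite !cancel_of_to, H1 by lia. reflexivity.
Qed.

Definition enum (L : lang) (n : nat) : form L :=
  let (f, m) := of_nat n in decode L f m.

Lemma enum_surj (L : lang) (p : form L) : exists n, enum L n = p.
Proof.
  destruct (decode_surj L p) as (f & m & H). exists (to_nat (f, m)).
  unfold enum. rewrite cancel_of_to. now apply H.
Qed.

(** * Completeness *)

Section Completeness.
Context {L : lang} (T : theory L) (p0 : form L).
Hypothesis T_closed : forall q, T q -> free_below 0 q.
Hypothesis T_consistent : consistent (adjoin T p0).

(* The variables serve as Henkin witnesses: [stage n] mentions only variables
   below [fresh n], so [Var (fresh n)] is free to witness the n-th formula. *)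
Fixpoint used (n : nat) : nat :=
  match n with 0 => bound p0 | S n => S (max (used n) (bound (enum L n))) end.
Definition fresh (n : nat) : nat := max (used n) (bound (enum L n)).

Fixpoint stage (n : nat) : theory L :=
  match n with
  | 0 => adjoin T p0
  | S n => fun q => stage n q \/
      consistent (adjoin (stage n) (enum L n)) /\
      (q = enum L n \/
       exists r, enum L n = fNot (fAll r) /\ q = fNot (inst0 (Var (fresh n)) r))
  end.

Definition Delta : theory L := fun q => exists n, stage n q.

Lemma free_below_inst0 k (q : form L) :
  free_below k (fAll q) -> free_below (S k) (inst0 (Var k) q).
Proof.
  cbn. intros H.
  assert (G : forall (q : form L) m s, (forall n, n < m -> term_below (S k) (s n)) ->
    free_below m q -> free_below (S k) (subst s q)).
  { clear. generalize (S k). intros k' q. revert k'. induction q; intros k' m s Hs H; cbn in *.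
    - auto.
    - destruct t, t0; cbn in *; destruct H; auto.
    - destruct t, t0; cbn in *; destruct H; auto.
    - destruct H; eauto.
    - apply (IHq _ (S m)); auto. intros [|n] Hn; cbn; [lia|].
      specialize (Hs n ltac:(lia)). destruct (s n); cbn in *; auto. lia. }
  apply (G q (S k)); auto. intros [|n] Hn; cbn; lia.
Qed.

Lemma stage_below n : forall q, stage n q -> free_below (used n) q.
Proof.
  induction n as [|n IH]; cbn; intros q.
  - intros [Hq| ->]; [|apply free_below_bound].
    eapply free_below_mono; [|apply T_closed, Hq]. lia.
  - intros [Hq|(_ & [->|(r & E & ->)])].
    + eapply free_below_mono; [|apply IH, Hq]. lia.
    + eapply free_below_mono; [|apply free_below_bound]. lia.
    + fold (fresh n). unfold fNot. split; [|exact I].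
      apply free_below_inst0. 
      assert (H := free_below_bound (enum L n)). rewrite E in H.
      eapply free_below_mono with (l := fresh n) in H; [exact (proj1 H)|].
      unfold fresh. rewrite E. lia.
Qed.

Lemma stage_consistent n : consistent (stage n).
Proof.
  induction n as [|n IH]; [exact T_consistent|].
  destruct (classic (consistent (adjoin (stage n) (enum L n)))) as [C|C].
  2:{ intros H. apply IH. eapply proves_mono; [|exact H]. cbn. tauto. }
  destruct (classic (exists r, enum L n = fNot (fAll r))) as [(r & E)|E].
  - intros H. apply C.
    assert (H' : proves (adjoin (adjoin (stage n) (enum L n))
                           (fNot (inst0 (Var (fresh n)) r))) fBot).
    { eapply proves_mono; [|exact H]. unfold adjoin. cbn.
      intros q [Hq|(_ & [->|(r' & E' & ->)])]; auto.
      rewrite E in E'. inversion E'; subst r'. auto. }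
    apply proves_raa in H'. destruct H' as (G & HG & H').
    assert (B : forall q, adjoin (stage n) (enum L n) q -> free_below (fresh n) q).
    { unfold fresh. intros q [Hq| ->].
      - eapply free_below_mono; [|apply stage_below, Hq]. lia.
      - eapply free_below_mono; [|apply free_below_bound]. lia. }
    apply nd_generalize in H'; auto.
    2:{ assert (B' := B (enum L n) (or_intror eq_refl)). rewrite E in B'. exact (proj1 B'). }
    eapply proves_impE.
    + apply proves_ax. right. symmetry. exact E.
    + exists G. auto.
  - intros H. apply C. eapply proves_mono; [|exact H]. unfold adjoin. cbn.
    intros q [Hq|(_ & [->|(r' & E' & ->)])]; auto. destruct E; eauto.
Qed.

Lemma stage_mono n m q : n <= m -> stage n q -> stage m q.
Proof. induction 1; cbn; auto. Qed.

Lemma Delta_consistent : consistent Delta.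
Proof.
  intros (G & HG & H).
  assert (E : exists n, forall q, In q G -> stage n q).
  { clear H. induction G as [|q G IH].
    - exists 0. intros q [].
    - destruct IH as (n & Hn); [intros; apply HG; cbn; auto|].
      destruct (HG q) as (m & Hm); cbn; auto. exists (max n m).
      intros r [<-|Hr].
      + eapply stage_mono; [|exact Hm]. lia.
      + eapply stage_mono; [|apply Hn, Hr]. lia. }
  destruct E as (n & Hn). apply (stage_consistent n). exists G. auto.
Qed.

Lemma Delta_enum n : consistent (adjoin Delta (enum L n)) ->
  consistent (adjoin (stage n) (enum L n)).
Proof.
  intros C H. apply C. eapply proves_mono; [|exact H].
  intros q [Hq| ->]; [left; now exists n|now right].
Qed.

Lemma Delta_closed q : proves Delta q -> Delta q.
Proof.
  intros H. destruct (enum_surj L q) as (n & <-).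
  exists (S n). cbn. right. split; auto. apply Delta_enum. intros C.
  apply Delta_consistent. apply proves_impI in C. eapply proves_impE; eauto.
Qed.

Lemma Delta_complete q : ~ Delta q -> Delta (fNot q).
Proof.
  intros H. apply Delta_closed, proves_impI. apply NNPP. intros C. apply H.
  destruct (enum_surj L q) as (n & <-).
  exists (S n). cbn. right. split; auto. apply Delta_enum. exact C.
Qed.

Lemma Delta_witness q : Delta (fNot (fAll q)) -> exists t, Delta (fNot (inst0 t q)).
Proof.
  intros H. destruct (enum_surj L (fNot (fAll q))) as (n & E).
  exists (Var (fresh n)), (S n). cbn. right. split.
  - apply Delta_enum. intros C. apply Delta_consistent. apply proves_impI in C.
    eapply proves_impE; eauto. rewrite E. now apply proves_ax.
  - right. eauto.
Qed.

Lemma Delta_bot : ~ Delta fBot.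
Proof. intros H. apply Delta_consistent, proves_ax, H. Qed.

Lemma Delta_imp q r : Delta (fImp q r) <-> (Delta q -> Delta r).
Proof.
  split.
  - intros H1 H2. apply Delta_closed. eapply proves_impE; apply proves_ax; eauto.
  - intros H. destruct (classic (Delta q)) as [Hq|Hq].
    + apply Delta_closed, proves_impI, proves_ax. left; auto.
    + apply Delta_complete in Hq. apply Delta_closed, proves_impI, proves_raa.
      eapply proves_mono with (S := adjoin Delta q); [unfold adjoin; tauto|].
      eapply proves_impE; apply proves_ax; [left; exact Hq|now right].
Qed.

Lemma Delta_all q : Delta (fAll q) <-> forall t, Delta (inst0 t q).
Proof.
  split.
  - intros H t. apply Delta_closed, proves_allE, proves_ax, H.
  - intros H. apply NNPP. intros C. apply Delta_complete, Delta_witness in C.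
    destruct C as (t & C). apply Delta_bot. exact (proj1 (Delta_imp _ _) C (H t)).
Qed.

Definition teq (t u : term L) : Prop := Delta (fEq t u).

Lemma Delta_leibniz p t u : teq t u -> Delta (inst0 t p) -> Delta (inst0 u p).
Proof. intros H1 H2. apply Delta_closed. eapply proves_leibniz; apply proves_ax; eauto. Qed.

Lemma inst0_term_lift (t u : term L) :
  subst_term (fun n => match n with 0 => t | S k => Var k end) (lift_term u) = u.
Proof. destruct u; reflexivity. Qed.

Lemma teq_refl t : teq t t.
Proof. apply Delta_closed. exists []. split; [intros q []|apply nd_refl]. Qed.

Lemma teq_sym t u : teq t u -> teq u t.
Proof.
  intros H. assert (G := Delta_leibniz (fEq (Var 0) (lift_term t)) t u H).
  cbn in G. rewrite !inst0_term_lift in G. apply G, teq_refl.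
Qed.

Lemma teq_trans t u w : teq t u -> teq u w -> teq t w.
Proof.
  intros H1 H2. assert (G := Delta_leibniz (fEq (lift_term t) (Var 0)) u w H2).
  cbn in G. rewrite !inst0_term_lift in G. apply G, H1.
Qed.

Lemma Delta_mem_congr t t' u u' :
  teq t t' -> teq u u' -> Delta (fMem t u) -> Delta (fMem t' u').
Proof.
  intros H1 H2 H.
  assert (G := Delta_leibniz (fMem (Var 0) (lift_term u)) t t' H1).
  cbn in G. rewrite !inst0_term_lift in G.
  assert (G' := Delta_leibniz (fMem (lift_term t') (Var 0)) u u' H2).
  cbn in G'. rewrite !inst0_term_lift in G'. auto.
Qed.

Definition term_model : interp L :=
  {| dom := quot teq;
     imem := fun x y => exists t u, cls teq t = x /\ cls teq u = y /\ Delta (fMem t u);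
     icst := fun c => cls teq (Cst c) |}.

Lemma teq_cls t u : cls teq t = cls teq u <-> teq t u.
Proof. apply cls_eq; [apply teq_refl|apply teq_sym|apply teq_trans]. Qed.

Lemma val_term_model s t :
  val term_model (fun n => cls teq (s n)) t = cls teq (subst_term s t).
Proof. destruct t; reflexivity. Qed.

Lemma sat_term_model q : forall s,
  sat term_model (fun n => cls teq (s n)) q <-> Delta (subst s q).
Proof.
  induction q; intros s; cbn [sat subst].
  - split; [tauto|apply Delta_bot].
  - rewrite !val_term_model. apply teq_cls.
  - rewrite !val_term_model. cbn. split.
    + intros (a & b & Ha & Hb & H). apply teq_cls in Ha, Hb.
      eapply Delta_mem_congr; eauto.
    + intros H. eexists _, _. split; [reflexivity|split; [reflexivity|exact H]].
  - rewrite IHq1, IHq2. symmetry. apply Delta_imp.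
  - rewrite Delta_all.
    assert (E : forall t, sat term_model (cls teq t .: (fun n => cls teq (s n))) q
                          <-> Delta (inst0 t (subst (up s) q))).
    { intros t. rewrite subst_inst0_up, <- IHq.
      replace (fun n => cls teq ((t .: s) n)) with (cls teq t .: (fun n => cls teq (s n)));
        [tauto|]. apply functional_extensionality. now intros [|n]. }
    split.
    + intros H t. apply E, H.
    + intros H m. destruct (cls_surj teq m) as (t & <-). apply E, H.
Qed.

Lemma term_model_models : models term_model T /\ exists v, sat term_model v p0.
Proof.
  assert (H : forall q, adjoin T p0 q -> sat term_model (fun n => cls teq (Var n)) q).
  { intros q Hq. apply sat_term_model. rewrite subst_Var. exists 0. exact Hq. }
  split.
  - intros q Hq v.
    eapply (sat_below term_model q 0); [|apply T_closed, Hq|apply H; now left]. lia.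
  - eexists. apply H. now right.
Qed.
End Completeness.

Theorem completeness {L} (T : theory L) p :
  (forall q, T q -> free_below 0 q) ->
  (forall I : interp L, models I T -> forall v, sat I v p) -> proves T p.
Proof.
  intros HT H. apply NNPP. intros N.
  assert (C : consistent (adjoin T (fNot p))) by (intros C; apply N, proves_raa, C).
  destruct (term_model_models T (fNot p) HT C) as (H1 & v & H2).
  exact (H2 (H _ H1 v)).
Qed.

(** * Meaning of the set-theoretic formulas *)

Declare Scope model_scope.
Delimit Scope model_scope with model.
Notation "x ∈ y" := (imem _ x y) (at level 70) : model_scope.
Open Scope model_scope.

Section Meaning.
Context {L : lang} (I : interp L).
Implicit Types (v : nat -> I) (d : nat).

(* [x] denotes [m] at depth [d] in every environment obtained from [v] by
   entering further binders. *)
Definition St d v (x : tm L) (m : I) : Prop :=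
  forall k w, (forall i, w (k + i) = v i) -> val I w (x (k + d)) = m.

Lemma St_val d v x m : St d v x m -> val I v (x d) = m.
Proof. intros H. exact (H 0 v (fun _ => eq_refl)). Qed.

Lemma St_level d v m : St (S d) (m .: v) (level d) m.
Proof.
  intros k w H. unfold level. cbn. replace (k + S d - S d) with (k + 0) by lia. apply H.
Qed.

Lemma St_weak d v x m m' : St d v x m -> St (S d) (m' .: v) x m.
Proof.
  intros H k w Hw. replace (k + S d) with (S k + d) by lia. apply H. intros i.
  specialize (Hw (S i)). cbn in Hw. rewrite <- Hw. f_equal. lia.
Qed.

Lemma St_cst d v c : St d v (mCst c) (icst I c).
Proof. intros k w _. reflexivity. Qed.

Lemma sat_all d v F (P : I -> Prop) :
  (forall m, St (S d) (m .: v) (level d) m -> (sat I (m .: v) (F (level d) (S d)) <-> P m)) ->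
  (sat I v (mAll F d) <-> forall m, P m).
Proof.
  intros H. cbn. split; intros G m; apply (H m (St_level d v m)), G.
Qed.

Lemma sat_imp v p q P Q d : (sat I v (p d) <-> P) -> (sat I v (q d) <-> Q) ->
  (sat I v (mImp p q d) <-> (P -> Q)).
Proof. cbn. tauto. Qed.
Lemma sat_bot v d : sat I v (mBot d) <-> False.
Proof. cbn. tauto. Qed.
Lemma sat_not v p P d : (sat I v (p d) <-> P) -> (sat I v (mNot p d) <-> ~ P).
Proof. cbn. tauto. Qed.
Lemma sat_and v p q P Q d : (sat I v (p d) <-> P) -> (sat I v (q d) <-> Q) ->
  (sat I v (mAnd p q d) <-> (P /\ Q)).
Proof. cbn. tauto. Qed.
Lemma sat_or v p q P Q d : (sat I v (p d) <-> P) -> (sat I v (q d) <-> Q) ->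
  (sat I v (mOr p q d) <-> (P \/ Q)).
Proof. cbn. tauto. Qed.
Lemma sat_iff v p q P Q d : (sat I v (p d) <-> P) -> (sat I v (q d) <-> Q) ->
  (sat I v (mIff p q d) <-> (P <-> Q)).
Proof. cbn. tauto. Qed.
Lemma sat_ex d v F (P : I -> Prop) :
  (forall m, St (S d) (m .: v) (level d) m -> (sat I (m .: v) (F (level d) (S d)) <-> P m)) ->
  (sat I v (mEx F d) <-> exists m, P m).
Proof.
  intros H. cbn. split; intros G.
  - apply NNPP. intros N. apply G. intros m Hm. apply N. exists m.
    apply (H m (St_level d v m)), Hm.
  - destruct G as (m & G). intros N. apply (N m), (H m (St_level d v m)), G.
Qed.
Lemma sat_eq d v x y a b : St d v x a -> St d v y b -> (sat I v (mEq x y d) <-> a = b).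
Proof. intros H1 H2. cbn. now rewrite (St_val _ _ _ _ H1), (St_val _ _ _ _ H2). Qed.
Lemma sat_mem d v x y a b : St d v x a -> St d v y b -> (sat I v (mMem x y d) <-> a ∈ b).
Proof. intros H1 H2. cbn. now rewrite (St_val _ _ _ _ H1), (St_val _ _ _ _ H2). Qed.
End Meaning.

Ltac st := repeat first [eassumption | apply St_cst | apply St_weak].

Create HintDb sats.
Ltac sat_step :=
  cbv beta;
  lazymatch goal with
  | |- sat _ _ (mAll _ _) <-> _ => apply sat_all; intros
  | |- sat _ _ (mEx _ _) <-> _ => apply sat_ex; intros
  | |- sat _ _ (mAnd _ _ _) <-> _ => apply sat_and
  | |- sat _ _ (mOr _ _ _) <-> _ => apply sat_or
  | |- sat _ _ (mIff _ _ _) <-> _ => apply sat_iff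
  | |- sat _ _ (mNot _ _) <-> _ => apply sat_not
  | |- sat _ _ (mImp _ _ _) <-> _ => apply sat_imp
  | |- sat _ _ (mBot _) <-> _ => apply sat_bot
  | |- sat _ _ (mEq _ _ _) <-> _ => eapply sat_eq; st; fail
  | |- sat _ _ (mMem _ _ _) <-> _ => eapply sat_mem; st; fail
  | |- sat _ _ _ <-> _ => solve [eauto with sats nocore]
  end.

Ltac sats := intros; repeat sat_step.

Definition IsSet {L} (I : interp L) : I -> Prop :=
  match L return forall I : interp L, I -> Prop with
  | LZF => fun _ _ => True
  | LZFA => fun I x => ~ imem I x (icst (L := LZFA) I c_atoms)
  end I.
Arguments IsSet {L I} _.

Section Notions.
Context {L : lang} {I : interp L}.
Implicit Types (x y z p r f X Y : I).

Definition Empty x := IsSet x /\ forall z, ~ z ∈ x.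
Definition Subset x y := IsSet x /\ forall z, z ∈ x -> z ∈ y.
Definition UPair p a b := forall z : I, z ∈ p <-> z = a \/ z = b.
Definition OPair p a b := exists u v : I, UPair u a a /\ UPair v a b /\ UPair p u v.
Definition Rel r a b := exists p, OPair p a b /\ p ∈ r.
Definition Succ s n := forall z : I, z ∈ s <-> z ∈ n \/ z = n.
Definition Inductive_ w :=
  (exists e, Empty e /\ e ∈ w) /\ forall n : I, n ∈ w -> exists s, Succ s n /\ s ∈ w.
Definition Omega w := Inductive_ w /\ forall v, Inductive_ v -> Subset w v.
Fixpoint Numeral (n : nat) x : Prop :=
  match n with
  | 0 => Empty x
  | S k => exists y, Numeral k y /\ Succ x y
  end.
Definition Relation r X Y :=
  IsSet r /\ forall p, p ∈ r -> exists a b, a ∈ X /\ b ∈ Y /\ OPair p a b.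
Definition Function_ f X Y := Relation f X Y /\
  forall a, a ∈ X -> exists b, Rel f a b /\ forall c, Rel f a c -> c = b.
Definition Injection f X Y := Function_ f X Y /\
  forall a b c, Rel f a c /\ Rel f b c -> a = b.
Definition Bijection f X Y := Injection f X Y /\
  forall b, b ∈ Y -> exists a, Rel f a b.
Definition Finite X := IsSet X /\ exists w n f, Omega w /\ n ∈ w /\ Bijection f X n.
Definition Infinite X := IsSet X /\ ~ Finite X.
Definition DFinite X := IsSet X /\ ~ exists w f, Omega w /\ Injection f w X.
Definition MSubset m s X :=
  Subset s X /\ exists k f, Numeral m k /\ Bijection f s k.
Definition MSubsets m P X := IsSet P /\ forall s, s ∈ P <-> MSubset m s X.
Definition StrictLinear R Y :=
  Relation R Y Y /\ (forall a, ~ Rel R a a) /\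
  (forall a b c, Rel R a b /\ Rel R b c -> Rel R a c) /\
  (forall a b, a ∈ Y /\ b ∈ Y -> Rel R a b \/ a = b \/ Rel R b a).
Definition SameColor f (a1 b1 a2 b2 : I) :=
  exists p q c, UPair p a1 b1 /\ UPair q a2 b2 /\ Rel f p c /\ Rel f q c.
Definition CanonA f Y := forall a1 b1 a2 b2 : I,
  a1 ∈ Y /\ b1 ∈ Y /\ a2 ∈ Y /\ b2 ∈ Y /\ ~ a1 = b1 /\ ~ a2 = b2 -> SameColor f a1 b1 a2 b2.
Definition CanonB f Y R := forall a1 b1 a2 b2 : I,
  a1 ∈ Y /\ b1 ∈ Y /\ a2 ∈ Y /\ b2 ∈ Y /\ Rel R a1 b1 /\ Rel R a2 b2 ->
  (SameColor f a1 b1 a2 b2 <-> a1 = a2).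
Definition CanonC f Y R := forall a1 b1 a2 b2 : I,
  a1 ∈ Y /\ b1 ∈ Y /\ a2 ∈ Y /\ b2 ∈ Y /\ Rel R a1 b1 /\ Rel R a2 b2 ->
  (SameColor f a1 b1 a2 b2 <-> b1 = b2).
Definition CanonD f Y R := forall a1 b1 a2 b2 : I,
  a1 ∈ Y /\ b1 ∈ Y /\ a2 ∈ Y /\ b2 ∈ Y /\ Rel R a1 b1 /\ Rel R a2 b2 ->
  (SameColor f a1 b1 a2 b2 <-> (a1 = a2 /\ b1 = b2)).

Definition Canonical X f := exists Y R, Subset Y X /\ Infinite Y /\ StrictLinear R Y /\
  (CanonA f Y \/ CanonB f Y R \/ CanonC f Y R \/ CanonD f Y R).
End Notions.

Section MeaningNotions.
Context {L : lang} (I : interp L).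

Local Notation means1 p P := (forall d (v : nat -> I) x a,
  St I d v x a -> (sat I v (p x d) <-> P a)).
Local Notation means2 p P := (forall d (v : nat -> I) x y a b,
  St I d v x a -> St I d v y b -> (sat I v (p x y d) <-> P a b)).
Local Notation means3 p P := (forall d (v : nat -> I) x y z a b c,
  St I d v x a -> St I d v y b -> St I d v z c -> (sat I v (p x y z d) <-> P a b c)).

Lemma sat_is_set : means1 is_set IsSet.
Proof.
  intros d v x a H. destruct L; cbn; [tauto|].
  rewrite (St_val _ _ _ _ _ H). tauto.
Qed.
Hint Resolve sat_is_set : sats.
Hint Extern 1 (St _ _ _ _ _) => st : sats.

Lemma sat_is_empty : means1 is_empty Empty.
Proof. unfold is_empty, Empty. sats. Qed.
Hint Resolve sat_is_empty : sats.
Lemma sat_subset : means2 subset Subset.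
Proof. unfold subset, Subset. sats. Qed.
Hint Resolve sat_subset : sats.
Lemma sat_is_upair : means3 is_upair UPair.
Proof. unfold is_upair, UPair. sats. Qed.
Hint Resolve sat_is_upair : sats.
Lemma sat_is_opair : means3 is_opair OPair.
Proof. unfold is_opair, OPair. sats. Qed.
Hint Resolve sat_is_opair : sats.
Lemma sat_rel : means3 rel Rel.
Proof. unfold rel, Rel. sats. Qed.
Hint Resolve sat_rel : sats.
Lemma sat_is_succ : means2 is_succ Succ.
Proof. unfold is_succ, Succ. sats. Qed.
Hint Resolve sat_is_succ : sats.
Lemma sat_is_inductive : means1 is_inductive Inductive_.
Proof. unfold is_inductive, Inductive_. sats. Qed.
Hint Resolve sat_is_inductive : sats.
Lemma sat_is_omega : means1 is_omega Omega.
Proof. unfold is_omega, Omega. sats. Qed.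
Hint Resolve sat_is_omega : sats.
Lemma sat_is_numeral n : means1 (is_numeral n) (Numeral n).
Proof. induction n; cbn [is_numeral Numeral]; sats. Qed.
Hint Resolve sat_is_numeral : sats.
Lemma sat_is_relation : means3 is_relation Relation.
Proof. unfold is_relation, Relation. sats. Qed.
Hint Resolve sat_is_relation : sats.
Lemma sat_is_function : means3 is_function Function_.
Proof. unfold is_function, Function_. sats. Qed.
Hint Resolve sat_is_function : sats.
Lemma sat_is_injection : means3 is_injection Injection.
Proof. unfold is_injection, Injection. sats. Qed.
Hint Resolve sat_is_injection : sats.
Lemma sat_is_bijection : means3 is_bijection Bijection.
Proof. unfold is_bijection, Bijection. sats. Qed.
Hint Resolve sat_is_bijection : sats.
Lemma sat_finite : means1 finite Finite.
Proof. unfold finite, Finite. sats. Qed.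
Hint Resolve sat_finite : sats.
Lemma sat_infinite : means1 infinite Infinite.
Proof. unfold infinite, Infinite. sats. Qed.
Hint Resolve sat_infinite : sats.
Lemma sat_dedekind_finite : means1 dedekind_finite DFinite.
Proof. unfold dedekind_finite, DFinite. sats. Qed.
Hint Resolve sat_dedekind_finite : sats.
Lemma sat_is_msubset m : means2 (is_msubset m) (MSubset m).
Proof. unfold is_msubset, MSubset. sats. Qed.
Hint Resolve sat_is_msubset : sats.
Lemma sat_is_msubsets m : means2 (is_msubsets m) (MSubsets m).
Proof. unfold is_msubsets, MSubsets. sats. Qed.
Hint Resolve sat_is_msubsets : sats.
Lemma sat_strict_linear_order : means2 strict_linear_order StrictLinear.
Proof. unfold strict_linear_order, StrictLinear. sats. Qed.
Hint Resolve sat_strict_linear_order : sats.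
Lemma sat_same_color d (v : nat -> I) f x1 y1 x2 y2 g a1 b1 a2 b2 :
  St I d v f g -> St I d v x1 a1 -> St I d v y1 b1 -> St I d v x2 a2 -> St I d v y2 b2 ->
  (sat I v (same_color f x1 y1 x2 y2 d) <-> SameColor g a1 b1 a2 b2).
Proof. unfold same_color, SameColor. sats. Qed.
Hint Resolve sat_same_color : sats.
Lemma sat_canonical_a : means2 canonical_a CanonA.
Proof. unfold canonical_a, CanonA. sats. Qed.
Lemma sat_canonical_b : means3 canonical_b CanonB.
Proof. unfold canonical_b, CanonB. sats. Qed.
Lemma sat_canonical_c : means3 canonical_c CanonC.
Proof. unfold canonical_c, CanonC. sats. Qed.
Lemma sat_canonical_d : means3 canonical_d CanonD.
Proof. unfold canonical_d, CanonD. sats. Qed.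
Hint Resolve sat_canonical_a sat_canonical_b sat_canonical_c sat_canonical_d : sats.

Lemma sat_OP (v : nat -> I) :
  sat I v OP <-> forall X : I, IsSet X -> exists R, StrictLinear R X.
Proof. unfold OP, close. sats. Qed.

Lemma sat_RT (v : nat -> I) m n :
  sat I v (RT m n) <-> forall X P N chi : I,
    Infinite X /\ MSubsets m P X /\ Numeral n N /\ Function_ chi P N ->
    exists Y, Subset Y X /\ Infinite Y /\
      exists c, c ∈ N /\ forall s, MSubset m s Y -> Rel chi s c.
Proof. unfold RT, close. sats. Qed.

Lemma sat_DF_eq_F (v : nat -> I) :
  sat I v DF_eq_F <-> forall X : I, DFinite X -> Finite X.
Proof. unfold DF_eq_F, close. sats. Qed.

Lemma sat_CRT (v : nat -> I) :
  sat I v CRT <-> forall X P C f : I,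
    Infinite X /\ MSubsets 2 P X /\ IsSet C /\ Function_ f P C -> Canonical X f.
Proof. unfold CRT, Canonical, close. sats. Qed.

Lemma sat_extensionality (v : nat -> I) :
  sat I v extensionality <-> forall x y : I, IsSet x /\ IsSet y ->
    (forall z, z ∈ x <-> z ∈ y) -> x = y.
Proof. unfold extensionality, close. sats. Qed.
Lemma sat_pairing (v : nat -> I) :
  sat I v pairing <-> forall a b : I, exists c : I, forall z, z ∈ c <-> z = a \/ z = b.
Proof. unfold pairing, close. sats. Qed.
Lemma sat_union (v : nat -> I) :
  sat I v union <-> forall x : I, exists u : I, forall z, z ∈ u <-> exists y, y ∈ x /\ z ∈ y.
Proof. unfold union, close. sats. Qed.
Lemma sat_power_set (v : nat -> I) :
  sat I v power_set <-> forall x : I, exists p : I, forall z, z ∈ p <-> Subset z x.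
Proof. unfold power_set, close. sats. Qed.
Lemma sat_infinity (v : nat -> I) : sat I v infinity <-> exists w : I, Inductive_ w.
Proof. unfold infinity, close. sats. Qed.
Lemma sat_regularity (v : nat -> I) :
  sat I v regularity <-> forall x : I, (exists y, y ∈ x) ->
    exists y, y ∈ x /\ forall z, ~ (z ∈ x /\ z ∈ y).
Proof. unfold regularity, close. sats. Qed.

Lemma sat_separation (v : nat -> I) p :
  sat I v (separation p) <-> forall x : I, exists y : I, forall z,
    z ∈ y <-> z ∈ x /\ sat I (z .: v) p.
Proof.
  unfold separation, close. repeat sat_step.
  unfold inst. rewrite sat_subst.
  replace (fun n => val I (m1 .: m0 .: m .: v) _) with (m1 .: v); [tauto|].
  apply functional_extensionality. intros [|n]; cbn.
  - reflexivity.
  - rewrite Nat.sub_0_r. now destruct n.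
Qed.

Lemma sat_replacement (v : nat -> I) p :
  sat I v (replacement p) <->
  ((forall x y z : I, sat I (x .: y .: v) p /\ sat I (x .: z .: v) p -> y = z) ->
   forall X : I, exists Y : I, forall y, y ∈ Y <-> exists x, x ∈ X /\ sat I (x .: y .: v) p).
Proof.
  assert (E : forall k (w : nat -> I) a b (ta tb : tm L),
    (forall i, w (k + i) = v i) -> val I w (ta k) = a -> val I w (tb k) = b ->
    (sat I w (inst p [ta; tb] k) <-> sat I (a .: b .: v) p)).
  { intros k w a b ta tb Hw Ha Hb. unfold inst. rewrite sat_subst.
    replace (fun n => val I w _) with (a .: b .: v); [tauto|].
    apply functional_extensionality. intros [|[|n]]; cbn; auto.
    rewrite Nat.sub_0_r, <- Hw. now destruct n. }
  unfold replacement, close. repeat sat_step; apply E; auto.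
Qed.
End MeaningNotions.

(** * Definability with parameters *)

Section Definability.
Context {L : lang} {I : interp L}.
Implicit Types (v w : nat -> I).

Definition look (s : nat + I) v : I := match s with inl n => v n | inr m => m end.

(* [s] sends each variable of [p] to an argument or to a parameter. *)
Definition DE (P : (nat -> I) -> Prop) : Prop :=
  exists p (s : nat -> nat + I), forall v, P v <-> sat I (fun n => look (s n) v) p.
Definition DTm (t : (nat -> I) -> I) : Prop :=
  DE (fun w => w 0 = t (fun n => w (S n))).

Lemma DE_iff (P Q : (nat -> I) -> Prop) : (forall v, P v <-> Q v) -> DE Q -> DE P.
Proof. intros E (p & s & H). exists p, s. intros v. now rewrite E. Qed.

Lemma DE_const (A : Prop) : DE (fun _ => A).
Proof.
  destruct (classic A) as [H|H].
  - exists (fImp fBot fBot), (fun n => inl n). cbn. tauto.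
  - exists fBot, (fun n => inl n). cbn. tauto.
Qed.

Lemma DE_imp (P Q : (nat -> I) -> Prop) : DE P -> DE Q -> DE (fun v => P v -> Q v).
Proof.
  intros (p & s & Hp) (q & r & Hq).
  exists (fImp (subst (fun n => Var (2 * n)) p) (subst (fun n => Var (2 * n + 1)) q)).
  exists (fun n => if Nat.even n then s (Nat.div2 n) else r (Nat.div2 n)).
  intros v. cbn [sat]. rewrite !sat_subst. cbn [val].
  erewrite (sat_below I p) by (try apply free_below_bound; intros n _;
    rewrite Nat.even_even, Nat.div2_double; reflexivity).
  erewrite (sat_below I q) by (try apply free_below_bound; intros n _;
    rewrite Nat.even_odd, Nat.add_1_r, Nat.div2_succ_double; reflexivity).
  rewrite <- Hp, <- Hq. tauto.
Qed.

Lemma DE_all (P : (nat -> I) -> I -> Prop) :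
  DE (fun w => P (fun n => w (S n)) (w 0)) -> DE (fun v => forall x, P v x).
Proof.
  intros (p & s & Hp).
  exists (fAll (subst (fun n => match s n with inl 0 => Var 0 | _ => Var (S n) end) p)).
  exists (fun n => match s n with inl (S k) => inl k | inl 0 => inl 0 | inr m => inr m end).
  intros v. cbn [sat].
  assert (E : forall x, P v x <-> sat I (x .: (fun n => look
    match s n with inl (S k) => inl k | inl 0 => inl 0 | inr m => inr m end v))
    (subst (fun n => match s n with inl 0 => Var 0 | _ => Var (S n) end) p)).
  { intros x. rewrite sat_subst. specialize (Hp (x .: v)).
    change (P v x <-> sat I (fun n => look (s n) (x .: v)) p) in Hp. rewrite Hp.
    apply (sat_below I p (bound p)); [|apply free_below_bound].
    intros n _. destruct (s n) as [[|k]|m] eqn:E; cbn; rewrite ?E; reflexivity. }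
  firstorder.
Qed.

Lemma DE_not (P : (nat -> I) -> Prop) : DE P -> DE (fun v => ~ P v).
Proof. intros H. apply (DE_imp P (fun _ => False) H (DE_const False)). Qed.

Lemma DE_and (P Q : (nat -> I) -> Prop) : DE P -> DE Q -> DE (fun v => P v /\ Q v).
Proof.
  intros H1 H2. apply (DE_iff _ (fun v => ~ (P v -> ~ Q v))); [intros; tauto|].
  apply DE_not, DE_imp, DE_not; auto.
Qed.

Lemma DE_or (P Q : (nat -> I) -> Prop) : DE P -> DE Q -> DE (fun v => P v \/ Q v).
Proof.
  intros H1 H2. apply (DE_iff _ (fun v => ~ P v -> Q v)); [intros; tauto|].
  apply DE_imp; auto. now apply DE_not.
Qed.

Lemma DE_equiv (P Q : (nat -> I) -> Prop) : DE P -> DE Q -> DE (fun v => P v <-> Q v).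
Proof. intros. apply DE_and; apply DE_imp; auto. Qed.

Lemma DE_ex (P : (nat -> I) -> I -> Prop) :
  DE (fun w => P (fun n => w (S n)) (w 0)) -> DE (fun v => exists x, P v x).
Proof.
  intros H. apply (DE_iff _ (fun v => ~ forall x, ~ P v x)).
  - intros v. split; [firstorder|]. intros N. apply NNPP. firstorder.
  - apply DE_not, DE_all, DE_not, H.
Qed.

Lemma DE_ren (P : (nat -> I) -> Prop) (r : nat -> nat + I) :
  DE P -> DE (fun v => P (fun n => look (r n) v)).
Proof.
  intros (p & s & H).
  exists p, (fun n => match s n with inl k => r k | inr m => inr m end).
  intros v. rewrite H. apply (sat_below I p (bound p)); [|apply free_below_bound].
  intros n _. destruct (s n); reflexivity.
Qed.

Lemma DTm_var n : DTm (fun v => v n).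
Proof.
  exists (fEq (Var 0) (Var 1)), (fun i => match i with 0 => inl 0 | _ => inl (S n) end).
  intros v. cbn. tauto.
Qed.

Lemma DTm_const m : DTm (fun _ => m).
Proof.
  exists (fEq (Var 0) (Var 1)), (fun i => match i with 0 => inl 0 | _ => inr m end).
  intros v. cbn. tauto.
Qed.

Lemma DTm_shift t k : DTm t -> DTm (fun v => t (fun n => v (k + n))).
Proof.
  intros H. apply (DE_ren _ (fun n => inl (match n with 0 => 0 | S n => S (k + n) end)) H).
Qed.

Definition D1 (P : I -> Prop) := DE (fun v => P (v 0)).
Definition D2 (P : I -> I -> Prop) := DE (fun v => P (v 0) (v 1)).
Definition D3 (P : I -> I -> I -> Prop) := DE (fun v => P (v 0) (v 1) (v 2)).
Definition D4 (P : I -> I -> I -> I -> Prop) := DE (fun v => P (v 0) (v 1) (v 2) (v 3)).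

Lemma D4_app P t u (w x : (nat -> I) -> I) : D4 P -> DTm t -> DTm u -> DTm w -> DTm x ->
  DE (fun v => P (t v) (u v) (w v) (x v)).
Proof.
  intros HP Ht Hu Hw Hx.
  apply (DE_iff _ (fun v => exists x', x' = t v /\ P x' (u v) (w v) (x v))).
  - intros v. split; [eauto|]. now intros (? & -> & H).
  - apply DE_ex, DE_and; [exact Ht|].
    apply (DE_iff _ (fun v => exists y, y = u (fun n => v (S n)) /\
      exists z, z = w (fun n => v (S n)) /\
      exists z', z' = x (fun n => v (S n)) /\ P (v 0) y z z')).
    { intros v. split; [eauto 8|]. now intros (? & -> & ? & -> & ? & -> & H). }
    apply DE_ex, DE_and; [exact (DTm_shift u 1 Hu)|].
    apply DE_ex, DE_and; [exact (DTm_shift w 2 Hw)|].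
    apply DE_ex, DE_and; [exact (DTm_shift x 3 Hx)|].
    apply (DE_ren _ (fun n => inl (3 - n)) HP).
Qed.

Lemma D3_app P t u (w : (nat -> I) -> I) :
  D3 P -> DTm t -> DTm u -> DTm w -> DE (fun v => P (t v) (u v) (w v)).
Proof. intros H Ht Hu Hw. exact (D4_app (fun x y z _ => P x y z) t u w w H Ht Hu Hw Hw). Qed.

Lemma D2_app P t u : D2 P -> DTm t -> DTm u -> DE (fun v => P (t v) (u v)).
Proof. intros H Ht Hu. exact (D4_app (fun x y _ _ => P x y) t u u u H Ht Hu Hu Hu). Qed.

Lemma D1_app P t : D1 P -> DTm t -> DE (fun v => P (t v)).
Proof. intros H Ht. exact (D4_app (fun x _ _ _ => P x) t t t t H Ht Ht Ht Ht). Qed.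

Lemma DE_eq t u : DTm t -> DTm u -> DE (fun v => t v = u v).
Proof.
  apply (D2_app (fun x y => x = y)).
  exists (fEq (Var 0) (Var 1)), (fun n => inl n). cbn. tauto.
Qed.

Lemma DE_mem t u : DTm t -> DTm u -> DE (fun v => t v ∈ u v).
Proof.
  apply (D2_app (fun x y => x ∈ y)).
  exists (fMem (Var 0) (Var 1)), (fun n => inl n). cbn. tauto.
Qed.

Lemma D1_form P (m0 : I) : D1 P ->
  exists p (v : nat -> I), forall x, P x <-> sat I (x .: v) p.
Proof.
  intros (p & s & H).
  exists (subst (fun n => match s n with inl _ => Var 0 | inr _ => Var (S n) end) p).
  exists (fun n => match s n with inl _ => m0 | inr m => m end).
  intros x. specialize (H (fun _ => x)). cbn in H. rewrite H, sat_subst.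
  apply (sat_below I p (bound p)); [|apply free_below_bound].
  intros n _. destruct (s n) as [k|m] eqn:E; cbn; rewrite ?E; reflexivity.
Qed.
End Definability.

Ltac dfn_tm := fail.
Ltac dfn_atom := fail.
Ltac dfn1 :=
  cbv beta;
  lazymatch goal with
  | |- D1 _ => unfold D1
  | |- D2 _ => unfold D2
  | |- D3 _ => unfold D3
  | |- D4 _ => unfold D4
  | |- DTm _ => first [assumption | apply DTm_const | apply DTm_var | dfn_tm]
  | |- DE _ =>
      first
        [ apply DE_const | apply DE_not
        | apply DE_and | apply DE_or | apply DE_equiv
        | apply DE_mem | apply DE_eq | dfn_atom
        | apply DE_ex | apply DE_imp | apply DE_all
        | (eapply D1_app; [eassumption|]) | (eapply D2_app; [eassumption| |])
        | (eapply D3_app; [eassumption| | |]) | (eapply D4_app; [eassumption| | | |]) ]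
  end.
Ltac dfn := repeat dfn1.

Lemma DE_IsSet {L} {I : interp L} t : DTm t -> DE (fun v => @IsSet L I (t v)).
Proof. destruct L; cbn; intros; dfn. Qed.
Ltac dfn_atom ::= apply DE_IsSet.

(** * Set theory inside a model *)

(* The common part of ZF and ZFA. *)
Class SetModel {L} (I : interp L) : Prop :=
  { sm_zf : models I zf_axiom;
    sm_set : forall x y : I, x ∈ y -> IsSet y;
    sm_empty : exists e : I, Empty e }.

Section Sets.
Context {L : lang} {I : interp L} {SM : SetModel I}.
Implicit Types (x y z a b c r f X Y Z n m k : I).

Definition emp : I := proj1_sig (constructive_indefinite_description _ sm_empty).
Lemma Empty_emp : Empty emp.
Proof. unfold emp. destruct constructive_indefinite_description; auto. Qed.
Lemma in_emp x : ~ x ∈ emp.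
Proof. apply Empty_emp. Qed.

Let v0 : nat -> I := fun _ => emp.

Lemma ext x y : IsSet x -> IsSet y -> (forall z, z ∈ x <-> z ∈ y) -> x = y.
Proof.
  intros H1 H2. apply (proj1 (sat_extensionality I v0) (sm_zf _ ax_extensionality v0)); auto.
Qed.

Lemma pairing_ex a b : exists c, forall z, z ∈ c <-> z = a \/ z = b.
Proof. exact (proj1 (sat_pairing I v0) (sm_zf _ ax_pairing v0) a b). Qed.
Definition upair a b : I := proj1_sig (constructive_indefinite_description _ (pairing_ex a b)).
Lemma in_upair a b z : z ∈ upair a b <-> z = a \/ z = b.
Proof. unfold upair. destruct constructive_indefinite_description; auto. Qed.
Lemma IsSet_upair a b : IsSet (upair a b).
Proof. apply (sm_set a). apply in_upair. auto. Qed.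

Lemma separation_ex (P : I -> Prop) x : D1 P ->
  exists y, IsSet y /\ forall z, z ∈ y <-> z ∈ x /\ P z.
Proof.
  intros HP. destruct (D1_form P emp HP) as (p & v & E).
  assert (H := forall_closure_sat I _ _ v0 (free_below_bound (separation p))
    (sm_zf _ (ax_separation (free_below_bound (separation p))) v0) v).
  destruct (proj1 (sat_separation I v p) H x) as (y & Hy).
  destruct (classic (exists z, z ∈ y)) as [(z & Hz)|N].
  - exists y. split; [exact (sm_set _ _ Hz)|]. intros u. rewrite E. apply Hy.
  - exists emp. split; [apply Empty_emp|]. intros z. split.
    + now intros H1%in_emp.
    + intros (H1 & H2). destruct N. exists z. apply Hy. now rewrite <- E.
Qed.
Definition cmp (x : I) (P : I -> Prop) : I :=
  epsilon (inhabits emp) (fun y => IsSet y /\ forall z, z ∈ y <-> z ∈ x /\ P z).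
Lemma in_cmp P x z : D1 P -> (z ∈ cmp x P <-> z ∈ x /\ P z).
Proof.
  intros H. unfold cmp. apply (epsilon_spec (inhabits emp) _ (separation_ex P x H)).
Qed.
Lemma IsSet_cmp P x : D1 P -> IsSet (cmp x P).
Proof.
  intros H. unfold cmp. apply (epsilon_spec (inhabits emp) _ (separation_ex P x H)).
Qed.

Lemma union_ex x : exists u, forall z, z ∈ u <-> exists y, y ∈ x /\ z ∈ y.
Proof. exact (proj1 (sat_union I v0) (sm_zf _ ax_union v0) x). Qed.

Lemma cup_ex a b : exists u, IsSet u /\ forall z, z ∈ u <-> z ∈ a \/ z ∈ b.
Proof.
  destruct (union_ex (upair a b)) as (u & Hu).
  assert (H : forall z, z ∈ u <-> z ∈ a \/ z ∈ b).
  { intros z. rewrite Hu. split.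
    - intros (y & [->| ->]%in_upair & Hy); auto.
    - intros [Hz|Hz]; [exists a|exists b]; rewrite in_upair; auto. }
  destruct (classic (exists z, z ∈ u)) as [(z & Hz)|N].
  - exists u. split; [exact (sm_set _ _ Hz)|auto].
  - exists emp. split; [apply Empty_emp|]. intros z. rewrite <- H. split.
    + now intros H1%in_emp.
    + intros Hz. destruct N. eauto.
Qed.
Definition cup a b : I := proj1_sig (constructive_indefinite_description _ (cup_ex a b)).
Lemma in_cup a b z : z ∈ cup a b <-> z ∈ a \/ z ∈ b.
Proof. unfold cup. destruct constructive_indefinite_description as (u & H1 & H2); auto. Qed.
Lemma IsSet_cup a b : IsSet (cup a b).
Proof. unfold cup. destruct constructive_indefinite_description as (u & H1 & H2); auto. Qed.

Lemma power_ex x : exists p, forall z, z ∈ p <-> Subset z x.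
Proof. exact (proj1 (sat_power_set I v0) (sm_zf _ ax_power_set v0) x). Qed.
Definition pow x : I := proj1_sig (constructive_indefinite_description _ (power_ex x)).
Lemma in_pow x z : z ∈ pow x <-> Subset z x.
Proof. unfold pow. destruct constructive_indefinite_description; auto. Qed.

Lemma mem_irrefl x : ~ x ∈ x.
Proof.
  intros H.
  destruct (proj1 (sat_regularity I v0) (sm_zf _ ax_regularity v0) (upair x x)) as (y & Hy & N).
  - exists x. apply in_upair. auto.
  - apply in_upair in Hy. assert (y = x) as -> by tauto. apply (N x). rewrite in_upair. auto.
Qed.

Definition sing a := upair a a.
Lemma in_sing a z : z ∈ sing a <-> z = a.
Proof. unfold sing. rewrite in_upair. tauto. Qed.

Definition opair a b := upair (sing a) (upair a b).
Lemma upair_inj a b c d : upair a b = upair c d -> (a = c /\ b = d) \/ (a = d /\ b = c).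
Proof.
  intros H. assert (E : forall z, z = a \/ z = b <-> z = c \/ z = d)
    by (intros z; rewrite <- !in_upair; rewrite H; tauto).
  destruct (proj1 (E a) (or_introl eq_refl)) as [H1|H1];
  destruct (proj1 (E b) (or_intror eq_refl)) as [H2|H2];
  destruct (proj2 (E c) (or_introl eq_refl)) as [H3|H3];
  destruct (proj2 (E d) (or_intror eq_refl)) as [H4|H4]; subst; auto.
Qed.
Lemma opair_inj a b c d : opair a b = opair c d <-> a = c /\ b = d.
Proof.
  split; [|now intros (-> & ->)].
  intros [(H1 & H2)|(H1 & H2)]%upair_inj; apply upair_inj in H1, H2;
    intuition congruence.
Qed.

Lemma UPair_iff p a b : UPair p a b <-> p = upair a b.
Proof.
  split.
  - intros H. apply ext.
    + apply (sm_set a). apply H. auto.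
    + apply IsSet_upair.
    + intros z. rewrite in_upair. apply H.
  - intros -> z. apply in_upair.
Qed.
Lemma upair_comm a b : upair a b = upair b a.
Proof. apply UPair_iff. intros z. rewrite in_upair. tauto. Qed.
Lemma OPair_iff p a b : OPair p a b <-> p = opair a b.
Proof.
  unfold OPair, opair. split.
  - intros (u & v & Hu & Hv & Hp). apply UPair_iff in Hu, Hv, Hp. now subst.
  - intros ->. exists (sing a), (upair a b). rewrite !UPair_iff. auto.
Qed.
Lemma Rel_iff r a b : Rel r a b <-> opair a b ∈ r.
Proof.
  unfold Rel. split.
  - now intros (p & ->%OPair_iff & Hp).
  - intros H. exists (opair a b). split; auto. now apply OPair_iff.
Qed.

Lemma DTm_upair t u : DTm t -> DTm u -> DTm (fun v => upair (t v) (u v)).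
Proof.
  intros. apply (DE_iff _ (fun w =>
    UPair (w 0) (t (fun i : nat => w (S i))) (u (fun i : nat => w (S i))))).
  { intros w. symmetry. apply UPair_iff. }
  apply (D3_app UPair); [unfold UPair; dfn|dfn|exact (DTm_shift t 1 H)|exact (DTm_shift u 1 H0)].
Qed.
Lemma DTm_opair t u : DTm t -> DTm u -> DTm (fun v => opair (t v) (u v)).
Proof. intros. repeat apply DTm_upair; auto. Qed.

Lemma DE_Rel (r t u : (nat -> I) -> I) : DTm r -> DTm t -> DTm u ->
  DE (fun v => Rel (r v) (t v) (u v)).
Proof.
  intros. apply (DE_iff _ (fun v => opair (t v) (u v) ∈ r v)).
  - intros v. apply Rel_iff.
  - apply DE_mem; auto. now apply DTm_opair.
Qed.

Definition succ n := cup n (sing n).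
Lemma in_succ n z : z ∈ succ n <-> z ∈ n \/ z = n.
Proof. unfold succ. rewrite in_cup, in_sing. tauto. Qed.
Lemma IsSet_succ n : IsSet (succ n).
Proof. apply IsSet_cup. Qed.
Lemma Succ_iff s n : Succ s n <-> s = succ n.
Proof.
  split.
  - intros H. apply ext; auto using IsSet_succ.
    + apply (sm_set n). apply H. auto.
    + intros z. rewrite in_succ. apply H.
  - intros -> z. apply in_succ.
Qed.
Lemma DTm_succ t : DTm t -> DTm (fun v => succ (t v)).
Proof.
  intros. apply (DE_iff _ (fun w => Succ (w 0) (t (fun i : nat => w (S i))))).
  { intros w. symmetry. apply Succ_iff. }
  apply (D2_app Succ); [unfold Succ; dfn|dfn|exact (DTm_shift t 1 H)].
Qed.
End Sets.

Ltac dfn_tm ::= first [apply DTm_upair | apply DTm_opair | apply DTm_succ].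
Ltac dfn_atom ::= first [apply DE_IsSet | apply DE_Rel].

Section Sets2.
Context {L : lang} {I : interp L} {SM : SetModel I}.
Implicit Types (x y z a b c r f X Y Z n m k : I).

Definition mkrel X Y (Q : I -> I -> Prop) : I :=
  cmp (pow (pow (cup X Y)))
    (fun p => exists a b, a ∈ X /\ b ∈ Y /\ p = opair a b /\ Q a b).

Lemma mkrel_D (X Y : I) Q : D2 Q ->
  D1 (fun p => exists a b, a ∈ X /\ b ∈ Y /\ p = opair a b /\ Q a b).
Proof. intros. dfn. Qed.

Lemma Rel_mkrel X Y Q a b : D2 Q -> (Rel (mkrel X Y Q) a b <-> a ∈ X /\ b ∈ Y /\ Q a b).
Proof.
  intros HQ. rewrite Rel_iff. unfold mkrel. rewrite in_cmp by now apply mkrel_D.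
  split.
  - intros (_ & a' & b' & Ha & Hb & E & H). apply opair_inj in E as (-> & ->). auto.
  - intros (Ha & Hb & H). split; [|now exists a, b].
    apply in_pow. split; [apply IsSet_upair|]. intros z Hz. apply in_pow.
    unfold opair in Hz. apply in_upair in Hz.
    destruct Hz as [->| ->]; (split; [apply IsSet_upair|]); intros u;
      rewrite ?in_sing, ?in_upair, in_cup; [intros ->|intros [->| ->]]; auto.
Qed.

Lemma Relation_mkrel X Y Q : D2 Q -> Relation (mkrel X Y Q) X Y.
Proof.
  intros HQ. split; [apply IsSet_cmp, mkrel_D, HQ|].
  intros p. unfold mkrel. rewrite in_cmp by now apply mkrel_D.
  intros (_ & a & b & Ha & Hb & E & _). exists a, b. rewrite OPair_iff. auto.
Qed.

Lemma Relation_Rel r X Y a b : Relation r X Y -> Rel r a b -> a ∈ X /\ b ∈ Y.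
Proof.
  intros (_ & H) Hr%Rel_iff. destruct (H _ Hr) as (a' & b' & Ha & Hb & E%OPair_iff).
  apply opair_inj in E as (-> & ->). auto.
Qed.

Lemma Function_mkrel X Y Q : D2 Q ->
  (forall a, a ∈ X -> exists b, b ∈ Y /\ Q a b /\ forall c, Q a c -> c = b) ->
  Function_ (mkrel X Y Q) X Y.
Proof.
  intros HQ H. split; [now apply Relation_mkrel|].
  intros a Ha. destruct (H a Ha) as (b & Hb & HQb & U). exists b.
  rewrite Rel_mkrel by auto. split; auto. intros c. rewrite Rel_mkrel by auto.
  intros (_ & _ & Hc). auto.
Qed.

Lemma Injection_mkrel X Y Q : D2 Q ->
  (forall a, a ∈ X -> exists b, b ∈ Y /\ Q a b /\ forall c, Q a c -> c = b) ->
  (forall a b c, a ∈ X -> b ∈ X -> Q a c -> Q b c -> a = b) ->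
  Injection (mkrel X Y Q) X Y.
Proof.
  intros HQ H1 H2. split; [now apply Function_mkrel|].
  intros a b c. rewrite !Rel_mkrel by auto. intros ((?&?&?)&(?&?&?)). eauto.
Qed.

Lemma Function_unique f X Y a b c : Function_ f X Y -> Rel f a b -> Rel f a c -> b = c.
Proof.
  intros (HR & HF) Hb Hc. destruct (Relation_Rel _ _ _ _ _ HR Hb) as (Ha & _).
  destruct (HF a Ha) as (d & _ & U). rewrite (U b Hb), (U c Hc). reflexivity.
Qed.

(** * The natural numbers *)

Lemma Inductive_iff w : Inductive_ w <-> emp ∈ w /\ forall n, n ∈ w -> succ n ∈ w.
Proof.
  unfold Inductive_. split.
  - intros ((e & He & Hw) & H). split.
    + replace emp with e; auto. apply ext; [apply He|apply Empty_emp|].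
      intros z. destruct He as (_ & He). split; [now intros ?%He|now intros ?%in_emp].
    + intros n (s & ->%Succ_iff & Hs)%H. auto.
  - intros (H1 & H2). split.
    + exists emp. split; auto. apply Empty_emp.
    + intros n Hn. exists (succ n). rewrite Succ_iff. auto.
Qed.

Lemma omega_ex : exists w : I, Omega w.
Proof.
  destruct (proj1 (sat_infinity I (fun _ => emp)) (sm_zf _ ax_infinity _)) as (w & Hw).
  assert (D : D1 (fun n : I => forall v, Inductive_ v -> n ∈ v)).
  { unfold Inductive_, Empty, Succ. dfn. }
  exists (cmp w (fun n => forall v, Inductive_ v -> n ∈ v)). split.
  - apply Inductive_iff. rewrite !in_cmp by auto. apply Inductive_iff in Hw as Hw'. split.
    + split; [apply Hw'|]. intros v Hv. now apply Inductive_iff in Hv.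
    + intros n. rewrite !in_cmp by auto. intros (H1 & H2). split; [now apply Hw'|].
      intros v Hv. apply Inductive_iff in Hv as Hv'. apply Hv'. auto.
  - intros v Hv. split; [now apply IsSet_cmp|]. intros z. rewrite in_cmp by auto.
    intros (_ & H). auto.
Qed.
Definition om : I := proj1_sig (constructive_indefinite_description _ omega_ex).
Lemma Omega_om : Omega om.
Proof. unfold om. destruct constructive_indefinite_description; auto. Qed.
Lemma Omega_iff w : Omega w <-> w = om.
Proof.
  split; [|intros ->; apply Omega_om].
  intros (H1 & H2). destruct Omega_om as (H3 & H4).
  apply H2 in H3 as (? & H3'). apply H4 in H1 as (? & H1').
  apply ext; auto. intros z. split; auto.
Qed.

Lemma IsSet_om : IsSet om.
Proof. apply (proj2 Omega_om om). apply Omega_om. Qed.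
Lemma om_emp : emp ∈ om.
Proof. apply Inductive_iff, Omega_om. Qed.
Lemma om_succ n : n ∈ om -> succ n ∈ om.
Proof. apply Inductive_iff, Omega_om. Qed.

Lemma om_ind (P : I -> Prop) : D1 P -> P emp ->
  (forall n, n ∈ om -> P n -> P (succ n)) -> forall n, n ∈ om -> P n.
Proof.
  intros D H0 HS n Hn.
  assert (H : Inductive_ (cmp om P)).
  { apply Inductive_iff. rewrite in_cmp by auto. split; [split; auto; apply om_emp|].
    intros m. rewrite !in_cmp by auto. intros (? & ?). split; auto. now apply om_succ. }
  apply (proj2 Omega_om) in H. destruct H as (_ & H). apply H in Hn.
  now apply in_cmp in Hn.
Qed.

End Sets2.

Ltac om_induction :=
  lazymatch goal with
  | |- forall n, n ∈ om -> @?P n => apply (om_ind P); cbv beta; [dfn| |]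
  end.

Section Naturals.
Context {L : lang} {I : interp L} {SM : SetModel I}.
Implicit Types (x y z a b c r f X Y Z n m k : I).

Lemma om_mem n m : n ∈ om -> m ∈ n -> m ∈ om.
Proof.
  intros Hn. revert n Hn m. om_induction.
  - now intros m ?%in_emp.
  - intros n Hn IH m [Hm| ->]%in_succ; auto.
Qed.

Lemma lt_trans k m n : n ∈ om -> k ∈ m -> m ∈ n -> k ∈ n.
Proof.
  intros Hn Hk. revert n Hn. om_induction.
  - now intros ?%in_emp.
  - intros n Hn IH [Hm| ->]%in_succ; apply in_succ; auto.
Qed.

Lemma zero_le n : n ∈ om -> emp = n \/ emp ∈ n.
Proof.
  revert n. apply om_ind; [dfn|auto|].
  intros n Hn [<-|H]; right; apply in_succ; auto.
Qed.

Lemma succ_le n m : n ∈ om -> m ∈ n -> succ m ∈ n \/ succ m = n.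
Proof.
  intros Hn. revert n Hn m.
  om_induction.
  - now intros m ?%in_emp.
  - intros n Hn IH m [Hm| ->]%in_succ; auto.
    left. apply in_succ. auto.
Qed.

Lemma lt_total n m : n ∈ om -> m ∈ om -> n ∈ m \/ n = m \/ m ∈ n.
Proof.
  intros Hn. revert n Hn m.
  om_induction.
  - intros m Hm. destruct (zero_le m Hm); auto.
  - intros n Hn IH m Hm. destruct (IH m Hm) as [H|[->|H]].
    + destruct (succ_le m n Hm H); auto.
    + right; right. apply in_succ. auto.
    + right; right. apply in_succ. auto.
Qed.

Lemma lt_asym n m : n ∈ om -> n ∈ m -> ~ m ∈ n.
Proof. intros Hn H1 H2. apply (mem_irrefl n). eapply lt_trans; eauto. Qed.

Lemma lt_succ n : n ∈ succ n.
Proof. apply in_succ. auto. Qed.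

Lemma om_least (P : I -> Prop) : D1 P -> forall n, n ∈ om -> P n ->
  exists m, m ∈ om /\ P m /\ forall k, k ∈ m -> ~ P k.
Proof.
  intros D n Hn HP. apply NNPP. intros N.
  assert (H : forall n, n ∈ om -> forall k, k ∈ n -> ~ P k).
  { om_induction.
    - now intros k ?%in_emp.
    - intros m Hm IH k [Hk| ->]%in_succ; auto. intros HPm. apply N. eauto. }
  apply (H (succ n) (om_succ n Hn) n); auto using lt_succ.
Qed.

Lemma om_max n m : n ∈ om -> m ∈ om -> exists k, k ∈ om /\ n ∈ k /\ m ∈ k.
Proof.
  intros Hn Hm. destruct (lt_total n m Hn Hm) as [H|[->|H]].
  - exists (succ m). rewrite !in_succ. auto using om_succ.
  - exists (succ m). rewrite !in_succ. auto using om_succ.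
  - exists (succ n). rewrite !in_succ. auto using om_succ.
Qed.

(** * Finite sets *)

Lemma Finite_iff X : Finite X <-> IsSet X /\ exists n f, n ∈ om /\ Bijection f X n.
Proof.
  unfold Finite. split; intros (H1 & H2); split; auto.
  - destruct H2 as (w & n & f & ->%Omega_iff & H). eauto.
  - destruct H2 as (n & f & H). exists om, n, f. rewrite Omega_iff. tauto.
Qed.

Lemma Finite_insert X a : Finite X -> ~ a ∈ X -> Finite (cup X (sing a)).
Proof.
  rewrite !Finite_iff. intros (HX & n & f & Hn & ((HR & HF) & HI) & HS) Ha.
  split; [apply IsSet_cup|].
  set (Q := fun x y => Rel f x y \/ x = a /\ y = n).
  assert (D : D2 Q) by (unfold Q; dfn).
  assert (E : forall x y, Rel (mkrel (cup X (sing a)) (succ n) Q) x y <-> Q x y).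
  { intros x y. rewrite Rel_mkrel by auto. split; [tauto|]. intros H. split; [|split; auto].
    - apply in_cup. destruct H as [H|(-> & _)].
      + left. apply (Relation_Rel _ _ _ _ _ HR H).
      + right. now apply in_sing.
    - apply in_succ. destruct H as [H|(_ & ->)]; auto. left.
      apply (Relation_Rel _ _ _ _ _ HR H). }
  exists (succ n), (mkrel (cup X (sing a)) (succ n) Q). split; [now apply om_succ|].
  split; [split|].
  - split; [now apply Relation_mkrel|]. intros x [Hx|Hx]%in_cup.
    + destruct (HF x Hx) as (b & Hb & U). exists b. split; [apply E; now left|].
      intros c [Hc|(-> & _)]%E; [auto|contradiction].
    + apply in_sing in Hx as ->. exists n. split; [apply E; now right|].
      intros c [Hc|(_ & ->)]%E; auto. destruct Ha. apply (Relation_Rel _ _ _ _ _ HR Hc).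
  - intros x y c (H1%E & H2%E). destruct H1 as [H1|(-> & ->)], H2 as [H2|(-> & E2)]; auto.
    + eauto.
    + subst c. apply (Relation_Rel _ _ _ _ _ HR) in H1. destruct (mem_irrefl n). tauto.
    + apply (Relation_Rel _ _ _ _ _ HR) in H2. destruct (mem_irrefl n). tauto.
  - intros b [Hb| ->]%in_succ.
    + destruct (HS b Hb) as (x & Hx). exists x. apply E. now left.
    + exists a. apply E. now right.
Qed.

Lemma Finite_emp : Finite emp.
Proof.
  apply Finite_iff. split; [apply Empty_emp|].
  exists emp, (mkrel emp emp (fun _ _ => False)). split; [apply om_emp|].
  split; [apply Injection_mkrel|].
  - dfn.
  - now intros a ?%in_emp.
  - now intros a b c ?%in_emp.
  - now intros a ?%in_emp.
Qed.

Lemma list_set (l : list I) : exists X, IsSet X /\ forall z, z ∈ X <-> In z l.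
Proof.
  induction l as [|a l (X & H1 & H2)].
  - exists emp. split; [apply Empty_emp|]. intros z. split; [apply in_emp|intros []].
  - exists (cup X (sing a)). split; [apply IsSet_cup|]. intros z.
    rewrite in_cup, in_sing, H2. cbn. intuition.
Qed.

Lemma Finite_list (l : list I) : forall X, IsSet X -> (forall z, z ∈ X <-> In z l) -> Finite X.
Proof.
  induction l as [|a l IH]; intros X HX H.
  - replace X with emp; [apply Finite_emp|].
    apply ext; auto; [apply Empty_emp|]. intros z. rewrite H. split; [apply in_emp|intros []].
  - destruct (list_set l) as (Y & H1 & H2). assert (HF := IH Y H1 H2).
    destruct (classic (In a l)) as [Ha|Ha].
    + replace X with Y; auto. apply ext; auto. intros z. rewrite H, H2. cbn.
      split; auto. intros [<-|]; auto.
    + replace X with (cup Y (sing a)).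
      * apply Finite_insert; auto. now rewrite H2.
      * apply ext; auto using IsSet_cup. intros z. rewrite in_cup, in_sing, H, H2. cbn.
        intuition.
Qed.

Lemma Infinite_NoDup X : Infinite X -> forall k : nat, exists l, length l = k /\ NoDup l /\
  forall z, In z l -> z ∈ X.
Proof.
  intros (HX & N) k. induction k as [|k (l & H1 & H2 & H3)].
  - exists []. repeat split; auto using NoDup_nil. intros z [].
  - destruct (classic (exists a, a ∈ X /\ ~ In a l)) as [(a & Ha & Hl)|H].
    + exists (a :: l). cbn. repeat split; [congruence|now constructor|].
      intros z [<-|Hz]; auto.
    + exfalso. apply N. apply (Finite_list l); auto. intros z. split; auto.
      intros Hz. apply NNPP. intros Hl. apply H. eauto.
Qed.

Lemma Infinite_remove X a Y : Infinite X -> IsSet Y ->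
  (forall z, z ∈ Y <-> z ∈ X /\ z <> a) -> Infinite Y.
Proof.
  intros (HX & N) HY H. split; auto. intros F. apply N.
  destruct (classic (a ∈ X)) as [Ha|Ha].
  - replace X with (cup Y (sing a)).
    + apply Finite_insert; auto. rewrite H. tauto.
    + apply ext; auto using IsSet_cup. intros z. rewrite in_cup, in_sing, H.
      destruct (classic (z = a)) as [->|]; tauto.
  - replace X with Y; auto. apply ext; auto. intros z. rewrite H. split; [tauto|].
    intros Hz. split; auto. now intros ->.
Qed.
End Naturals.

(** * Recursion and thinning on the natural numbers *)

Section Ramsey.
Context {L : lang} {I : interp L} {SM : SetModel I}.
Implicit Types (x y z a b c d e h r f X Y Z H K n m k : I).

Lemma succ_inj n m : n ∈ om -> m ∈ om -> succ n = succ m -> n = m.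
Proof.
  intros Hn Hm E. assert (H1 := lt_succ n). rewrite E in H1. apply in_succ in H1.
  assert (H2 := lt_succ m). rewrite <- E in H2. apply in_succ in H2.
  destruct H1, H2; auto. destruct (lt_asym n m); auto.
Qed.

Lemma succ_not_emp n : succ n <> emp.
Proof. intros E. apply (in_emp n). rewrite <- E. apply lt_succ. Qed.

Lemma iterate S s0 (St : I -> I -> Prop) : D2 St -> s0 ∈ S ->
  (forall x, x ∈ S -> exists y, y ∈ S /\ St x y /\ forall z, z ∈ S -> St x z -> z = y) ->
  exists F, (forall n, n ∈ om -> exists x, x ∈ S /\ Rel F n x) /\
    (forall n x, Rel F n x -> n ∈ om /\ x ∈ S) /\
    (forall n x y, Rel F n x -> Rel F n y -> x = y) /\
    Rel F emp s0 /\
    (forall n x y, Rel F n x -> Rel F (succ n) y -> St x y).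
Proof.
  intros D H0 HS.
  set (closed := fun Z => opair emp s0 ∈ Z /\
    forall n x y, opair n x ∈ Z -> y ∈ S -> St x y -> opair (succ n) y ∈ Z).
  set (Q := fun n x => forall Z, closed Z -> opair n x ∈ Z).
  assert (DC : D1 closed) by (unfold closed; dfn).
  assert (DQ : D2 Q) by (unfold Q; dfn).
  set (F := mkrel om S Q).
  assert (EF : forall n x, Rel F n x <-> n ∈ om /\ x ∈ S /\ Q n x)
    by (intros; now apply Rel_mkrel).
  assert (F0 : Rel F emp s0).
  { apply EF. split; [apply om_emp|split; auto]. intros Z HZ. apply HZ. }
  assert (FS : forall n x y, Rel F n x -> y ∈ S -> St x y -> Rel F (succ n) y).
  { intros n x y (Hn & Hx & Hq)%EF Hy Hxy. apply EF. split; [now apply om_succ|split; auto].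
    intros Z HZ. apply (proj2 HZ n x); auto. }
  assert (ind : forall R : I -> I -> Prop, D2 R -> R emp s0 ->
    (forall n x y, Rel F n x -> R n x -> y ∈ S -> St x y -> R (succ n) y) ->
    forall n x, Rel F n x -> R n x).
  { intros R DR R0 RS n x Hnx. assert (Hnx' := Hnx). apply EF in Hnx as (Hn & Hx & Hq).
    set (R' := fun n x => Rel F n x /\ R n x).
    assert (DR' : D2 R') by (unfold R'; dfn).
    specialize (Hq (mkrel om S R')).
    rewrite <- Rel_iff, Rel_mkrel in Hq by auto. apply Hq.
    split.
    - rewrite <- Rel_iff, Rel_mkrel by auto. split; [apply om_emp|split; auto]. now split.
    - intros n' x' y. rewrite <- !Rel_iff, !Rel_mkrel by auto.
      intros (Hn' & Hx' & H1 & H2) Hy HSt. split; [now apply om_succ|split; auto].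
      split; eauto. }
  assert (inv0 : forall x, Rel F emp x -> x = s0).
  { intros x Hx. apply (ind (fun n x => n = emp -> x = s0)) with (n := emp); auto.
    - dfn.
    - intros n ? ? _ _ _ _ E. destruct (succ_not_emp _ E). }
  assert (invS : forall n y, n ∈ om -> Rel F (succ n) y -> exists x, Rel F n x /\ St x y).
  { intros n y Hn Hy.
    apply (ind (fun m y => forall n, n ∈ om -> m = succ n -> exists x, Rel F n x /\ St x y))
      with (n := succ n); auto.
    - dfn.
    - intros n' _ E. destruct (succ_not_emp n'). auto.
    - intros n1 x1 y1 H1 _ Hy1 HSt n2 Hn2 E. exists x1.
      apply succ_inj in E as <-; auto. apply (proj1 (EF _ _) H1). }
  assert (U : forall n, n ∈ om -> forall x y, Rel F n x -> Rel F n y -> x = y).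
  { om_induction.
    - intros x y ->%inv0 ->%inv0. auto.
    - intros n Hn IH x y Hx Hy.
      assert (x ∈ S /\ y ∈ S) as (HxS & HyS) by (apply EF in Hx, Hy; tauto).
      apply invS in Hx as (x' & Hx' & Hx), Hy as (y' & Hy' & Hy); auto.
      assert (x' = y') as -> by auto. apply EF in Hy' as (_ & Hy' & _).
      destruct (HS y' Hy') as (w & _ & _ & Uw). rewrite (Uw x), (Uw y); auto. }
  exists F. split; [|split; [|split; [|split]]].
  - om_induction; [eauto|].
    intros n Hn (x & Hx & HF). destruct (HS x Hx) as (y & Hy & HSt & _). eauto.
  - intros n x (? & ? & _)%EF. auto.
  - intros n x y Hx. apply U; auto. now apply EF in Hx.
  - auto.
  - intros n x y Hx Hy. assert (Hn : n ∈ om) by now apply EF in Hx.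
    apply invS in Hy as (x' & Hx' & HSt); auto. now rewrite (U n Hn x x').
Qed.

Definition Ub H := forall m, m ∈ om -> exists h, h ∈ H /\ m ∈ h.
Definition Least h X := h ∈ X /\ forall k, k ∈ h -> ~ k ∈ X.

Lemma Ub_Least X : (forall x, x ∈ X -> x ∈ om) -> Ub X -> exists h, Least h X.
Proof.
  intros HX U. destruct (U emp om_emp) as (h & Hh & _).
  destruct (om_least (fun h => h ∈ X)) with (n := h) as (m & _ & H); auto; [dfn|].
  now exists m.
Qed.

Lemma Least_unique h k X : (forall x, x ∈ X -> x ∈ om) -> Least h X -> Least k X -> h = k.
Proof.
  intros HX (H1 & H2) (H3 & H4).
  destruct (lt_total h k) as [H|[H|H]]; auto; [destruct (H4 h)|destruct (H2 k)]; auto.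
Qed.

Lemma almost_all (Q : I -> I -> Prop) : D2 Q -> forall n, n ∈ om ->
  (forall b, b ∈ n -> exists m, m ∈ om /\ forall d, d ∈ om -> m ∈ d -> Q b d) ->
  exists m, m ∈ om /\ forall d, d ∈ om -> m ∈ d -> forall b, b ∈ n -> Q b d.
Proof.
  intros D. om_induction.
  - intros _. exists emp. split; [apply om_emp|]. now intros d _ _ b ?%in_emp.
  - intros n Hn IH H. destruct IH as (m1 & Hm1 & H1).
    { intros b Hb. apply H, in_succ. auto. }
    destruct (H n (lt_succ n)) as (m2 & Hm2 & H2).
    destruct (om_max m1 m2) as (m & Hm & H3 & H4); auto.
    exists m. split; auto. intros d Hd Hmd b [Hb| ->]%in_succ.
    + apply H1; auto. eapply lt_trans; eauto.
    + apply H2; auto. eapply lt_trans; eauto.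
Qed.

Lemma diagonal H (Nx : I -> I -> I -> Prop) :
  D3 Nx -> (forall x, x ∈ H -> x ∈ om) -> IsSet H -> Ub H ->
  (forall X h, IsSet X -> (forall x, x ∈ X -> x ∈ H) -> Ub X -> h ∈ X ->
     forall m, m ∈ om -> exists d, d ∈ X /\ h ∈ d /\ Nx h X d /\ m ∈ d) ->
  exists K, IsSet K /\ (forall x, x ∈ K -> x ∈ H) /\ Ub K /\
    forall a, a ∈ K -> exists X, (forall x, x ∈ X -> x ∈ H) /\
      forall d, d ∈ K -> a ∈ d -> d ∈ X /\ Nx a X d.
Proof.
  intros D Hom HS HU HN.
  set (good := fun X => (forall x, x ∈ X -> x ∈ H) /\ Ub X).
  assert (Dg : D1 good) by (unfold good, Ub; dfn).
  set (S := cmp (pow H) good).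
  assert (ES : forall X, X ∈ S <-> IsSet X /\ (forall x, x ∈ X -> x ∈ H) /\ Ub X).
  { intros X. unfold S. rewrite in_cmp, in_pow by auto. unfold Subset, good. tauto. }
  set (St := fun X Y => IsSet Y /\ exists h, Least h X /\
     forall d, d ∈ Y <-> d ∈ X /\ h ∈ d /\ Nx h X d).
  assert (DS : D2 St) by (unfold St, Least; dfn).
  destruct (iterate S H St) as (F & F1 & F2 & F3 & F4 & F5); auto.
  { apply ES. auto. }
  { intros X (HX & HX1 & HX2)%ES.
    destruct (Ub_Least X) as (h & Hh); auto.
    assert (DN : D1 (fun d => h ∈ d /\ Nx h X d)) by dfn.
    exists (cmp X (fun d => h ∈ d /\ Nx h X d)).
    assert (HSt : St X (cmp X (fun d => h ∈ d /\ Nx h X d))).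
    { split; [now apply IsSet_cmp|]. exists h. split; auto. intros d. now rewrite in_cmp. }
    split; [|split; auto].
    - apply ES. split; [now apply IsSet_cmp|]. split.
      + intros x. rewrite in_cmp by auto. intros (Hx & _). auto.
      + intros m Hm. destruct (HN X h) with (m := m) as (d & Hd & H1 & H2 & H3); auto.
        { apply Hh. }
        exists d. rewrite in_cmp by auto. auto.
    - intros Z _ (HZ & h' & Hh' & EZ). apply ext; auto; [now apply IsSet_cmp|].
      intros z. rewrite EZ, in_cmp by auto.
      assert (h' = h) as -> by (apply (Least_unique h' h X); auto). tauto. }
  set (inK := fun h => exists n X, Rel F n X /\ Least h X).
  assert (DK : D1 inK) by (unfold inK, Least; dfn).
  assert (step : forall n m X Y h, Rel F n X -> Rel F m Y -> Least h X -> n ∈ m ->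
     forall d, d ∈ Y -> d ∈ X /\ h ∈ d /\ Nx h X d).
  { intros n m X Y h HX HY Hh Hnm d. assert (Hm : m ∈ om) by apply (F2 _ _ HY).
    assert (Hn : n ∈ om) by apply (F2 _ _ HX).
    revert m Hm Y HY Hnm d.
    om_induction.
    - now intros Y _ ?%in_emp.
    - intros m Hm IH Y HY Hnm d Hd.
      destruct (F1 m Hm) as (Y' & _ & HY').
      destruct (F5 _ _ _ HY' HY) as (_ & h' & Hh' & E).
      destruct (proj1 (E d) Hd) as (Hd1 & Hd2 & Hd3).
      apply in_succ in Hnm as [Hnm| ->].
      + eapply IH; eauto.
      + assert (X = Y') as <- by eauto.
        assert (h' = h) as ->; auto. apply (Least_unique h' h X); auto.
        intros x Hx. apply Hom. apply F2 in HX as (_ & HX). apply ES in HX. now apply HX. }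
  assert (sub : forall n X, Rel F n X -> forall x, x ∈ X -> x ∈ H).
  { intros n X (_ & HX)%F2. now apply ES in HX. }
  exists (cmp H inK). split; [now apply IsSet_cmp|]. split; [|split].
  - intros x. rewrite in_cmp by auto. tauto.
  - unfold Ub. om_induction.
    + destruct (F1 _ (om_succ _ om_emp)) as (X & _ & HX).
      assert (HX' := HX). apply F2 in HX' as (_ & HX'%ES). destruct HX' as (_ & HX1 & HX2).
      destruct (Ub_Least X) as (h & Hh); auto.
      exists h. rewrite in_cmp by auto. split; [split; [apply HX1, Hh|]|].
      * exists (succ emp), X. auto.
      * destruct (Ub_Least H) as (h0 & Hh0); auto.
        destruct (step _ _ _ _ _ F4 HX Hh0 (lt_succ _) h (proj1 Hh)) as (H1 & H2 & _).
        destruct (zero_le h0) as [<-|H3]; auto. { apply Hom, Hh0. }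
        eapply lt_trans; eauto.
    + intros m Hm (h & Hh & Hmh). apply in_cmp in Hh as (Hh & n & X & HX & Hl); auto.
      assert (Hn : n ∈ om) by apply (F2 _ _ HX).
      destruct (F1 _ (om_succ _ Hn)) as (Y & _ & HY).
      assert (HY' := HY). apply F2 in HY' as (_ & HY'%ES). destruct HY' as (_ & HY1 & HY2).
      destruct (Ub_Least Y) as (h' & Hh'); auto.
      destruct (step _ _ _ _ _ HX HY Hl (lt_succ _) h' (proj1 Hh')) as (H1 & H2 & _).
      exists h'. rewrite in_cmp by auto. split; [split; [apply HY1, Hh'|]|].
      * exists (succ n), Y. auto.
      * destruct (succ_le h m) as [H3| ->]; auto. eapply lt_trans; eauto.
  - intros a Ha. apply in_cmp in Ha as (Ha & n & X & HX & Hl); auto.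
    exists X. split; [eauto|]. intros d Hd Had.
    apply in_cmp in Hd as (Hd & m & Y & HY & Hl'); auto.
    assert (Hn : n ∈ om) by apply (F2 _ _ HX).
    assert (Hm : m ∈ om) by apply (F2 _ _ HY).
    destruct (lt_total n m) as [Hnm|[->|Hnm]]; auto.
    + destruct (step _ _ _ _ _ HX HY Hl Hnm d (proj1 Hl')) as (H1 & H2 & H3). auto.
    + assert (X = Y) as <- by eauto.
      assert (a = d) as <- by (apply (Least_unique a d X); eauto).
      destruct (mem_irrefl _ Had).
    + destruct (step _ _ _ _ _ HY HX Hl' Hnm a (proj1 Hl)) as (H1 & H2 & H3).
      destruct (lt_asym a d); auto.
Qed.

Lemma thin H (G : I -> I -> Prop) :
  D2 G -> (forall x, x ∈ H -> x ∈ om) -> IsSet H -> Ub H ->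
  (forall a, a ∈ H -> exists m, m ∈ om /\ forall d, d ∈ om -> m ∈ d -> d ∈ H -> G a d) ->
  exists K, IsSet K /\ (forall x, x ∈ K -> x ∈ H) /\ Ub K /\
    forall a d, a ∈ K -> d ∈ K -> a ∈ d -> G a d.
Proof.
  intros D Hom HS HU HG.
  destruct (diagonal H (fun a _ d => G a d)) as (K & H1 & H2 & H3 & H4); auto.
  - dfn.
  - intros X h HX HXH HXU Hh m Hm. destruct (HG h) as (m' & Hm' & Hd); auto.
    destruct (om_max m m') as (k & Hk & H1 & H2); auto.
    destruct (om_max k h) as (k' & Hk' & H3 & H4); auto.
    destruct (HXU k' Hk') as (d & Hd1 & Hd2). exists d.
    assert (Hdo : d ∈ om) by auto.
    assert (k ∈ d) by (eapply lt_trans; eauto).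
    repeat split; auto.
    + eapply lt_trans; eauto.
    + apply Hd; auto. eapply lt_trans; eauto.
    + eapply lt_trans; eauto.
  - exists K. repeat split; auto. intros a d Ha Hd Had.
    destruct (H4 a Ha) as (X & _ & HX). now apply HX.
Qed.

Lemma constant_or_injective H (E : I -> I -> I -> Prop) :
  D3 E -> (forall x, x ∈ H -> x ∈ om) -> IsSet H -> Ub H ->
  (forall a d, a ∈ H -> d ∈ H -> a ∈ d -> E a d d) ->
  (forall a d d', a ∈ H -> d ∈ H -> d' ∈ H -> a ∈ d -> a ∈ d' -> E a d d' -> E a d' d) ->
  (forall a d d' d'', a ∈ H -> d ∈ H -> d' ∈ H -> d'' ∈ H -> a ∈ d -> a ∈ d' -> a ∈ d'' ->
     E a d d' -> E a d' d'' -> E a d d'') ->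
  exists K, IsSet K /\ (forall x, x ∈ K -> x ∈ H) /\ Ub K /\
    forall a, a ∈ K ->
      (forall d d', d ∈ K -> d' ∈ K -> a ∈ d -> a ∈ d' -> E a d d') \/
      (forall d d', d ∈ K -> d' ∈ K -> a ∈ d -> d ∈ d' -> ~ E a d d').
Proof.
  intros D Hom HS HU Erefl Esym Etrans.
  set (Fib := fun a X e => forall m, m ∈ om -> exists d, d ∈ X /\ m ∈ d /\ a ∈ d /\ E a e d).
  set (Rep := fun a X e => e ∈ X /\ a ∈ e /\ Fib a X e /\
     forall e', e' ∈ e -> e' ∈ X -> a ∈ e' -> ~ Fib a X e').
  set (Nx := fun a X d => (exists e, Rep a X e /\ E a e d) \/
     ((forall e, e ∈ X -> a ∈ e -> ~ Fib a X e) /\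
      forall e, e ∈ X -> a ∈ e -> e ∈ d -> ~ E a e d)).
  assert (DF : D3 Fib) by (unfold Fib; dfn).
  assert (DR : D3 Rep) by (unfold Rep; dfn).
  assert (DN : D3 Nx) by (unfold Nx; dfn).
  assert (exRep : forall a X e, (forall x, x ∈ X -> x ∈ H) -> e ∈ X -> a ∈ e -> Fib a X e ->
    exists e', Rep a X e').
  { intros a X e HX He Hae HF.
    destruct (om_least (fun e => e ∈ X /\ a ∈ e /\ Fib a X e)) with (n := e)
      as (m & Hm & (H1 & H2 & H3) & H4); auto; [dfn|].
    exists m. unfold Rep. repeat split; auto. intros e' He' H5 H6 H7.
    apply (H4 e'); auto. }
  destruct (diagonal H Nx) as (K & H1 & H2 & H3 & H4); auto.
  - intros X a HX HXH HXU Ha m Hm.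
    destruct (classic (exists e, e ∈ X /\ a ∈ e /\ Fib a X e)) as [(e & He)|N].
    + destruct (exRep a X e) as (e' & He'); try tauto.
      destruct He' as (H1 & H2 & H3 & H4). destruct (H3 m Hm) as (d & Hd).
      exists d. repeat split; try tauto. left. exists e'. unfold Rep. tauto.
    + assert (N' : forall e, e ∈ X -> a ∈ e -> ~ Fib a X e) by (intros e H1 H2 H3; eauto).
      apply NNPP. intros C.
      (* all elements of X beyond a are equivalent to elements up to max m a, whose
         finitely many classes are bounded *)
      destruct (om_max m a) as (k & Hk & Hmk & Hak); auto.
      destruct (almost_all (fun e d => e ∈ X -> a ∈ e -> d ∈ X -> a ∈ d -> ~ E a e d))
        with (n := succ k) as (p & Hp & Hd); [dfn|now apply om_succ| |].
      { intros e Hek. destruct (classic (e ∈ X /\ a ∈ e)) as [(H1 & H2)|N2].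
        - assert (N3 := N' e H1 H2). unfold Fib in N3. apply not_all_ex_not in N3.
          destruct N3 as (q & N3). apply imply_to_and in N3 as (Hq & N3).
          exists q. split; auto. intros d Hd Hqd _ _ HdX Had HE. apply N3. eauto.
        - exists emp. split; [apply om_emp|]. tauto. }
      destruct (om_max p k) as (q & Hq & Hpq & Hkq); auto.
      destruct (HXU q Hq) as (d & HdX & Hqd).
      assert (Hdo : d ∈ om) by auto.
      assert (Hkd : k ∈ d) by (eapply lt_trans; eauto).
      assert (Had : a ∈ d) by (eapply lt_trans; eauto).
      destruct (om_least (fun e => e ∈ X /\ a ∈ e /\ E a e d)) with (n := d)
        as (e & He & (He1 & He2 & He3) & He4); auto; [dfn|].
      destruct (classic (e ∈ succ k)) as [Hek|Hek].
      * apply (Hd d) with (b := e); auto. eapply lt_trans; eauto.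
      * assert (k ∈ e).
        { destruct (lt_total k e) as [?|[<-|?]]; auto; destruct Hek; apply in_succ; auto. }
        apply C. exists e. repeat split; auto.
        -- right. split; auto. intros e' H1 H2 H3 H4. apply (He4 e'); auto.
           repeat split; auto. apply (Etrans a e' e d); auto.
        -- eapply lt_trans; eauto.
  - exists K. repeat split; auto. intros a Ha. destruct (H4 a Ha) as (X & HX & HK).
    destruct (classic (exists e, e ∈ X /\ a ∈ e /\ Fib a X e)) as [(e & He)|N].
    + left. intros d d' Hd Hd' Had Had'.
      destruct (HK d Hd Had) as (HdX & [(e1 & R1 & E1)|(N & _)]);
        [|destruct (N e); tauto].
      destruct (HK d' Hd' Had') as (HdX' & [(e2 & R2 & E2)|(N & _)]);
        [|destruct (N e); tauto].
      assert (e1 = e2) as <-.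
      { destruct R1 as (A1 & A2 & A3 & A4), R2 as (B1 & B2 & B3 & B4).
        destruct (lt_total e1 e2) as [C|[C|C]]; auto; [destruct (B4 e1)|destruct (A4 e2)]; auto. }
      destruct R1 as (A1 & A2 & _).
      apply (Etrans a d e1 d'); auto.
    + right. intros d d' Hd Hd' Had Hdd' HE.
      assert (a ∈ d') by (eapply lt_trans; eauto).
      destruct (HK d Hd Had) as (HdX & _).
      destruct (HK d' Hd' H0) as (_ & [(e1 & R1 & _)|(_ & N')]).
      * apply N. exists e1. unfold Rep in R1. tauto.
      * apply (N' d); auto.
Qed.

Lemma all_or_none H (E : I -> I -> Prop) :
  D2 E -> (forall x, x ∈ H -> x ∈ om) -> IsSet H -> Ub H ->
  (forall d, d ∈ H -> E d d) ->
  (forall d d', d ∈ H -> d' ∈ H -> E d d' -> E d' d) ->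
  (forall d d' d'', d ∈ H -> d' ∈ H -> d'' ∈ H -> E d d' -> E d' d'' -> E d d'') ->
  exists K, IsSet K /\ (forall x, x ∈ K -> x ∈ H) /\ Ub K /\
      ((forall d d', d ∈ K -> d' ∈ K -> E d d') \/
       (forall d d', d ∈ K -> d' ∈ K -> d ∈ d' -> ~ E d d')).
Proof.
  intros D Hom HS HU E1 E2 E3.
  destruct (constant_or_injective H (fun _ d d' => E d d')) as (K & H1 & H2 & H3 & H4);
    auto; [dfn|intros; eauto|].
  destruct (Ub_Least K) as (a & Ha & _); auto.
  assert (DA : D1 (fun d => a ∈ d)) by dfn.
  exists (cmp K (fun d => a ∈ d)). split; [now apply IsSet_cmp|].
  split; [|split].
  - intros x. rewrite in_cmp by auto. intros (? & _). auto.
  - intros m Hm. destruct (om_max m a) as (k & Hk & Hmk & Hak); auto.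
    destruct (H3 k Hk) as (d & Hd & Hkd). exists d. rewrite in_cmp by auto.
    assert (d ∈ om) by auto.
    repeat split; auto; eapply lt_trans; eauto.
  - destruct (H4 a Ha) as [A|A]; [left|right]; intros d d'; rewrite !in_cmp by auto;
      intros (? & ?) (? & ?); auto.
Qed.
End Ramsey.

Definition canonical_on {T} (lt : T -> T -> Prop) (E : T -> T -> T -> T -> Prop) : Prop :=
  (forall a b c d, lt a b -> lt c d -> E a b c d) \/
  (forall a b c d, lt a b -> lt c d -> (E a b c d <-> a = c)) \/
  (forall a b c d, lt a b -> lt c d -> (E a b c d <-> b = d)) \/
  (forall a b c d, lt a b -> lt c d -> (E a b c d <-> a = c /\ b = d)).

Lemma canonical_on_transfer {T U} (y : T -> U -> Prop) lt E lt' E' :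
  (forall a u u', y a u -> y a u' -> u = u') ->
  (forall a a' u, y a u -> y a' u -> a = a') ->
  (forall u v, lt' u v -> exists a b, lt a b /\ y a u /\ y b v) ->
  (forall a b c d u v w z, y a u -> y b v -> y c w -> y d z ->
     (E a b c d <-> E' u v w z)) ->
  canonical_on lt E -> canonical_on lt' E'.
Proof.
  intros Hf Hi Hlt HE [H|[H|[H|H]]];
    [left|right; left|right; right; left|right; right; right];
    intros u v w z Huv Hwz;
    destruct (Hlt u v Huv) as (a & b & Hab & Hu & Hv), (Hlt w z Hwz) as (c & d & Hcd & Hw & Hz);
    rewrite <- (HE a b c d u v w z) by auto; [auto|rewrite H by auto ..].
  - split; intros <-; eauto.
  - split; intros <-; eauto.
  - split; intros (<- & <-); eauto.
Qed.

Section CanonicalOmega.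
Context {L : lang} {I : interp L} {SM : SetModel I}.
Implicit Types (x y z a b c d e h r f X Y Z H K n m k : I).

(* [E a b c d] stands for f(ab) = f(cd). *)
Lemma canonical_omega (E : I -> I -> I -> I -> Prop) :
  D4 E ->
  (forall a b, b ∈ om -> a ∈ b -> E a b a b) ->
  (forall a b c d, b ∈ om -> a ∈ b -> d ∈ om -> c ∈ d -> E a b c d -> E c d a b) ->
  (forall a b c d e f, b ∈ om -> a ∈ b -> d ∈ om -> c ∈ d -> f ∈ om -> e ∈ f ->
     E a b c d -> E c d e f -> E a b e f) ->
  exists H, IsSet H /\ (forall x, x ∈ H -> x ∈ om) /\ Ub H /\
    canonical_on (fun a b => a ∈ H /\ b ∈ H /\ a ∈ b) E.
Proof.
  intros D Er Es Et.
  assert (Uom : Ub om).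
  { intros m Hm. exists (succ m). auto using om_succ, lt_succ. }
  destruct (constant_or_injective om (fun a d d' => E a d a d')) as (K1 & S1 & I1 & U1 & C1);
    auto using IsSet_om; [dfn|intros; eauto ..|].
  set (Const := fun a => forall d d', d ∈ K1 -> d' ∈ K1 -> a ∈ d -> a ∈ d' -> E a d a d').
  assert (DC : D1 Const) by (unfold Const; dfn).
  set (K1c := cmp K1 Const).
  assert (EK1c : forall a, a ∈ K1c <-> a ∈ K1 /\ Const a) by (intros; now apply in_cmp).
  destruct (classic (Ub K1c)) as [Uc|NUc].
  - (* f(a, d) does not depend on d, so f factors through the first component *)
    set (Ev := fun a b => exists d d', d ∈ K1 /\ d' ∈ K1 /\ a ∈ d /\ b ∈ d' /\ E a d b d').
    assert (DE : D2 Ev) by (unfold Ev; dfn).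
    destruct (all_or_none K1c Ev) as (K2 & S2 & I2 & U2 & C2); auto.
    + intros a (Ha & _)%EK1c. auto.
    + now apply IsSet_cmp.
    + intros a (Ha & _)%EK1c. destruct (U1 a) as (d & Hd & Had); auto.
      exists d, d. auto 8.
    + intros a b _ _ (d & d' & Hd & Hd' & Had & Hbd & H). exists d', d. repeat split; auto.
    + intros a b c (Ha & HaC)%EK1c (Hb & HbC)%EK1c (Hc & HcC)%EK1c
        (d & d' & Hd & Hd' & Had & Hbd & H) (e & e' & He & He' & Hbe & Hce & H').
      exists d, e'. repeat split; auto.
      apply (Et a d b d'); auto. apply (Et b d' b e); auto.
    + exists K2. repeat split; auto. { intros x (Hx & _)%I2%EK1c. auto. }
      destruct C2 as [C2|C2]; [left|right; left].
      * intros a b c d (Ha & Hb & Hab) (Hc & Hd & Hcd).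
        destruct (C2 a c Ha Hc) as (e & e' & He & He' & Hae & Hce & HE).
        apply I2, EK1c in Ha as (Ha & HaC), Hb as (Hb & _), Hc as (Hc & HcC), Hd as (Hd & _).
        apply (Et a b a e); auto. apply (Et a e c e'); auto.
      * intros a b c d (Ha & Hb & Hab) (Hc & Hd & Hcd).
        assert (Hb1 := Hb). assert (Hd1 := Hd).
        apply I2, EK1c in Hb1 as (Hb1 & _), Hd1 as (Hd1 & _). split.
        -- intros HE. assert (HEv : Ev a c) by (exists b, d; auto 8).
           assert (HEv' : Ev c a) by (exists d, b; repeat split; auto).
           destruct (lt_total a c) as [H|[H|H]]; auto.
           ++ apply I2, EK1c in Ha. apply I1, Ha.
           ++ apply I2, EK1c in Hc. apply I1, Hc.
           ++ destruct (C2 a c); auto.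
           ++ destruct (C2 c a); auto.
        -- intros <-. apply I2, EK1c in Ha. apply Ha; auto.
  - unfold Ub in NUc. apply not_all_ex_not in NUc as (m0 & NUc).
    apply imply_to_and in NUc as (Hm0 & NUc).
    assert (DM : D1 (fun a => m0 ∈ a)) by dfn.
    set (K1' := cmp K1 (fun a => m0 ∈ a)).
    assert (EK1' : forall a, a ∈ K1' <-> a ∈ K1 /\ m0 ∈ a) by (intros; now apply in_cmp).
    assert (I1' : forall x, x ∈ K1' -> x ∈ om) by (intros x (Hx & _)%EK1'; auto).
    assert (U1' : Ub K1').
    { intros m Hm. destruct (om_max m m0) as (k & Hk & Hk1 & Hk2); auto.
      destruct (U1 k Hk) as (d & Hd & Hkd). exists d. rewrite EK1'.
      assert (d ∈ om) by auto.
      repeat split; auto; eapply lt_trans; eauto. }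
    assert (Inj1 : forall a d d', a ∈ K1' -> d ∈ K1' -> d' ∈ K1' -> a ∈ d -> d ∈ d' ->
      ~ E a d a d').
    { intros a d d' (Ha & Hma)%EK1' (Hd & _)%EK1' (Hd' & _)%EK1' Had Hdd'.
      destruct (C1 a Ha) as [HC|HC]; auto.
      destruct NUc. exists a. split; auto. now apply EK1c. }
    assert (S1' : IsSet K1') by now apply IsSet_cmp.
    clearbody K1'. clear EK1'.
    (* discard the d for which f(a, d) is a color used below d *)
    destruct (thin K1' (fun m d => forall a, a ∈ succ m -> forall b, b ∈ succ m ->
      forall c, c ∈ succ m -> a ∈ K1' -> b ∈ K1' -> c ∈ K1' -> b ∈ c -> a ∈ d -> d ∈ K1' ->
      ~ E a d b c)) as (K2 & S2 & I2 & U2 & C2); auto; [dfn| |].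
    { intros m Hm.
      assert (Hsm : succ m ∈ om) by auto using om_succ.
      destruct (almost_all (fun a d => forall b, b ∈ succ m ->
        forall c, c ∈ succ m -> a ∈ K1' -> b ∈ K1' -> c ∈ K1' -> b ∈ c -> a ∈ d -> d ∈ K1' ->
        ~ E a d b c)) with (n := succ m) as (p & Hp & Hpd); auto; [dfn| |].
      2:{ exists p. split; auto. }
      intros a Ha.
      destruct (almost_all (fun b d =>
        forall c, c ∈ succ m -> a ∈ K1' -> b ∈ K1' -> c ∈ K1' -> b ∈ c -> a ∈ d -> d ∈ K1' ->
        ~ E a d b c)) with (n := succ m) as (p & Hp & Hpd); auto; [dfn| |].
      2:{ exists p. split; auto. }
      intros b Hb.
      destruct (almost_all (fun c d =>
        a ∈ K1' -> b ∈ K1' -> c ∈ K1' -> b ∈ c -> a ∈ d -> d ∈ K1' ->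
        ~ E a d b c)) with (n := succ m) as (p & Hp & Hpd); auto; [dfn| |].
      2:{ exists p. split; auto. }
      intros c Hc.
      destruct (classic (exists d0, d0 ∈ K1' /\ a ∈ d0 /\ E a d0 b c)) as [(d0 & H1 & H2 & H3)|N].
      - exists d0. split; auto. intros d Hd Hd0 Ha1 Hb1 Hc1 Hbc Had Hd1 HE.
        apply (Inj1 a d0 d); auto. apply (Et a d0 b c); auto.
      - exists emp. split; [apply om_emp|]. intros d Hd _ Ha1 Hb1 Hc1 Hbc Had Hd1 HE.
        apply N. eauto. }
    assert (I2' : forall x, x ∈ K2 -> x ∈ om) by auto.
    assert (F3 : forall a b c d, a ∈ K2 -> b ∈ K2 -> c ∈ K2 -> d ∈ K2 -> a ∈ b -> c ∈ d ->
      E a b c d -> b = d).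
    { assert (G : forall a b c d, a ∈ K2 -> b ∈ K2 -> c ∈ K2 -> d ∈ K2 -> a ∈ b -> c ∈ d ->
        b ∈ d -> ~ E c d a b).
      { intros a b c d Ha Hb Hc Hd Hab Hcd Hbd.
        destruct (lt_total b c) as [H|H]; auto.
        - apply (C2 c d); auto using lt_succ; apply in_succ; auto. left.
          eapply lt_trans; eauto.
        - apply (C2 b d); auto using lt_succ; apply in_succ; intuition. }
      intros a b c d Ha Hb Hc Hd Hab Hcd HE.
      destruct (lt_total b d) as [H|[H|H]]; auto.
      - destruct (G a b c d); auto.
      - destruct (G c d a b); auto. }
    (* [Lst a d x]: x is the first index with f(x, d) = f(a, d) *)
    set (Lst := fun a d x => x ∈ K2 /\ x ∈ succ a /\ E x d a d /\
      forall y, y ∈ x -> y ∈ K2 -> ~ E y d a d).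
    assert (DL : D3 Lst) by (unfold Lst; dfn).
    assert (LstU : forall a d x y, a ∈ d -> d ∈ om -> Lst a d x -> Lst a d y -> x = y).
    { intros a d x y Had Hd (A1 & A2 & A3 & A4) (B1 & B2 & B3 & B4).
      destruct (lt_total x y) as [H|[H|H]]; auto; [destruct (B4 x)|destruct (A4 y)]; auto. }
    assert (LstE : forall a d, a ∈ K2 -> d ∈ om -> a ∈ d -> exists x, Lst a d x).
    { intros a d Ha Hd Had.
      destruct (om_least (fun x => x ∈ K2 /\ x ∈ succ a /\ E x d a d)) with (n := a)
        as (x & Hx & (H1 & H2 & H3) & H4); auto using lt_succ; [dfn|].
      exists x. repeat split; auto. intros y Hyx Hy HE. apply (H4 y); auto.
      repeat split; auto. apply lt_trans with x; auto using om_succ. }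
    assert (LstS : forall a b d x, a ∈ K2 -> b ∈ K2 -> d ∈ K2 -> a ∈ d -> b ∈ d -> E a d b d ->
      Lst a d x -> Lst b d x).
    { assert (G : forall a b d x, a ∈ K2 -> b ∈ K2 -> d ∈ K2 -> a ∈ d -> b ∈ d -> E a d b d ->
        Lst a d x -> x ∈ succ b -> Lst b d x).
      { intros a b d x Ha Hb Hd Had Hbd HE (A1 & A2 & A3 & A4) Hxb.
        assert (Hxd : x ∈ d).
        { apply in_succ in Hxb as [Hxb| ->]; auto. eapply lt_trans; eauto. }
        repeat split; auto.
        - apply (Et x d a d); auto.
        - intros y Hy HyK HEy. apply (A4 y); auto.
          assert (y ∈ d) by (apply (lt_trans y x d); auto).
          apply (Et y d b d); auto. }
      intros a b d x Ha Hb Hd Had Hbd HE HL.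
      destruct (classic (x ∈ succ b)) as [H|H]; [apply (G a b); auto|].
      destruct (LstE b d) as (y & Hy); auto.
      assert (y ∈ succ a).
      { destruct Hy as (_ & Hy & _). destruct HL as (Hx & HL & _).
        apply in_succ in Hy. apply in_succ.
        destruct (lt_total b x) as [C|[C|C]]; auto.
        - apply in_succ in HL as [HL| ->].
          + left. apply lt_trans with x; auto. destruct Hy as [Hy| ->]; auto.
            eapply lt_trans; eauto.
          + left. destruct Hy as [Hy| ->]; auto. eapply lt_trans; eauto.
        - exfalso. apply H, in_succ. auto.
        - exfalso. apply H, in_succ. auto. }
      assert (Lst a d y) by (apply (G b a); auto).
      now rewrite (LstU a d x y) by auto. }
    destruct (constant_or_injective K2 (fun a d d' => forall x, Lst a d x <-> Lst a d' x))
      as (K3 & S3 & I3 & U3 & C3); auto;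
      [dfn|intros; tauto|intros ? ? ? _ _ _ _ _ Hd x; symmetry; apply Hd
      |intros ? ? ? ? _ _ _ _ _ _ _ Hd Hd' x; rewrite Hd; apply Hd'|].
    assert (C3' : forall a d d' x, a ∈ K3 -> d ∈ K3 -> d' ∈ K3 -> a ∈ d -> a ∈ d' ->
      Lst a d x -> Lst a d' x).
    { intros a d d' x Ha Hd Hd' Had Had' HL.
      destruct (C3 a Ha) as [C|C]; [apply (C d d'); auto|]. exfalso.
      assert (Hao : a ∈ om) by auto.
      destruct (almost_all (fun b d => d ∈ K3 -> a ∈ d -> ~ Lst a d b)) with (n := succ a)
        as (p & Hp & Hpd); [dfn|auto using om_succ| |].
      - intros b Hb.
        destruct (classic (exists d0, d0 ∈ K3 /\ a ∈ d0 /\ Lst a d0 b)) as [(d0 & H1 & H2 & H3)|N].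
        + exists d0. split; auto. intros d1 Hd1o Hd1 Hd1K Had1 HL1.
          apply (C d0 d1); auto. intros y. split; intros Hy.
          * rewrite (LstU a d0 y b); auto.
          * rewrite (LstU a d1 y b); auto.
        + exists emp. split; [apply om_emp|]. intros d1 _ _ H1 H2 H3. apply N. eauto.
      - destruct (om_max p a) as (q & Hq & Hpq & Haq); auto.
        destruct (U3 q Hq) as (d1 & Hd1 & Hqd1).
        assert (Hd1o : d1 ∈ om) by auto.
        assert (Had1 : a ∈ d1) by (eapply lt_trans; eauto).
        destruct (LstE a d1) as (y & Hy); auto.
        apply (Hpd d1 Hd1o) with (b := y); auto.
        + eapply lt_trans; eauto.
        + apply Hy. }
    assert (I3' : forall x, x ∈ K3 -> x ∈ om) by auto.
    assert (transfer : forall a b d d', a ∈ K3 -> b ∈ K3 -> d ∈ K3 -> d' ∈ K3 ->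
      a ∈ d -> b ∈ d -> a ∈ d' -> b ∈ d' -> E a d b d -> E a d' b d').
    { intros a b d d' Ha Hb Hd Hd' Had Hbd Had' Hbd' HE.
      destruct (LstE a d) as (x & Hx); auto.
      assert (Hx' : Lst b d x) by (apply (LstS a b); auto).
      apply C3' with (d' := d') in Hx as (H1 & H2 & H3 & _), Hx' as (H4 & H5 & H6 & _); auto.
      assert (Hxd' : x ∈ d').
      { apply in_succ in H5 as [H5| ->]; auto. eapply lt_trans; eauto. }
      apply (Et a d' x d'); auto. }
    set (Ev := fun a b => exists d, d ∈ K3 /\ a ∈ d /\ b ∈ d /\ E a d b d).
    assert (DE : D2 Ev) by (unfold Ev; dfn).
    assert (above : forall a b, a ∈ K3 -> b ∈ K3 -> exists d, d ∈ K3 /\ a ∈ d /\ b ∈ d).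
    { intros a b Ha Hb. destruct (om_max a b) as (k & Hk & Hak & Hbk); auto.
      destruct (U3 k Hk) as (d & Hd & Hkd). assert (d ∈ om) by auto.
      exists d. repeat split; auto; eapply lt_trans; eauto. }
    destruct (all_or_none K3 Ev) as (K4 & S4 & I4 & U4 & C4); auto.
    + intros a Ha. destruct (above a a Ha Ha) as (d & Hd & Had & _). exists d. auto 9.
    + intros a b Ha Hb (d & Hd & Had & Hbd & HE). exists d. auto 9.
    + intros a b c Ha Hb Hc (d & Hd & Had & Hbd & HE) (e & He & Hbe & Hce & HE').
      destruct (above d e Hd He) as (g & Hg & Hdg & Heg).
      assert (a ∈ g /\ b ∈ g /\ c ∈ g) as (Hag & Hbg & Hcg).
      { repeat split; eapply lt_trans; eauto. }
      exists g. repeat split; auto. apply (Et a g b g); auto.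
      * apply (transfer a b d g); auto.
      * apply (transfer b c e g); auto.
    + exists K4. repeat split; auto. right; right.
      assert (F4 : forall a b c d, a ∈ K4 -> b ∈ K4 -> c ∈ K4 -> d ∈ K4 -> a ∈ b -> c ∈ d ->
        E a b c d -> b = d) by (intros a b c d Ha Hb Hc Hd; apply F3; auto).
      destruct C4 as [C4|C4]; [left|right];
        intros a b c d (Ha & Hb & Hab) (Hc & Hd & Hcd); split.
      * intros HE. apply (F4 a b c d); auto.
      * intros <-. destruct (C4 a c Ha Hc) as (e & He & Hae & Hce & HE).
        apply (transfer a c e b); auto.
      * intros HE. assert (b = d) as <- by (apply (F4 a b c d); auto). split; auto.
        assert (Ev a c) by (exists b; auto 9).
        assert (Ev c a) by (exists b; auto 9).
        destruct (lt_total a c) as [H'|[H'|H']]; auto;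
          [destruct (C4 a c)|destruct (C4 c a)]; auto.
      * intros (-> & ->). auto.
Qed.
End CanonicalOmega.

Section Subsets.
Context {L : lang} {I : interp L} {SM : SetModel I}.
Implicit Types (x y z a b c d e h r f X Y Z H K C P : I).

Fixpoint num (n : nat) : I := match n with 0 => emp | S k => succ (num k) end.

Lemma num_om n : num n ∈ om.
Proof. induction n; cbn; auto using om_emp, om_succ. Qed.
Lemma Numeral_iff n x : Numeral n x <-> x = num n.
Proof.
  revert x. induction n as [|n IH]; intros x; cbn.
  - split; [|intros ->; apply Empty_emp]. intros (H1 & H2).
    apply ext; auto; [apply Empty_emp|]. intros z. split; [now intros ?%H2|now intros ?%in_emp].
  - split.
    + intros (y & ->%IH & ->%Succ_iff). auto.
    + intros ->. exists (num n). rewrite IH, Succ_iff. auto.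
Qed.
Lemma in_num n z : z ∈ num n <-> exists i, i < n /\ z = num i.
Proof.
  induction n as [|n IH]; cbn.
  - split; [now intros ?%in_emp|]. intros (i & Hi & _). lia.
  - rewrite in_succ, IH. split.
    + intros [(i & Hi & ->)| ->]; [exists i|exists n]; auto.
    + intros (i & Hi & ->). destruct (Nat.eq_dec i n) as [->|]; auto.
      left. exists i. split; auto. lia.
Qed.
Lemma num_inj i k : num i = num k -> i = k.
Proof.
  intros E. destruct (lt_eq_lt_dec i k) as [[H|H]|H]; auto; exfalso.
  - apply (mem_irrefl (num i)). rewrite E at 2. apply in_num. eauto.
  - apply (mem_irrefl (num k)). rewrite <- E at 2. apply in_num. eauto.
Qed.

Lemma MSubset_iff m s X : MSubset m s X <->
  IsSet s /\ exists l, NoDup l /\ length l = m /\ (forall z, z ∈ s <-> In z l) /\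
    forall z, In z l -> z ∈ X.
Proof.
  split.
  - intros ((Hs & HsX) & k & f & ->%Numeral_iff & (HF & HI) & HS). split; auto.
    assert (Hc : forall i, exists a, i < m -> Rel f a (num i)).
    { intros i. destruct (classic (i < m)) as [Hi|Hi].
      - destruct (HS (num i)) as (a & Ha); [apply in_num; eauto|]. exists a. auto.
      - exists emp. tauto. }
    apply choice in Hc as (g & Hg).
    assert (E : forall z, z ∈ s <-> In z (map g (seq 0 m))).
    { intros z. rewrite in_map_iff. split.
      - intros Hz. destruct HF as (HR & HF). destruct (HF z Hz) as (b & Hb & _).
        destruct (Relation_Rel _ _ _ _ _ HR Hb) as (_ & (i & Hi & ->)%in_num).
        exists i. rewrite in_seq. split; [|lia]. eapply HI. split; [apply Hg; auto|eauto].
      - intros (i & <- & Hi%in_seq). assert (Hi' : i < m) by lia.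
        apply (Relation_Rel f s (num m) _ (num i)); [apply HF|auto]. }
    exists (map g (seq 0 m)). split; [|split; [|split]]; auto.
    + apply NoDup_map_NoDup_ForallPairs; [|apply seq_NoDup].
      intros i i' Hi%in_seq Hi'%in_seq Egg. apply num_inj.
      assert (H1 := Hg i ltac:(lia)). assert (H2 := Hg i' ltac:(lia)). rewrite Egg in H1.
      eapply Function_unique; eauto.
    + now rewrite length_map, length_seq.
    + intros z Hz%E. auto.
  - intros (Hs & l & HN & Hl & E & HX). split.
    { split; auto. intros z Hz%E. auto. }
    exists (num m).
    destruct (list_set (map (fun i => opair (nth i l emp) (num i)) (seq 0 m))) as (Z & _ & HZ).
    set (Q := fun x y => opair x y ∈ Z).
    assert (D : D2 Q) by (unfold Q; dfn).
    assert (EQ : forall x y, Q x y <-> exists i, i < m /\ x = nth i l emp /\ y = num i).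
    { intros x y. unfold Q. rewrite HZ, in_map_iff. split.
      - intros (i & (<- & <-)%opair_inj & Hi%in_seq). exists i. split; auto. lia.
      - intros (i & Hi & -> & ->). exists i. rewrite in_seq. split; auto. lia. }
    exists (mkrel s (num m) Q). split; [now apply Numeral_iff|]. split.
    + apply Injection_mkrel; auto.
      * intros a Ha%E. destruct (In_nth l a emp Ha) as (i & Hi & <-).
        exists (num i). rewrite in_num, EQ. split; [exists i; split; auto; lia|].
        split; [exists i; split; auto; lia|].
        intros c (i' & Hi' & E' & ->)%EQ. f_equal.
        symmetry. apply (proj1 (NoDup_nth l emp) HN); auto. lia.
      * intros a b c Ha Hb (i & _ & E1 & ->)%EQ (i' & _ & E2 & E')%EQ.
        apply num_inj in E' as ->. congruence.
    + intros b (i & Hi & ->)%in_num. exists (nth i l emp). rewrite Rel_mkrel by auto.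
      rewrite E, EQ, in_num. split; [apply nth_In; lia|]. split; eauto.
Qed.

Lemma upair_MSubset a b X : a ∈ X -> b ∈ X -> a <> b -> MSubset 2 (upair a b) X.
Proof.
  intros Ha Hb N. apply MSubset_iff. split; [apply IsSet_upair|].
  exists [a; b]. split; [|split; [|split]]; auto.
  - repeat constructor; cbn; intuition.
  - intros z. rewrite in_upair. cbn. intuition.
  - intros z [<-|[<-|[]]]; auto.
Qed.

(** * Colorings of pairs *)

Section Coloring.
Context {X P C f : I}.
Hypothesis HP : MSubsets 2 P X.
Hypothesis Hf : Function_ f P C.

Lemma color_ex a b : a ∈ X -> b ∈ X -> a <> b -> exists c, Rel f (upair a b) c.
Proof.
  intros Ha Hb N. destruct (proj2 Hf (upair a b)) as (c & Hc & _); eauto.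
  apply HP. now apply upair_MSubset.
Qed.

Lemma SameColor_iff a b c d : SameColor f a b c d <->
  exists k, Rel f (upair a b) k /\ Rel f (upair c d) k.
Proof.
  unfold SameColor. split.
  - intros (p & q & k & ->%UPair_iff & ->%UPair_iff & H). eauto.
  - intros (k & H). exists (upair a b), (upair c d), k. rewrite !UPair_iff. tauto.
Qed.

Lemma SameColor_refl a b : a ∈ X -> b ∈ X -> a <> b -> SameColor f a b a b.
Proof.
  intros Ha Hb N. apply SameColor_iff. destruct (color_ex a b) as (c & Hc); eauto.
Qed.
Lemma SameColor_sym a b c d : SameColor f a b c d -> SameColor f c d a b.
Proof. rewrite !SameColor_iff. intros (k & H1 & H2). eauto. Qed.
Lemma SameColor_trans a b c d e g :
  SameColor f a b c d -> SameColor f c d e g -> SameColor f a b e g.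
Proof.
  rewrite !SameColor_iff. intros (k & H1 & H2) (k' & H3 & H4).
  assert (k = k') as <- by (eapply Function_unique; eauto). eauto.
Qed.
Lemma SameColor_swapl a b c d : SameColor f a b c d -> SameColor f b a c d.
Proof. rewrite !SameColor_iff, (upair_comm a b). auto. Qed.
Lemma SameColor_swapr a b c d : SameColor f a b c d -> SameColor f a b d c.
Proof. rewrite !SameColor_iff, (upair_comm c d). auto. Qed.
End Coloring.

Lemma SameColor_D f : D4 (SameColor f).
Proof. unfold SameColor, UPair. dfn. Qed.

Lemma canonical_intro X f Y R :
  Subset Y X -> Infinite Y -> StrictLinear R Y ->
  canonical_on (Rel R) (SameColor f) ->
  Canonical X f.
Proof.
  intros HYX HY HR HC. exists Y, R. split; [auto|split; [auto|split; [auto|]]].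
  destruct HC as [HC|[HC|[HC|HC]]]; [left|right; left|right; right; left|right; right; right];
    [|intros a b c d (_ & _ & _ & _ & H1 & H2); apply HC; auto ..].
  intros a b c d (Ha & Hb & Hc & Hd & N1 & N2).
  destruct HR as (_ & _ & _ & T).
  destruct (T a b) as [H1|[H1|H1]], (T c d) as [H2|[H2|H2]]; auto; try contradiction.
  - now apply SameColor_swapr, HC.
  - now apply SameColor_swapl, HC.
  - now apply SameColor_swapl, SameColor_swapr, HC.
Qed.

(** * Sets with a countable subset *)

Lemma injection_bounded n : n ∈ om -> forall H f, (forall x, x ∈ H -> x ∈ om) ->
  (forall x, x ∈ H -> exists y, y ∈ n /\ Rel f x y) ->
  (forall x x' y, Rel f x y -> Rel f x' y -> x = x') ->
  exists m, m ∈ om /\ forall x, x ∈ H -> x ∈ m.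
Proof.
  revert n. om_induction.
  - intros H f _ Hf _. exists emp. split; [apply om_emp|]. intros x Hx.
    destruct (Hf x Hx) as (y & Hy%in_emp & _). contradiction.
  - intros n Hn IH H f Hom Hf Hi.
    assert (D : D1 (fun x => ~ Rel f x n)) by dfn.
    destruct (IH (cmp H (fun x => ~ Rel f x n)) f) as (m & Hm & HB); auto.
    + intros x. rewrite in_cmp by auto. intros (? & _). auto.
    + intros x. rewrite in_cmp by auto. intros (Hx & N).
      destruct (Hf x Hx) as (y & [Hy| ->]%in_succ & HR); [eauto|contradiction].
    + destruct (classic (exists x0, x0 ∈ H /\ Rel f x0 n)) as [(x0 & Hx0 & H0)|N].
      * destruct (om_max m x0) as (k & Hk & H1 & H2); auto. exists k. split; auto.
        intros x Hx. destruct (classic (Rel f x n)) as [Hxn|Hxn].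
        -- now rewrite (Hi x x0 n).
        -- apply lt_trans with m; auto. apply HB. rewrite in_cmp; auto.
      * exists m. split; auto. intros x Hx. apply HB. rewrite in_cmp by auto.
        split; auto. intros Hxn. eauto.
Qed.

Lemma canonical_of_injection X P C f j :
  MSubsets 2 P X -> Function_ f P C -> Injection j om X -> Canonical X f.
Proof.
  intros HP Hf Hj.
  assert (Hjf : Function_ j om X) by apply Hj.
  assert (ju : forall a x y, Rel j a x -> Rel j a y -> x = y)
    by (intros; eapply Function_unique; eauto).
  assert (ji : forall a b x, Rel j a x -> Rel j b x -> a = b)
    by (intros; eapply (proj2 Hj); eauto).
  assert (jX : forall a x, Rel j a x -> a ∈ om /\ x ∈ X)
    by (intros a x; apply (Relation_Rel j om X a x), Hjf).
  assert (je : forall a, a ∈ om -> exists x, Rel j a x).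
  { intros a Ha. destruct (proj2 Hjf a Ha) as (x & Hx & _). eauto. }
  assert (DS := SameColor_D f).
  set (E := fun a b c d => exists x y z w,
    Rel j a x /\ Rel j b y /\ Rel j c z /\ Rel j d w /\ SameColor f x y z w).
  assert (DE : D4 E) by (unfold E; dfn).
  assert (EE : forall a b c d x y z w, Rel j a x -> Rel j b y -> Rel j c z -> Rel j d w ->
    (E a b c d <-> SameColor f x y z w)).
  { intros a b c d x y z w Hx Hy Hz Hw. split; [|unfold E; eauto 10].
    intros (x' & y' & z' & w' & Hx' & Hy' & Hz' & Hw' & HS).
    now rewrite (ju a x x'), (ju b y y'), (ju c z z'), (ju d w w'). }
  assert (neq : forall a b x y, Rel j a x -> Rel j b y -> a ∈ b -> x <> y).
  { intros a b x y Hx Hy Hab <-. apply (mem_irrefl a). now rewrite (ji a b x) at 2. }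
  destruct (canonical_omega E) as (H & SH & HH & UH & HC); auto.
  - intros a b Hb Hab. assert (Ha : a ∈ om) by (eapply om_mem; eauto).
    destruct (je a Ha) as (x & Hx), (je b Hb) as (y & Hy). rewrite (EE a b a b x y x y); auto.
    eapply SameColor_refl; eauto; [apply (jX a x)|apply (jX b y)]; auto.
  - intros a b c d _ _ _ _ (x & y & z & w & Hx & Hy & Hz & Hw & HS).
    exists z, w, x, y. repeat split; auto. eapply SameColor_sym; eauto.
  - intros a b c d e g _ _ _ _ _ _ (x & y & z & w & Hx & Hy & Hz & Hw & HS)
      (z' & w' & p & q & Hz' & Hw' & Hp & Hq & HS').
    exists x, y, p, q. repeat split; auto.
    rewrite (ju c z z'), (ju d w w') in HS; auto. eapply SameColor_trans; eauto.
  - set (inY := fun x => exists a, a ∈ H /\ Rel j a x).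
    assert (DY : D1 inY) by (unfold inY; dfn).
    set (Y := cmp X inY).
    assert (EY : forall x, x ∈ Y <-> inY x).
    { intros x. unfold Y. rewrite in_cmp by auto. split; [tauto|].
      intros (a & Ha & Hx). split; [apply (jX a x Hx)|]. now exists a. }
    set (lt := fun x y => exists a b, a ∈ H /\ b ∈ H /\ Rel j a x /\ Rel j b y /\ a ∈ b).
    assert (Dlt : D2 lt) by (unfold lt; dfn).
    assert (ER : forall x y, Rel (mkrel Y Y lt) x y <-> lt x y).
    { intros x y. rewrite Rel_mkrel, !EY by auto. split; [tauto|].
      intros (a & b & Ha & Hb & Hx & Hy & Hab).
      split; [now exists a|split; [now exists b|]]. now exists a, b. }
    apply (canonical_intro X f Y (mkrel Y Y lt)).
    + split; [now apply IsSet_cmp|]. intros x (a & Ha & Hx)%EY. apply (jX a x Hx).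
    + split; [now apply IsSet_cmp|]. rewrite Finite_iff.
      intros (_ & n & g & Hn & (Hg & Hgi) & _).
      assert (Dg : D2 (fun a y => exists x, Rel j a x /\ Rel g x y)) by dfn.
      destruct (injection_bounded n Hn H
        (mkrel om n (fun a y => exists x, Rel j a x /\ Rel g x y))) as (m & Hm & HB); auto.
      * intros a Ha. destruct (je a) as (x & Hx); auto.
        destruct (proj2 Hg x) as (y & Hy & _). { apply EY. now exists a. }
        destruct (Relation_Rel _ _ _ _ _ (proj1 Hg) Hy) as (_ & Hyn).
        exists y. rewrite Rel_mkrel by auto. repeat split; eauto.
      * intros a b y. rewrite !Rel_mkrel by auto.
        intros (_ & _ & x & Hx & Hxy) (_ & _ & x' & Hx' & Hxy').
        assert (x = x') as <- by (eapply Hgi; eauto). eauto.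
      * destruct (UH m Hm) as (h & Hh & Hmh). apply (lt_asym m h); auto.
    + split; [now apply Relation_mkrel|]. split; [|split].
      * intros x (a & b & _ & _ & Hx & Hy & Hab)%ER. now apply (neq a b x x).
      * intros x y z (Hxy%ER & Hyz%ER). apply ER.
        destruct Hxy as (a & b & Ha & Hb & Hx & Hy & Hab),
          Hyz as (b' & c & Hb' & Hc & Hy' & Hz & Hbc).
        assert (b = b') as <- by eauto.
        exists a, c. repeat split; auto. apply lt_trans with b; auto.
      * intros x y ((a & Ha & Hx)%EY & (b & Hb & Hy)%EY). rewrite !ER.
        destruct (lt_total a b) as [Hab|[->|Hab]]; auto.
        -- left. exists a, b. auto.
        -- right; left. eauto.
        -- right; right. exists b, a. auto.
    + apply (canonical_on_transfer (Rel j) _ E) with (5 := HC); auto.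
      intros x y (a & b & Ha & Hb & Hx & Hy & Hab)%ER. eauto 8.
Qed.

Lemma DF_eq_F_CRT v : sat I v DF_eq_F -> sat I v CRT.
Proof.
  rewrite sat_DF_eq_F, sat_CRT. intros HD X P C f (HX & HP & _ & Hf).
  destruct (classic (exists w j, Omega w /\ Injection j w X)) as [(w & j & ->%Omega_iff & Hj)|N].
  - eapply canonical_of_injection; eauto.
  - destruct HX as (HX & NF). destruct NF. apply HD. split; auto.
Qed.
End Subsets.

(** * Models of ZF and ZFA *)

Lemma closed_zf_axiom {L} (q : form L) : zf_axiom q -> free_below 0 q.
Proof.
  intros []; try (apply free_below_forall_closure; now rewrite Nat.add_0_r);
    destruct L; cbn; repeat split; lia.
Qed.

Lemma closed_ZFA q : ZFA q -> free_below 0 q.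
Proof. intros []; [now apply closed_zf_axiom| |]; cbn; repeat split; lia. Qed.

Lemma SetModel_ZF (I : interp LZF) (m : I) : models I ZF -> SetModel I.
Proof.
  intros H. split; auto; [cbn; auto|].
  assert (F : free_below 0 (@separation LZF fBot)) by (cbn; repeat split; lia).
  destruct (proj1 (sat_separation I (fun _ => m) fBot) (H _ (ax_separation F) _) m) as (y & Hy).
  exists y. split; [cbn; auto|]. intros z Hz%Hy. apply Hz.
Qed.

Lemma sat_empty_set_axiom (I : interp LZFA) (v : nat -> I) :
  sat I v empty_set_axiom <-> forall x : I, ~ x ∈ icst (L := LZFA) I c_empty.
Proof. cbn. tauto. Qed.

Lemma sat_atoms_axiom (I : interp LZFA) (v : nat -> I) :
  sat I v atoms_axiom <-> forall z : I, z ∈ icst (L := LZFA) I c_atoms <->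
    (~ z = icst (L := LZFA) I c_empty /\ ~ exists x, x ∈ z).
Proof.
  unfold atoms_axiom, close. repeat sat_step.
Qed.

Lemma SetModel_ZFA (I : interp LZFA) : models I ZFA -> SetModel I.
Proof.
  intros H.
  assert (HE := proj1 (sat_empty_set_axiom I (fun _ => icst (L := LZFA) I c_empty))
    (H _ zfa_empty_set _)).
  assert (HA := proj1 (sat_atoms_axiom I (fun _ => icst (L := LZFA) I c_empty))
    (H _ zfa_atoms _)).
  split.
  - intros q Hq. apply H. now constructor.
  - intros x y Hxy (_ & N)%HA. eauto.
  - exists (icst (L := LZFA) I c_empty). split; [|exact HE].
    intros (N & _)%HA. auto.
Qed.

Theorem ZFA_DF_eq_F_CRT : proves ZFA (fImp DF_eq_F CRT).
Proof.
  apply completeness; [apply closed_ZFA|]. intros I HI v.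
  assert (SM := SetModel_ZFA I HI). exact (DF_eq_F_CRT v).
Qed.

(** * Canonical sets from homogeneous patterns *)

Section Patterns.
Context {T : Type} (E : T -> T -> T -> T -> Prop).

(* The patterns 3 to 6 are never homogeneous. *)
Definition pattern (i : nat) (a b c d : T) : Prop :=
  let e1 := E a b a c in let e2 := E a c b c in let e3 := E a b b c in
  let e4 := E a b c d in let e5 := E a c b d in let e6 := E a d b c in
  match i with
  | 0 => e1 /\ e2
  | 1 => e1 /\ ~ e2
  | 2 => ~ e1 /\ e2
  | 3 => ~ e1 /\ ~ e2 /\ e3
  | 4 => ~ e1 /\ ~ e2 /\ ~ e3 /\ e4
  | 5 => ~ e1 /\ ~ e2 /\ ~ e3 /\ ~ e4 /\ e5
  | 6 => ~ e1 /\ ~ e2 /\ ~ e3 /\ ~ e4 /\ ~ e5 /\ e6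
  | 7 => ~ e1 /\ ~ e2 /\ ~ e3 /\ ~ e4 /\ ~ e5 /\ ~ e6
  | _ => False
  end.

Lemma pattern_ex a b c d : exists i, i < 8 /\ pattern i a b c d.
Proof.
  destruct (classic (E a b a c)); destruct (classic (E a c b c));
    [exists 0|exists 1|exists 2|]; try (cbn; split; [lia|tauto]).
  destruct (classic (E a b b c)); [exists 3; cbn; split; [lia|tauto]|].
  destruct (classic (E a b c d)); [exists 4; cbn; split; [lia|tauto]|].
  destruct (classic (E a c b d)); [exists 5; cbn; split; [lia|tauto]|].
  destruct (classic (E a d b c)); [exists 6|exists 7]; cbn; (split; [lia|tauto]).
Qed.

Lemma pattern_unique i i' a b c d : pattern i a b c d -> pattern i' a b c d -> i = i'.
Proof.
  destruct i as [|[|[|[|[|[|[|[|i]]]]]]]], i' as [|[|[|[|[|[|[|[|i']]]]]]]]; cbn; tauto.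
Qed.

Lemma pattern_iff i a b c d a' b' c' d' :
  (E a b a c <-> E a' b' a' c') -> (E a c b c <-> E a' c' b' c') ->
  (E a b b c <-> E a' b' b' c') -> (E a b c d <-> E a' b' c' d') ->
  (E a c b d <-> E a' c' b' d') -> (E a d b c <-> E a' d' b' c') ->
  pattern i a b c d -> pattern i a' b' c' d'.
Proof. destruct i as [|[|[|[|[|[|[|[|i]]]]]]]]; cbn; tauto. Qed.

End Patterns.

Section Homogeneous.
Context {T : Type} (lt : T -> T -> Prop) (E : T -> T -> T -> T -> Prop).
Variables (Y Z : T -> Prop).
Hypothesis lt_irr : forall a, ~ lt a a.
Hypothesis lt_tr : forall a b c, lt a b -> lt b c -> lt a c.
Hypothesis lt_tot : forall a b, Y a -> Y b -> lt a b \/ a = b \/ lt b a.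
Hypothesis E_refl : forall a b, Y a -> Y b -> lt a b -> E a b a b.
Hypothesis E_sym : forall a b c d, E a b c d -> E c d a b.
Hypothesis E_trans : forall a b c d e f, E a b c d -> E c d e f -> E a b e f.
Hypothesis ZY : forall a, Z a -> Y a.
Hypothesis Z_top : forall a, Z a -> exists b, Y b /\ lt a b.
Hypothesis chain : exists a b c d e f,
  Y a /\ Y b /\ Y c /\ Y d /\ Y e /\ Y f /\ lt a b /\ lt b c /\ lt c d /\ lt d e /\ lt e f.

Lemma canonical_of_pattern i :
  (forall a b c d, Y a -> Y b -> Y c -> Y d -> lt a b -> lt b c -> lt c d -> pattern E i a b c d) ->
  canonical_on (fun a b => Z a /\ Z b /\ lt a b) E.
Proof.
  intros HP.
  assert (H3 : forall a b c, Z a -> Z b -> Z c -> lt a b -> lt b c ->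
    exists d, pattern E i a b c d).
  { intros a b c Ha Hb Hc Hab Hbc. destruct (Z_top c Hc) as (d & Hd & Hcd).
    exists d. apply HP; auto. }
  destruct chain as (p1 & p2 & p3 & p4 & p5 & p6 & Y1 & Y2 & Y3 & Y4 & Y5 & Y6 &
    L12 & L23 & L34 & L45 & L56).
  assert (L13 := lt_tr _ _ _ L12 L23). assert (L24 := lt_tr _ _ _ L23 L34).
  assert (L35 := lt_tr _ _ _ L34 L45). assert (L46 := lt_tr _ _ _ L45 L56).
  assert (L14 := lt_tr _ _ _ L12 L24).
  assert (max : forall b d, Z b -> Z d ->
    exists m, Z m /\ (b = m \/ lt b m) /\ (d = m \/ lt d m)).
  { intros b d Hb Hd. destruct (lt_tot b d) as [H|[->|H]]; auto;
      [exists d|exists d|exists b]; auto. }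
  assert (le_tr : forall a b m, lt a b -> b = m \/ lt b m -> lt a m).
  { intros a b m H [<-|H']; eauto. }
  assert (min : forall b d, Z b -> Z d ->
    exists m, Z m /\ (m = b \/ lt m b) /\ (m = d \/ lt m d)).
  { intros b d Hb Hd. destruct (lt_tot b d) as [H|[->|H]]; auto;
      [exists b|exists d|exists d]; auto. }
  assert (le_tr' : forall a b m, lt a b -> m = a \/ lt m a -> lt m b).
  { intros a b m H [->|H']; eauto. }
  destruct i as [|[|[|[|[|[|[|[|i]]]]]]]].
  - left. intros a b c d (Ha & Hb & Hab) (Hc & Hd & Hcd).
    destruct (max b d Hb Hd) as (m & Hm & Hbm & Hdm).
    assert (Ham := le_tr _ _ _ Hab Hbm). assert (Hcm := le_tr _ _ _ Hcd Hdm).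
    assert (H1 : forall x y, Z x -> Z y -> lt x y -> y = m \/ lt y m -> E x y x m).
    { intros x y Hx Hy Hxy [<-|Hym]; auto. destruct (H3 x y m) as (w & Hw); auto. apply Hw. }
    assert (H4 : forall x y, Z x -> Z y -> lt y m -> lt x y -> E x m y m).
    { intros x y Hx Hy Hym Hxy. destruct (H3 x y m) as (w & Hw); auto. apply Hw. }
    apply E_trans with a m; auto. apply E_trans with c m; auto.
    destruct (lt_tot a c) as [H|[->|H]]; auto.
  - right; left. intros a b c d (Ha & Hb & Hab) (Hc & Hd & Hcd).
    destruct (max b d Hb Hd) as (m & Hm & Hbm & Hdm).
    assert (Ham := le_tr _ _ _ Hab Hbm). assert (Hcm := le_tr _ _ _ Hcd Hdm).
    assert (H1 : forall x y, Z x -> Z y -> lt x y -> y = m \/ lt y m -> E x y x m).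
    { intros x y Hx Hy Hxy [<-|Hym]; auto. destruct (H3 x y m) as (w & Hw); auto. apply Hw. }
    assert (H4 : forall x y, Z x -> Z y -> lt y m -> lt x y -> ~ E x m y m).
    { intros x y Hx Hy Hym Hxy. destruct (H3 x y m) as (w & Hw); auto. apply Hw. }
    split.
    + intros HE. assert (HE' : E a m c m).
      { apply E_trans with a b; auto. apply E_trans with c d; auto. }
      destruct (lt_tot a c) as [H|[->|H]]; auto; exfalso; [apply (H4 a c)|apply (H4 c a)]; auto.
    + intros <-. apply E_trans with a m; auto.
  - right; right; left. intros a b c d (Ha & Hb & Hab) (Hc & Hd & Hcd).
    destruct (min a c Ha Hc) as (m & Hm & Hma & Hmc).
    assert (Hmb := le_tr' _ _ _ Hab Hma). assert (Hmd := le_tr' _ _ _ Hcd Hmc).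
    assert (H1 : forall x y, Z x -> Z y -> lt x y -> m = x \/ lt m x -> E x y m y).
    { intros x y Hx Hy Hxy [<-|Hym]; auto. destruct (H3 m x y) as (w & Hw); auto.
      apply E_sym, Hw. }
    assert (H4 : forall x y, Z x -> Z y -> lt m x -> lt x y -> ~ E m x m y).
    { intros x y Hx Hy Hym Hxy. destruct (H3 m x y) as (w & Hw); auto. apply Hw. }
    split.
    + intros HE. assert (HE' : E m b m d).
      { apply E_trans with a b; auto. apply E_trans with c d; auto. }
      destruct (lt_tot b d) as [H|[->|H]]; auto; exfalso; [apply (H4 b d)|apply (H4 d b)]; auto.
    + intros <-. apply E_trans with m b; auto.
  - exfalso. destruct (HP p1 p2 p3 p4) as (_ & _ & A), (HP p1 p2 p4 p5) as (_ & _ & B),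
      (HP p2 p3 p4 p5) as (C & _); auto.
    apply C, E_trans with p1 p2; auto.
  - exfalso. destruct (HP p1 p2 p3 p4) as (_ & _ & _ & A), (HP p1 p2 p3 p5) as (_ & _ & _ & B),
      (HP p3 p4 p5 p6) as (C & _); auto.
    apply C, E_trans with p1 p2; auto.
  - exfalso. destruct (HP p1 p2 p3 p4) as (_ & _ & _ & _ & A),
      (HP p1 p2 p3 p5) as (_ & _ & _ & _ & B),
      (HP p2 p4 p5 p6) as (C & _); auto.
    apply C, E_trans with p1 p3; auto.
  - exfalso. destruct (HP p1 p2 p3 p4) as (_ & _ & _ & _ & _ & A),
      (HP p1 p2 p3 p5) as (_ & _ & _ & _ & _ & B),
      (HP p1 p4 p5 p6) as (C & _); auto.
    apply C, E_trans with p2 p3; auto.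
  - right; right; right.
    assert (G : forall a b c d, Z a -> Z b -> Z c -> Z d -> lt a b -> lt c d -> lt a c ->
      ~ E a b c d).
    { intros a b c d Ha Hb Hc Hd Hab Hcd Hac.
      destruct (lt_tot b d) as [Hbd|[->|Hbd]]; auto.
      - destruct (lt_tot b c) as [Hbc|[->|Hbc]]; auto.
        + apply (HP a b c d); auto.
        + destruct (H3 a c d) as (w & Hw); auto. apply Hw.
        + apply (HP a c b d); auto.
      - destruct (H3 a c d) as (w & Hw); auto. apply Hw.
      - apply (HP a c d b); auto. }
    intros a b c d (Ha & Hb & Hab) (Hc & Hd & Hcd). split; [|intros (<- & <-); auto].
    intros HE. destruct (lt_tot a c) as [H|[->|H]]; auto.
    + destruct (G a b c d); auto.
    + split; auto. destruct (lt_tot b d) as [H|[->|H]]; auto.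
      * destruct (H3 c b d) as (w & Hw); auto. destruct Hw as (Hw & _). contradiction.
      * destruct (H3 c d b) as (w & Hw); auto. destruct Hw as (Hw & _). destruct Hw; auto.
    + destruct (G c d a b); auto.
  - destruct (HP p1 p2 p3 p4); auto.
Qed.

End Homogeneous.

Section Sorting.
Context {T : Type} (lt : T -> T -> Prop) (Y : T -> Prop).
Hypothesis lt_irr : forall a, ~ lt a a.
Hypothesis lt_tr : forall a b c, lt a b -> lt b c -> lt a c.
Hypothesis lt_tot : forall a b, Y a -> Y b -> lt a b \/ a = b \/ lt b a.

Lemma sort_ex l : NoDup l -> (forall a, In a l -> Y a) ->
  exists l', StronglySorted lt l' /\ length l' = length l /\ forall z, In z l' <-> In z l.
Proof.
  induction l as [|a l IH]; intros HN HY.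
  - exists []. split; [constructor|split; [auto|tauto]].
  - inversion HN as [|? ? Ha HN']. subst.
    destruct IH as (l' & HS & HL & HI); auto; [intros; apply HY; cbn; auto|].
    assert (G : forall k, StronglySorted lt k -> (forall b, In b k -> Y b /\ b <> a) ->
      exists k', StronglySorted lt k' /\ length k' = S (length k) /\
        forall z, In z k' <-> a = z \/ In z k).
    { induction k as [|b k IHk]; intros Hk Hka.
      - exists [a]. split; [repeat constructor|split; [auto|cbn; tauto]].
      - apply StronglySorted_inv in Hk as (Hk & Hbk). rewrite Forall_forall in Hbk.
        destruct (Hka b) as (Hb & Nb); [cbn; auto|].
        destruct (lt_tot a b) as [H|[H|H]]; auto; [apply HY; cbn; auto| |congruence|].
        + exists (a :: b :: k). split; [|split; [auto|cbn; tauto]].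
          constructor; [constructor; auto; now apply Forall_forall|].
          constructor; auto. apply Forall_forall. intros z Hz. apply lt_tr with b; auto.
        + destruct IHk as (k' & H1 & H4 & H3); auto; [intros; apply Hka; cbn; auto|].
          exists (b :: k'). split; [|split; [cbn; lia|intros z; cbn; rewrite H3; tauto]].
          constructor; auto. apply Forall_forall. intros z [<-|Hz]%H3; auto. }
    destruct (G l' HS) as (k & H1 & H2 & H3).
    { intros b Hb%HI. split; [apply HY; cbn; auto|]. now intros ->. }
    exists k. split; auto. split; [cbn; lia|]. intros z. rewrite H3, HI. cbn. tauto.
Qed.

Lemma sorted_unique l : forall l', StronglySorted lt l -> StronglySorted lt l' ->
  (forall z, In z l <-> In z l') -> l = l'.
Proof.
  induction l as [|a l IH]; intros [|b l'] H1 H2 HI; auto.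
  - destruct (proj2 (HI b) (or_introl eq_refl)).
  - destruct (proj1 (HI a) (or_introl eq_refl)).
  - apply StronglySorted_inv in H1 as (H1 & Ha), H2 as (H2 & Hb).
    rewrite Forall_forall in Ha, Hb.
    assert (a = b) as <-.
    { destruct (proj1 (HI a) (or_introl eq_refl)) as [|Hab]; auto.
      destruct (proj2 (HI b) (or_introl eq_refl)) as [|Hba]; auto.
      destruct (lt_irr a). eauto. }
    f_equal. apply IH; auto. intros z. split; intros Hz.
    + destruct (proj1 (HI z) (or_intror Hz)) as [<-|]; auto. destruct (lt_irr a); auto.
    + destruct (proj2 (HI z) (or_intror Hz)) as [<-|]; auto. destruct (lt_irr a); auto.
Qed.
End Sorting.

(** * The Ordering Principle and Ramsey's theorem for 4-sets *)

Section OrderedRamsey.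
Context {L : lang} {I : interp L} {SM : SetModel I}.
Implicit Types (x y z a b c d e h r f X Y Z H K C P : I).

Lemma DE_Numeral n t : DTm t -> DE (fun v : nat -> I => Numeral n (t v)).
Proof.
  intros. apply (DE_iff _ (fun v => t v = num n)); [intros; apply Numeral_iff|]. dfn.
Qed.

Lemma MSubset_D m X : D1 (fun s : I => MSubset m s X).
Proof.
  unfold MSubset, Subset, Bijection, Injection, Function_, Relation, OPair, UPair.
  dfn. apply DE_Numeral. dfn.
Qed.

Lemma OP_RT_CRT v : sat I v OP -> sat I v (RT 4 203) -> sat I v CRT.
Proof.
  rewrite sat_OP, sat_RT, sat_CRT. intros HOP HRT X P C f (HX & HP & _ & Hf).
  destruct (HOP X (proj1 HX)) as (R & HR).
  assert (RX : forall a b, Rel R a b -> a ∈ X /\ b ∈ X)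
    by (intros; eapply Relation_Rel; [apply HR|eauto]).
  destruct HR as (_ & Rirr & Rtr' & Rtot').
  assert (Rtr : forall a b c, Rel R a b -> Rel R b c -> Rel R a c) by eauto.
  assert (Rtot : forall a b, a ∈ X -> b ∈ X -> Rel R a b \/ a = b \/ Rel R b a) by auto.
  assert (DS := SameColor_D f).
  set (sorts := fun s a b c d => Rel R a b /\ Rel R b c /\ Rel R c d /\
    forall z, z ∈ s <-> z = a \/ z = b \/ z = c \/ z = d).
  assert (sorts_ex : forall s, MSubset 4 s X -> exists a b c d, sorts s a b c d).
  { intros s (Hs & l & HN & Hl & HI & HlX)%MSubset_iff.
    destruct (sort_ex (Rel R) (fun x => x ∈ X) Rtr Rtot l HN HlX)
      as ([|a [|b [|c [|d [|? ?]]]]] & HS & HL & HI'); cbn in HL; try lia.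
    apply StronglySorted_inv in HS as (HS & Ha). apply StronglySorted_inv in HS as (HS & Hb).
    apply StronglySorted_inv in HS as (HS & Hc). rewrite Forall_forall in Ha, Hb, Hc.
    exists a, b, c, d. repeat split; [apply Ha|apply Hb|apply Hc| |]; cbn; auto.
    - intros Hz%HI%HI'. cbn in Hz. intuition.
    - intros Hz. apply HI, HI'. cbn. intuition. }
  assert (sorts_unique : forall s a b c d a' b' c' d', sorts s a b c d -> sorts s a' b' c' d' ->
    [a; b; c; d] = [a'; b'; c'; d']).
  { assert (G : forall a b c d, Rel R a b -> Rel R b c -> Rel R c d ->
      StronglySorted (Rel R) [a; b; c; d]).
    { intros. repeat constructor; eauto 6. }
    intros s a b c d a' b' c' d' (H1 & H2 & H3 & H4) (H5 & H6 & H7 & H8).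
    apply (sorted_unique (Rel R) Rirr); auto.
    intros z. transitivity (z ∈ s); [rewrite H4|rewrite H8]; cbn; intuition. }
  set (col := fun s y => exists a b c d, sorts s a b c d /\
    (pattern (SameColor f) 0 a b c d /\ y = num 0 \/ pattern (SameColor f) 1 a b c d /\ y = num 1 \/
     pattern (SameColor f) 2 a b c d /\ y = num 2 \/ pattern (SameColor f) 3 a b c d /\ y = num 3 \/
     pattern (SameColor f) 4 a b c d /\ y = num 4 \/ pattern (SameColor f) 5 a b c d /\ y = num 5 \/
     pattern (SameColor f) 6 a b c d /\ y = num 6 \/ pattern (SameColor f) 7 a b c d /\ y = num 7)).
  assert (Dcol : D2 col) by (unfold col, sorts; cbn [pattern]; dfn).
  assert (Ecol : forall s y, col s y <-> exists a b c d i, sorts s a b c d /\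
    pattern (SameColor f) i a b c d /\ y = num i).
  { intros s y. split.
    - intros (a & b & c & d & Hs & Hp). exists a, b, c, d.
      destruct Hp as [?|[?|[?|[?|[?|[?|[?|?]]]]]]]; eauto.
    - intros (a & b & c & d & i & Hs & Hp & ->). exists a, b, c, d. split; auto.
      destruct i as [|[|[|[|[|[|[|[|i]]]]]]]]; [tauto ..|destruct Hp]. }
  clearbody col.
  assert (D4 : D1 (fun s : I => MSubset 4 s X)) by apply MSubset_D.
  set (P4 := cmp (pow X) (fun s => MSubset 4 s X)).
  assert (HP4 : forall s, s ∈ P4 <-> MSubset 4 s X).
  { intros s. unfold P4. rewrite in_cmp, in_pow by auto. unfold MSubset. tauto. }
  set (chi := mkrel P4 (num 203) col).
  destruct (HRT X P4 (num 203) chi) as (Y & (HYs & HYX) & HYi & k & Hk & HYk).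
  { split; [auto|split; [|split]].
    - split; auto. now apply IsSet_cmp.
    - now apply Numeral_iff.
    - apply Function_mkrel; auto. intros s Hs%HP4.
      destruct (sorts_ex s Hs) as (a & b & c & d & H).
      destruct (pattern_ex (SameColor f) a b c d) as (i & Hi & Hp).
      exists (num i). split; [apply in_num; exists i; split; [lia|auto]|].
      split; [apply Ecol; exists a, b, c, d, i; auto|].
      intros y (a' & b' & c' & d' & i' & H' & Hp' & ->)%Ecol.
      assert (E := sorts_unique _ _ _ _ _ _ _ _ _ H H'). inversion E; subst a' b' c' d'.
      f_equal. eapply pattern_unique; eauto. }
  assert (HY4 : forall a b c d, a ∈ Y -> b ∈ Y -> c ∈ Y -> d ∈ Y ->
    Rel R a b -> Rel R b c -> Rel R c d ->
    exists i, k = num i /\ pattern (SameColor f) i a b c d).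
  { intros a b c d Ha Hb Hc Hd Hab Hbc Hcd.
    destruct (list_set [a; b; c; d]) as (s & Hs & HI).
    assert (Hs4 : MSubset 4 s Y).
    { apply MSubset_iff. split; auto. exists [a; b; c; d].
      split; [|split; [auto|split; [auto|intros z [<-|[<-|[<-|[<-|[]]]]]; auto]]].
      assert (N : forall x y, Rel R x y -> x <> y) by (intros x y H <-; exact (Rirr x H)).
      repeat constructor; cbn; [intros [E|[E|[E|[]]]]|intros [E|[E|[]]]|intros [E|[]]|tauto];
        symmetry in E; revert E; apply N; eauto. }
    apply HYk in Hs4. unfold chi in Hs4. rewrite Rel_mkrel in Hs4 by auto.
    destruct Hs4 as (_ & _ & (a' & b' & c' & d' & i & H' & Hp & ->)%Ecol).
    exists i. split; auto.
    assert (H : sorts s a b c d).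
    { repeat split; auto; rewrite HI; cbn; intuition. }
    assert (E := sorts_unique _ _ _ _ _ _ _ _ _ H H'). now inversion E; subst a' b' c' d'. }
  assert (chain : exists a b c d e h, a ∈ Y /\ b ∈ Y /\ c ∈ Y /\ d ∈ Y /\ e ∈ Y /\ h ∈ Y /\
    Rel R a b /\ Rel R b c /\ Rel R c d /\ Rel R d e /\ Rel R e h).
  { destruct (Infinite_NoDup Y HYi 6) as (l & Hl & HN & HlY).
    destruct (sort_ex (Rel R) (fun x => x ∈ X) Rtr Rtot l HN)
      as (l' & HS & HL & HI); auto.
    rewrite Hl in HL.
    assert (HlY' : forall z, In z l' -> z ∈ Y) by (intros z Hz%HI; auto).
    destruct l' as [|a [|b [|c [|d [|e [|h [|? ?]]]]]]]; cbn in HL; try lia.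
    exists a, b, c, d, e, h. cbn in HlY'.
    repeat match goal with H : StronglySorted _ (_ :: _) |- _ =>
      apply StronglySorted_inv in H as (H & ?) end.
    repeat match goal with H : Forall _ (_ :: _) |- _ => apply Forall_inv in H end.
    repeat split; auto 10. }
  assert (exists i, k = num i) as (i & ->).
  { destruct chain as (a & b & c & d & e & h & Ha & Hb & Hc & Hd & _ & _ & Hab & Hbc & Hcd & _).
    destruct (HY4 a b c d) as (i & Hi & _); eauto. }
  assert (DT : D1 (fun z => exists y, y ∈ Y /\ Rel R z y)) by dfn.
  set (Z := cmp Y (fun z => exists y, y ∈ Y /\ Rel R z y)).
  assert (EZ : forall z, z ∈ Z <-> z ∈ Y /\ exists y, y ∈ Y /\ Rel R z y)
    by (intros z; exact (in_cmp _ _ _ DT)).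
  assert (HZi : Infinite Z).
  { destruct (classic (exists m, m ∈ Y /\ forall y, y ∈ Y -> ~ Rel R m y)) as [(m & Hm & Hmax)|N].
    - apply (Infinite_remove Y m); auto; [now apply IsSet_cmp|].
      intros z. rewrite EZ. split.
      + intros (Hz & y & Hy & Hzy). split; auto. intros ->. eapply Hmax; eauto.
      + intros (Hz & Nz). split; auto. exists m. split; auto.
        destruct (Rtot z m) as [H|[H|H]]; auto; [contradiction|]. destruct (Hmax z); auto.
    - replace Z with Y; auto. apply ext; auto; [now apply IsSet_cmp|].
      intros z. rewrite EZ. split; [|tauto]. intros Hz. split; auto.
      apply NNPP. intros N'. apply N. exists z. split; auto. intros y Hy Hzy. eauto. }
  assert (ZX : forall z, z ∈ Z -> z ∈ X) by (intros z (Hz & _)%EZ; auto).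
  assert (DR : D2 (Rel R)) by dfn.
  assert (ER : forall a b, Rel (mkrel Z Z (Rel R)) a b <-> a ∈ Z /\ b ∈ Z /\ Rel R a b)
    by (intros; now apply Rel_mkrel).
  apply (canonical_intro X f Z (mkrel Z Z (Rel R))); auto.
  - split; auto. now apply IsSet_cmp.
  - split; [now apply Relation_mkrel|split; [|split]].
    + intros a (_ & _ & H)%ER. exact (Rirr a H).
    + intros a b c ((? & ? & ?)%ER & (? & ? & ?)%ER). apply ER. eauto.
    + intros a b (Ha & Hb). rewrite !ER. destruct (Rtot a b) as [H|[H|H]]; auto.
  - apply (canonical_on_transfer eq (fun a b => a ∈ Z /\ b ∈ Z /\ Rel R a b) (SameColor f));
      [congruence|congruence|intros u w H%ER; eauto|intros; now subst|].
    apply canonical_of_pattern with (Y := fun y => y ∈ Y) (i := i); auto.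
    + intros a b Ha Hb Hab. eapply SameColor_refl; eauto. intros <-. exact (Rirr a Hab).
    + apply SameColor_sym.
    + eapply SameColor_trans; eauto.
    + intros z (Hz & _)%EZ. auto.
    + intros z (_ & Hz)%EZ. auto.
    + intros a b c d Ha Hb Hc Hd Hab Hbc Hcd.
      destruct (HY4 a b c d) as (i' & E%num_inj & Hp); auto. now subst i'.
Qed.
End OrderedRamsey.

Theorem ZF_OP_RT_CRT : proves ZF (fImp (fAnd OP (RT 4 203)) CRT).
Proof.
  apply completeness; [apply closed_zf_axiom|]. intros I HI v.
  assert (SM := SetModel_ZF I (v 0) HI). intros H. apply NNPP. intros N.
  apply H. intros H1 H2. exact (N (OP_RT_CRT v H1 H2)).
Qed.

(** * Automorphisms of the real line *)

Record aut : Type :=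
  { ap :> R -> R; ai : R -> R;
    ap_ai : forall x, ap (ai x) = x;
    ai_ap : forall x, ai (ap x) = x;
    ap_mono : forall x y, (x < y)%R -> (ap x < ap y)%R }.

Lemma ap_lt (g : aut) x y : (ap g x < ap g y)%R <-> (x < y)%R.
Proof.
  split; [|apply ap_mono]. intros H. destruct (Rtotal_order x y) as [?|[->|H']]; auto.
  - lra.
  - apply (ap_mono g) in H'. lra.
Qed.
Lemma ap_inj (g : aut) x y : ap g x = ap g y -> x = y.
Proof. intros H. rewrite <- (ai_ap g x), H. apply ai_ap. Qed.

Definition aut_id : aut.
Proof. now exists (fun x => x) (fun x => x). Defined.
Definition aut_comp (g h : aut) : aut.
Proof.
  exists (fun x => g (h x)) (fun x => ai h (ai g x)).
  - intros x. now rewrite !ap_ai.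
  - intros x. now rewrite !ai_ap.
  - intros x y H. now apply ap_mono, ap_mono.
Defined.
Definition aut_inv (g : aut) : aut.
Proof.
  exists (ai g) (ap g); [apply ai_ap|apply ap_ai|].
  intros x y H. apply (ap_lt g). now rewrite !ap_ai.
Defined.

Definition pw (u p q v x : R) : R :=
  (if Rle_dec x u then x
   else if Rle_dec x p then u + (x - u) * ((q - u) / (p - u))
   else if Rle_dec x v then v - (v - x) * ((v - q) / (v - p))
   else x)%R.

Section Piecewise.
Local Open Scope R_scope.

Lemma pw_cases u p q v x : u < p -> p < v -> u < q -> q < v ->
  (x <= u /\ pw u p q v x = x) \/
  (u < x <= p /\ u < pw u p q v x <= q /\ (pw u p q v x - u) * (p - u) = (x - u) * (q - u)) \/
  (p < x <= v /\ q < pw u p q v x <= v /\ (v - pw u p q v x) * (v - p) = (v - x) * (v - q)) \/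
  (v < x /\ pw u p q v x = x).
Proof.
  intros H1 H2 H3 H4. unfold pw.
  destruct (Rle_dec x u) as [A|A]; [left; auto|right].
  destruct (Rle_dec x p) as [B|B]; [left|right].
  - assert (E : (u + (x - u) * ((q - u) / (p - u)) - u) * (p - u) = (x - u) * (q - u))
      by (field; lra).
    set (y := u + (x - u) * ((q - u) / (p - u))) in *. clearbody y.
    split; [lra|]. split; auto. split; nra.
  - destruct (Rle_dec x v) as [C|C]; [left|right; lra].
    assert (E : (v - (v - (v - x) * ((v - q) / (v - p)))) * (v - p) = (v - x) * (v - q))
      by (field; lra).
    set (y := v - (v - x) * ((v - q) / (v - p))) in *. clearbody y.
    split; [lra|]. split; auto. split; nra.
Qed.

Lemma pw_inv u p q v x : u < p -> p < v -> u < q -> q < v -> pw u q p v (pw u p q v x) = x.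
Proof.
  intros H1 H2 H3 H4.
  destruct (pw_cases u p q v x) as [A|[A|[A|A]]]; auto;
  destruct (pw_cases u q p v (pw u p q v x)) as [B|[B|[B|B]]]; auto; try lra.
  - destruct A as (_ & _ & A), B as (_ & _ & B). rewrite A in B.
    assert (pw u q p v (pw u p q v x) - u = x - u); [|lra].
    apply Rmult_eq_reg_r with (q - u); lra.
  - destruct A as (_ & _ & A), B as (_ & _ & B). rewrite A in B.
    assert (v - pw u q p v (pw u p q v x) = v - x); [|lra].
    apply Rmult_eq_reg_r with (v - q); lra.
Qed.

Lemma pw_mono u p q v x y : u < p -> p < v -> u < q -> q < v -> x < y ->
  pw u p q v x < pw u p q v y.
Proof.
  intros H1 H2 H3 H4 H.
  destruct (pw_cases u p q v x) as [A|[A|[A|A]]]; auto;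
  destruct (pw_cases u p q v y) as [B|[B|[B|B]]]; auto; try lra; nra.
Qed.
End Piecewise.

Definition fixes (g : aut) (E : list R) : Prop := forall e, In e E -> ap g e = e.

Lemma gap_left E p : exists u, (u < p)%R /\ forall e, In e E -> (e < p)%R -> (e <= u)%R.
Proof.
  induction E as [|e E (u & Hu & H)].
  - exists (p - 1)%R. split; [lra|intros e []].
  - destruct (Rlt_dec e p) as [He|He].
    + exists (Rmax e u). split; [now apply Rmax_lub_lt|].
      intros d [<-|Hd] Hdp; [apply Rmax_l|]. eapply Rle_trans; [apply H; auto|apply Rmax_r].
    + exists u. split; auto. intros d [<-|Hd] Hdp; [contradiction|auto].
Qed.

Lemma gap_right E p : exists v, (p < v)%R /\ forall e, In e E -> (p < e)%R -> (v <= e)%R.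
Proof.
  destruct (gap_left (map Ropp E) (- p)) as (u & Hu & H).
  exists (- u)%R. split; [lra|]. intros e He Hpe.
  specialize (H (- e)%R (in_map _ _ _ He) ltac:(lra)). lra.
Qed.

Definition same_cut (E : list R) (p q : R) : Prop :=
  forall e, In e E -> ((e < p)%R <-> (e < q)%R) /\ e <> p /\ e <> q.

Lemma same_cut_sym E p q : same_cut E p q -> same_cut E q p.
Proof. intros H e He. destruct (H e He) as (H1 & H2 & H3). tauto. Qed.

Lemma homogeneous E p q : same_cut E p q -> exists g, fixes g E /\ ap g p = q.
Proof.
  assert (G : forall p q, (p < q)%R -> same_cut E p q -> exists g, fixes g E /\ ap g p = q).
  { clear p q. intros p q Hpq H.
    destruct (gap_left E p) as (u & Hu & HE), (gap_right E q) as (v & Hv & HE').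
    assert (p < v)%R by lra. assert (u < q)%R by lra.
    exists {| ap := pw u p q v; ai := pw u q p v;
      ap_ai := fun x => pw_inv u q p v x H1 Hv Hu H0;
      ai_ap := fun x => pw_inv u p q v x Hu H0 H1 Hv;
      ap_mono := fun x y => pw_mono u p q v x y Hu H0 H1 Hv |}.
    split; cbn.
    - intros e He. cbn. destruct (H e He) as (C & N1 & N2).
      destruct (pw_cases u p q v e) as [A|[A|[A|A]]]; auto; try tauto.
      + destruct (Rtotal_order e p) as [F|[F|F]]; [|tauto|lra].
        specialize (HE e He F). lra.
      + destruct (Rtotal_order e q) as [F|[F|F]]; [|tauto|].
        * apply C in F. lra.
        * specialize (HE' e He F). assert (e = v) as -> by lra.
          destruct A as (_ & _ & A).
          assert (v - pw u p q v v = 0)%R; [|lra].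
          apply Rmult_eq_reg_r with (v - p)%R; lra.
    - destruct (pw_cases u p q v p) as [A|[A|[A|A]]]; auto; try lra.
      destruct A as (_ & _ & A).
      assert (pw u p q v p - u = q - u)%R; [|lra]. apply Rmult_eq_reg_r with (p - u)%R; lra. }
  intros H. destruct (Rtotal_order p q) as [Hpq|[->|Hpq]]; auto.
  - exists aut_id. split; [intros e _|]; reflexivity.
  - destruct (G q p) as (g & Hg & Hgp); auto using same_cut_sym.
    exists (aut_inv g). split; cbn.
    + intros e He. rewrite <- (Hg e He) at 1. apply ai_ap.
    + rewrite <- Hgp. apply ai_ap.
Qed.

Lemma fixes_comp g h E : fixes g E -> fixes h E -> fixes (aut_comp g h) E.
Proof. intros Hg Hh e He. cbn. now rewrite Hh, Hg. Qed.
Lemma fixes_inv g E : fixes g E -> fixes (aut_inv g) E.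
Proof. intros Hg e He. cbn. rewrite <- (Hg e He) at 1. apply ai_ap. Qed.
Lemma fixes_incl g E F : incl E F -> fixes g F -> fixes g E.
Proof. intros H Hg e He. auto. Qed.
Lemma fixes_app g E F : fixes g (E ++ F) <-> fixes g E /\ fixes g F.
Proof.
  unfold fixes. split.
  - intros H. split; intros e He; apply H, in_or_app; auto.
  - intros (H1 & H2) e [He|He]%in_app_or; auto.
Qed.

(** * Sets with atoms *)

(* Aczel's sets as trees, over the reals as atoms. *)
Inductive V : Type :=
| atom : R -> V
| node : forall A : Type, (A -> V) -> V.

Fixpoint Eq (x y : V) : Prop :=
  match x, y with
  | atom r, atom s => r = s
  | node A f, node B h =>
      (forall a, exists b, Eq (f a) (h b)) /\ (forall b, exists a, Eq (f a) (h b))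
  | _, _ => False
  end.

Lemma Eq_refl x : Eq x x.
Proof. induction x; cbn; eauto. Qed.
Lemma Eq_sym x : forall y, Eq x y -> Eq y x.
Proof.
  induction x as [r|A f IH]; intros [s|B h]; cbn; auto.
  intros (H1 & H2). split.
  - intros b. destruct (H2 b) as (a & Ha). eauto.
  - intros a. destruct (H1 a) as (b & Hb). eauto.
Qed.
Lemma Eq_trans x : forall y z, Eq x y -> Eq y z -> Eq x z.
Proof.
  induction x as [r|A f IH]; intros [s|B h] [t|C k]; cbn; try tauto; try congruence.
  intros (H1 & H2) (H3 & H4). split.
  - intros a. destruct (H1 a) as (b & Hb), (H3 b) as (c & Hc). eauto.
  - intros c. destruct (H4 c) as (b & Hb), (H2 b) as (a & Ha). eauto.
Qed.

Definition Mem (x y : V) : Prop :=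
  match y with atom _ => False | node B h => exists b, Eq x (h b) end.

Lemma Mem_Eq x x' y y' : Eq x x' -> Eq y y' -> Mem x y -> Mem x' y'.
Proof.
  destruct y as [r|A f], y' as [s|B h]; cbn; try tauto.
  intros Hx (H1 & _) (a & Ha). destruct (H1 a) as (b & Hb). exists b.
  eauto using Eq_sym, Eq_trans.
Qed.

Fixpoint act (g : aut) (x : V) : V :=
  match x with atom r => atom (g r) | node A f => node A (fun a => act g (f a)) end.

Lemma act_Eq g x : forall y, Eq x y -> Eq (act g x) (act g y).
Proof.
  induction x as [r|A f IH]; intros [s|B h]; cbn; try tauto; [congruence|].
  intros (H1 & H2). split.
  - intros a. destruct (H1 a) as (b & Hb). eauto.
  - intros b. destruct (H2 b) as (a & Ha). eauto.
Qed.
Lemma act_comp g h x : act (aut_comp g h) x = act g (act h x).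
Proof.
  induction x as [r|A f IH]; cbn; auto. f_equal. now apply functional_extensionality.
Qed.
Lemma act_invl g x : act (aut_inv g) (act g x) = x.
Proof.
  induction x as [r|A f IH]; cbn; [now rewrite ai_ap|].
  f_equal. now apply functional_extensionality.
Qed.
Lemma act_invr g x : act g (act (aut_inv g) x) = x.
Proof.
  induction x as [r|A f IH]; cbn; [now rewrite ap_ai|].
  f_equal. now apply functional_extensionality.
Qed.
Lemma act_Mem g x y : Mem x y -> Mem (act g x) (act g y).
Proof.
  destruct y as [r|A f]; cbn; auto. intros (a & Ha). exists a. now apply act_Eq.
Qed.

Definition supports (E : list R) (x : V) : Prop := forall g, fixes g E -> Eq (act g x) x.

Fixpoint hereditarily_symmetric (x : V) : Prop :=
  match x with
  | atom _ => True
  | node A f => (exists E, supports E (node A f)) /\ forall a, hereditarily_symmetric (f a)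
  end.

Lemma hs_supports x : hereditarily_symmetric x -> exists E, supports E x.
Proof.
  destruct x as [r|A f]; [|intros (H & _); exact H].
  intros _. exists [r]. intros g Hg. cbn. apply Hg. now left.
Qed.

Lemma hs_act g x : hereditarily_symmetric x -> hereditarily_symmetric (act g x).
Proof.
  induction x as [r|A f IH]; cbn; auto. intros ((E & HE) & Hf). split; auto.
  exists (map g E). intros h Hh.
  change (Eq (act h (act g (node A f))) (act g (node A f))).
  rewrite <- (act_invr g (act h _)). apply act_Eq. rewrite <- !act_comp.
  apply HE. intros e He. cbn. rewrite (Hh (g e)); [apply ai_ap|now apply in_map].
Qed.

(** * The permutation model *)

Definition hsV : Type := {x : V | hereditarily_symmetric x}.
Definition hsEq (x y : hsV) : Prop := Eq (proj1_sig x) (proj1_sig y).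
Definition HS : Type := quot hsEq.
Definition mk (x : V) (H : hereditarily_symmetric x) : HS := cls hsEq (exist _ x H).
Definition rep (X : HS) : V :=
  proj1_sig (proj1_sig (constructive_indefinite_description _ (cls_surj hsEq X))).

Lemma hs_rep X : hereditarily_symmetric (rep X).
Proof. unfold rep. apply proj2_sig. Qed.

Lemma mk_eq x y Hx Hy : mk x Hx = mk y Hy <-> Eq x y.
Proof.
  apply (cls_eq hsEq); unfold hsEq; intros; eauto using Eq_refl, Eq_sym, Eq_trans.
Qed.

Lemma mk_rep X H : mk (rep X) H = X.
Proof.
  unfold rep in *. destruct constructive_indefinite_description as ((x & Hx) & <-). cbn in *.
  apply mk_eq, Eq_refl.
Qed.

Lemma rep_mk x H : Eq (rep (mk x H)) x.
Proof. apply (mk_eq _ _ (hs_rep _) H). apply mk_rep. Qed.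

Lemma rep_inj X Y : Eq (rep X) (rep Y) -> X = Y.
Proof. intros H. rewrite <- (mk_rep X (hs_rep X)), <- (mk_rep Y (hs_rep Y)). now apply mk_eq. Qed.

Definition memN (X Y : HS) : Prop := Mem (rep X) (rep Y).
Definition atN (r : R) : HS := mk (atom r) Logic.I.
Definition actN (g : aut) (X : HS) : HS := mk (act g (rep X)) (hs_act g _ (hs_rep X)).

Lemma rep_actN g X : Eq (rep (actN g X)) (act g (rep X)).
Proof. apply rep_mk. Qed.

Lemma actN_comp g h X : actN (aut_comp g h) X = actN g (actN h X).
Proof.
  apply rep_inj. eapply Eq_trans; [apply rep_actN|]. rewrite act_comp.
  apply Eq_sym. eapply Eq_trans; [apply rep_actN|]. apply act_Eq, rep_actN.
Qed.
Lemma actN_invl g X : actN (aut_inv g) (actN g X) = X.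
Proof.
  apply rep_inj. eapply Eq_trans; [apply rep_actN|].
  eapply Eq_trans; [apply act_Eq, rep_actN|]. rewrite act_invl. apply Eq_refl.
Qed.
Lemma actN_invr g X : actN g (actN (aut_inv g) X) = X.
Proof.
  apply rep_inj. eapply Eq_trans; [apply rep_actN|].
  eapply Eq_trans; [apply act_Eq, rep_actN|]. rewrite act_invr. apply Eq_refl.
Qed.
Lemma actN_inj g X Y : actN g X = actN g Y -> X = Y.
Proof. intros H. rewrite <- (actN_invl g X), H. apply actN_invl. Qed.
Lemma actN_mem g X Y : memN X Y -> memN (actN g X) (actN g Y).
Proof.
  intros H. eapply Mem_Eq; [apply Eq_sym, rep_actN|apply Eq_sym, rep_actN|].
  now apply act_Mem.
Qed.
Lemma mem_actN g X Y : memN X (actN g Y) <-> memN (actN (aut_inv g) X) Y.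
Proof.
  split; intros H.
  - apply (actN_mem (aut_inv g)) in H. now rewrite actN_invl in H.
  - apply (actN_mem g) in H. now rewrite actN_invr in H.
Qed.
Lemma actN_at g r : actN g (atN r) = atN (g r).
Proof.
  apply rep_inj. eapply Eq_trans; [apply rep_actN|].
  eapply Eq_trans; [apply act_Eq, rep_mk|]. apply Eq_sym, rep_mk.
Qed.
Lemma atN_inj r s : atN r = atN s -> r = s.
Proof. intros H%mk_eq. exact H. Qed.
Lemma mem_at X r : ~ memN X (atN r).
Proof.
  intros H. exact (Mem_Eq _ _ _ _ (Eq_refl _) (rep_mk (atom r) Logic.I) H).
Qed.

Definition suppN (E : list R) (X : HS) : Prop := forall g, fixes g E -> actN g X = X.

Lemma suppN_ex X : exists E, suppN E X.
Proof.
  destruct (hs_supports _ (hs_rep X)) as (E & HE). exists E. intros g Hg.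
  apply rep_inj. eapply Eq_trans; [apply rep_actN|]. auto.
Qed.

Definition setN (X : HS) : Prop := forall r, X <> atN r.

Lemma setN_node X : setN X -> exists A f, rep X = node A f.
Proof.
  intros H. destruct (rep X) as [r|A f] eqn:E; [|eauto].
  destruct (H r). apply rep_inj. rewrite E. apply Eq_sym, rep_mk.
Qed.

Lemma N_ext X Y : setN X -> setN Y -> (forall Z, memN Z X <-> memN Z Y) -> X = Y.
Proof.
  intros HX HY H. apply rep_inj.
  destruct (setN_node X HX) as (A & f & EX), (setN_node Y HY) as (B & h & EY).
  assert (Hf : forall a, hereditarily_symmetric (f a))
    by (assert (S := hs_rep X); rewrite EX in S; apply S).
  assert (Hh : forall b, hereditarily_symmetric (h b))
    by (assert (S := hs_rep Y); rewrite EY in S; apply S).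
  rewrite EX, EY. split.
  - intros a. assert (M : memN (mk (f a) (Hf a)) X).
    { unfold memN. rewrite EX. exists a. apply rep_mk. }
    apply H in M. unfold memN in M. rewrite EY in M. destruct M as (b & Hb).
    exists b. eapply Eq_trans; [apply Eq_sym, rep_mk|exact Hb].
  - intros b. assert (M : memN (mk (h b) (Hh b)) Y).
    { unfold memN. rewrite EY. exists b. apply rep_mk. }
    apply H in M. unfold memN in M. rewrite EX in M. destruct M as (a & Ha).
    exists a. eapply Eq_trans; [apply Eq_sym, Ha|apply rep_mk].
Qed.

Lemma N_ind (P : HS -> Prop) : (forall X, (forall Y, memN Y X -> P Y) -> P X) -> forall X, P X.
Proof.
  intros H.
  assert (G : forall x X, Eq (rep X) x -> P X).
  { induction x as [r|A f IH]; intros X E; apply H; intros Y HY;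
      apply (Mem_Eq _ _ _ _ (Eq_refl _) E) in HY.
    - destruct HY.
    - destruct HY as (a & Ha). now apply (IH a). }
  intros X. exact (G (rep X) X (Eq_refl _)).
Qed.

Definition small (P : HS -> Prop) : Prop :=
  exists (A : Type) (f : A -> HS), forall Y, P Y -> exists a, Y = f a.

Lemma small_mem X : small (fun Y => memN Y X).
Proof.
  destruct (rep X) as [r|A f] eqn:E.
  - exists Empty_set, (fun a : Empty_set => match a with end). unfold memN. rewrite E. intros Y [].
  - assert (Hf : forall a, hereditarily_symmetric (f a))
      by (assert (S := hs_rep X); rewrite E in S; apply S).
    exists A, (fun a => mk (f a) (Hf a)). unfold memN. rewrite E. intros Y (a & Ha).
    exists a. apply rep_inj. eapply Eq_trans; [exact Ha|]. apply Eq_sym, rep_mk.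
Qed.

Lemma small_sub (P Q : HS -> Prop) : (forall Y, P Y -> Q Y) -> small Q -> small P.
Proof. intros H (A & f & Hf). exists A, f. auto. Qed.

Lemma small_image (Q : HS -> Prop) (F : HS -> HS -> Prop) :
  (forall x y y', F x y -> F x y' -> y = y') -> small Q ->
  small (fun Y => exists x, Q x /\ F x Y).
Proof.
  intros HF (A & f & Hf).
  exists A, (fun a => epsilon (inhabits (atN 0)) (fun Y => F (f a) Y)).
  intros Y (x & Hx & HY). destruct (Hf x Hx) as (a & ->). exists a.
  apply (HF (f a)); auto. apply epsilon_spec. eauto.
Qed.

Lemma N_comprehension (P : HS -> Prop) (E : list R) : small P ->
  (forall g, fixes g E -> forall Y, P Y -> P (actN g Y)) ->
  exists X, setN X /\ forall Y, memN Y X <-> P Y.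
Proof.
  intros (A & f & Hf) HE.
  set (x := node {a : A | P (f a)} (fun a => rep (f (proj1_sig a)))).
  assert (S : supports E x).
  { intros g Hg. cbn. split.
    - intros (a & Ha). cbn. destruct (Hf _ (HE g Hg _ Ha)) as (a' & Ha').
      assert (Pa' : P (f a')) by (rewrite <- Ha'; auto).
      exists (exist _ a' Pa'). cbn. rewrite <- Ha'. apply Eq_sym, rep_actN.
    - intros (a & Ha). cbn. destruct (Hf _ (HE _ (fixes_inv g E Hg) _ Ha)) as (a' & Ha').
      assert (Pa' : P (f a')) by (rewrite <- Ha'; apply HE; auto using fixes_inv).
      exists (exist _ a' Pa'). cbn. rewrite <- Ha'.
      eapply Eq_trans; [apply act_Eq, rep_actN|]. rewrite act_invr. apply Eq_refl. }
  assert (H : hereditarily_symmetric x).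
  { split; [now exists E|]. intros a. apply hs_rep. }
  exists (mk x H). split.
  - intros r Hr. apply mk_eq in Hr. exact Hr.
  - intros Y. unfold memN. split.
    + intros M. apply (Mem_Eq _ _ _ _ (Eq_refl _) (rep_mk x H)) in M.
      destruct M as ((a & Ha) & Hb). cbn in Hb. apply rep_inj in Hb as ->. exact Ha.
    + intros HY. apply (Mem_Eq _ _ _ _ (Eq_refl _) (Eq_sym _ _ (rep_mk x H))).
      destruct (Hf Y HY) as (a & ->). exists (exist _ a HY). apply Eq_refl.
Qed.

Lemma emptyN_ex : exists X, setN X /\ forall Y, memN Y X <-> False.
Proof.
  apply (N_comprehension _ []); [|auto].
  exists Empty_set, (fun a : Empty_set => match a with end). intros Y [].
Qed.
Definition emptyN : HS := proj1_sig (constructive_indefinite_description _ emptyN_ex).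
Lemma setN_empty : setN emptyN.
Proof. unfold emptyN. destruct constructive_indefinite_description as (X & H & H1); auto. Qed.
Lemma mem_empty Y : ~ memN Y emptyN.
Proof.
  unfold emptyN. destruct constructive_indefinite_description as (X & H1 & H).
  cbn. rewrite H. tauto.
Qed.

Lemma atomsN_ex : exists X, setN X /\ forall Y, memN Y X <-> exists r, Y = atN r.
Proof.
  apply (N_comprehension _ []).
  - exists R, atN. auto.
  - intros g _ Y (r & ->). exists (g r). apply actN_at.
Qed.
Definition atomsN : HS := proj1_sig (constructive_indefinite_description _ atomsN_ex).
Lemma setN_atoms : setN atomsN.
Proof. unfold atomsN. destruct constructive_indefinite_description as (X & H & H1); auto. Qed.
Lemma mem_atoms Y : memN Y atomsN <-> exists r, Y = atN r.
Proof. unfold atomsN. destruct constructive_indefinite_description as (X & H1 & H). apply H. Qed.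

Lemma setN_act g X : setN X -> setN (actN g X).
Proof.
  intros H r E. apply (H (ai g r)). rewrite <- (actN_invl g X), E. apply (actN_at (aut_inv g)).
Qed.

Lemma actN_empty g : actN g emptyN = emptyN.
Proof.
  apply N_ext; auto using setN_act, setN_empty. intros Z. rewrite mem_actN.
  split; intros H; now apply mem_empty in H.
Qed.

Lemma actN_atoms g : actN g atomsN = atomsN.
Proof.
  apply N_ext; auto using setN_act, setN_atoms. intros Z. rewrite mem_actN, !mem_atoms. split.
  - intros (r & E). exists (g r). rewrite <- (actN_invr g Z), E. apply actN_at.
  - intros (r & ->). exists (ai g r). apply (actN_at (aut_inv g)).
Qed.

Definition NI : interp LZFA :=
  Build_interp LZFA HS memN
    (fun c : zfa_const => match c with c_empty => emptyN | c_atoms => atomsN end).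

Lemma IsSet_setN (X : NI) : IsSet X <-> setN X.
Proof.
  cbn. rewrite mem_atoms. split.
  - intros H r ->. eauto.
  - intros H (r & ->). now apply (H r).
Qed.

Lemma val_actN g (v : nat -> NI) t : val NI (fun n => actN g (v n)) t = actN g (val NI v t).
Proof.
  destruct t as [n|[]]; cbn; auto; symmetry; [apply actN_empty|apply actN_atoms].
Qed.

Lemma sat_actN g p : forall v : nat -> NI,
  sat NI v p <-> sat NI (fun n => actN g (v n)) p.
Proof.
  induction p; intros v; cbn [sat]; rewrite ?val_actN.
  - tauto.
  - split; [congruence|apply actN_inj].
  - cbn. split; [apply actN_mem|]. intros H. apply mem_actN in H. now rewrite actN_invl in H.
  - rewrite (IHp1 v), (IHp2 v). tauto.
  - assert (E : forall m, sat NI (m .: v) p <-> sat NI (actN g m .: (fun n => actN g (v n))) p).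
    { intros m. rewrite (IHp (m .: v)).
      replace (fun n => actN g ((m .: v) n)) with (actN g m .: (fun n => actN g (v n)));
        [tauto|]. apply functional_extensionality. now intros [|n]. }
    split; intros H m.
    + rewrite <- (actN_invr g m). apply E, H.
    + apply E, H.
Qed.

Lemma suppN_env (v : nat -> NI) n :
  exists E, forall g, fixes g E -> forall i, i < n -> actN g (v i) = v i.
Proof.
  induction n as [|n (E & HE)].
  - exists []. lia.
  - destruct (suppN_ex (v n)) as (F & HF). exists (E ++ F).
    intros g (H1 & H2)%fixes_app i Hi. destruct (Nat.eq_dec i n) as [->|]; auto.
    apply HE; auto. lia.
Qed.

(* The first [k] variables are arguments, the others are parameters of the formula. *)
Lemma sat_support p (v : nat -> NI) : exists E, forall g, fixes g E -> forall k w,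
  (forall i, w (k + i) = v i) ->
  sat NI w p -> sat NI (fun i => if i <? k then actN g (w i) else w i) p.
Proof.
  destruct (suppN_env v (bound p)) as (E & HE). exists E. intros g Hg k w Hw H.
  apply (sat_actN g) in H.
  eapply (sat_below NI p (bound p)); [|apply free_below_bound|exact H].
  intros n Hn. cbn beta. destruct (Nat.ltb_spec n k) as [Hk|Hk]; auto.
  replace n with (k + (n - k)) by lia. rewrite Hw. symmetry. apply HE; auto. lia.
Qed.

Lemma actN_inv_fix g X : actN g X = X -> actN (aut_inv g) X = X.
Proof. intros H. rewrite <- H at 1. apply actN_invl. Qed.

Lemma N_subset X (P : HS -> Prop) E :
  (forall g, fixes g E -> forall Y, P Y -> P (actN g Y)) ->
  exists Z, setN Z /\ forall Y, memN Y Z <-> memN Y X /\ P Y.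
Proof.
  intros HP. destruct (suppN_ex X) as (F & HF).
  apply (N_comprehension _ (E ++ F)).
  - apply (small_sub _ (fun Y => memN Y X)); [tauto|]. apply small_mem.
  - intros g (H1 & H2)%fixes_app Y (HY & HPY). split; auto.
    rewrite <- (HF g H2). now apply actN_mem.
Qed.

Lemma N_pairing (a b : HS) : exists c, setN c /\ forall z, memN z c <-> z = a \/ z = b.
Proof.
  destruct (suppN_ex a) as (E & HE), (suppN_ex b) as (F & HF).
  apply (N_comprehension _ (E ++ F)).
  - exists bool, (fun i : bool => if i then a else b).
    intros Y [->| ->]; [now exists true|now exists false].
  - intros g (H1 & H2)%fixes_app Y [->| ->]; [left|right]; auto.
Qed.

Lemma small_union (Q : HS -> Prop) : small Q -> small (fun z => exists y, Q y /\ memN z y).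
Proof.
  intros (A & f & Hf).
  set (idx := fun y => proj1_sig (constructive_indefinite_description _ (small_mem y))).
  assert (G : forall y, exists h : idx y -> HS, forall z, memN z y -> exists b, z = h b).
  { intros y. unfold idx. destruct (constructive_indefinite_description _ (small_mem y))
      as (B & h & Hh). cbn. eauto. }
  exists {a : A & idx (f a)}, (fun p =>
    proj1_sig (constructive_indefinite_description _ (G (f (projT1 p)))) (projT2 p)).
  intros z (y & Hy & Hz). destruct (Hf y Hy) as (a & ->).
  destruct (constructive_indefinite_description _ (G (f a))) as (h & Hh) eqn:E.
  destruct (Hh z Hz) as (b & ->). exists (existT _ a b). cbn. now rewrite E.
Qed.

Lemma N_union x : exists u, setN u /\ forall z, memN z u <-> exists y, memN y x /\ memN z y.
Proof.
  destruct (suppN_ex x) as (E & HE).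
  apply (N_comprehension _ E).
  - apply small_union, small_mem.
  - intros g Hg z (y & Hy & Hz). exists (actN g y). split; [|now apply actN_mem].
    rewrite <- (HE g Hg). now apply actN_mem.
Qed.

Lemma N_power x : exists p, setN p /\
  forall z, memN z p <-> setN z /\ forall y, memN y z -> memN y x.
Proof.
  destruct (suppN_ex x) as (E & HE).
  apply (N_comprehension _ E).
  - destruct (small_mem x) as (A & f & Hf).
    exists (A -> Prop), (fun S => epsilon (inhabits emptyN)
      (fun z => setN z /\ forall y, memN y z <-> exists a, S a /\ y = f a)).
    intros z (Hz & Hzx). exists (fun a => memN (f a) z).
    assert (G : exists z', setN z' /\
      forall y, memN y z' <-> exists a, memN (f a) z /\ y = f a).
    { exists z. split; auto. intros y. split.
      - intros Hy. destruct (Hf y (Hzx y Hy)) as (a & ->). eauto.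
      - now intros (a & Ha & ->). }
    apply (epsilon_spec (inhabits emptyN)) in G. destruct G as (G1 & G2).
    apply N_ext; auto. intros y. rewrite G2. split.
    + intros Hy. destruct (Hf y (Hzx y Hy)) as (a & ->). eauto.
    + now intros (a & Ha & ->).
  - intros g Hg z (Hz & Hzx). split; [now apply setN_act|].
    intros y Hy. apply mem_actN in Hy. apply Hzx in Hy.
    apply (actN_mem g) in Hy. now rewrite actN_invr, HE in Hy.
Qed.

Lemma succN_ex x : exists s, setN s /\ forall z, memN z s <-> memN z x \/ z = x.
Proof.
  destruct (N_pairing x x) as (p & _ & Hp), (N_pairing x p) as (q & _ & Hq).
  destruct (N_union q) as (u & Hu & H). exists u. split; auto.
  intros z. rewrite H. split.
  - intros (y & [->| ->]%Hq & Hz); auto. apply Hp in Hz. tauto.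
  - intros [Hz| ->]; [exists x|exists p]; rewrite Hq, ?Hp; auto.
Qed.

Fixpoint numN (n : nat) : HS :=
  match n with
  | 0 => emptyN
  | S k => proj1_sig (constructive_indefinite_description _ (succN_ex (numN k)))
  end.
Lemma mem_numN_S n z : memN z (numN (S n)) <-> memN z (numN n) \/ z = numN n.
Proof. cbn. destruct constructive_indefinite_description as (s & H1 & H). apply H. Qed.
Lemma setN_numN n : setN (numN n).
Proof.
  destruct n; [apply setN_empty|]. cbn.
  destruct constructive_indefinite_description as (s & H & H1). apply H.
Qed.
Lemma actN_numN g n : actN g (numN n) = numN n.
Proof.
  induction n as [|n IH]; [apply actN_empty|].
  apply N_ext; auto using setN_act, setN_numN. intros z.
  rewrite mem_actN, !mem_numN_S, <- mem_actN, IH. split; (intros [H|H]; [auto|right]).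
  - rewrite <- (actN_invr g z), H. exact IH.
  - rewrite H. now apply actN_inv_fix.
Qed.

Lemma N_infinity : exists w, setN w /\ forall z, memN z w <-> exists n, z = numN n.
Proof.
  apply (N_comprehension _ []).
  - exists nat, numN. auto.
  - intros g _ z (n & ->). exists n. apply actN_numN.
Qed.

Lemma NI_zf_axiom : models NI zf_axiom.
Proof.
  intros q [| | | | | |n p Hp|n p Hp] v.
  - apply sat_extensionality. intros x y (Hx%IsSet_setN & Hy%IsSet_setN). now apply N_ext.
  - apply sat_pairing. intros a b. destruct (N_pairing a b) as (c & _ & H). eauto.
  - apply sat_union. intros x. destruct (N_union x) as (u & _ & H). eauto.
  - apply sat_power_set. intros x. destruct (N_power x) as (p & _ & H). exists p.
    intros z. rewrite (H z). unfold Subset. now rewrite IsSet_setN.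
  - apply sat_infinity. destruct N_infinity as (w & _ & H). exists w. split.
    + exists (numN 0). split; [|apply H; eauto]. split.
      * apply IsSet_setN, setN_empty.
      * apply mem_empty.
    + intros n (k & ->)%H. exists (numN (S k)). split; [|apply H; eauto].
      intros z. apply mem_numN_S.
  - apply sat_regularity. intros x Hx. apply NNPP. intros C.
    assert (G : forall y : HS, ~ memN y x).
    { apply (N_ind (fun y => ~ memN y x)). intros y IH Hy. apply C. exists y. split; auto.
      intros z (Hzx & Hzy). exact (IH z Hzy Hzx). }
    destruct Hx as (y & Hy). exact (G y Hy).
  - apply sat_forall_closure. clear v. intros v. apply sat_separation. intros x.
    destruct (sat_support p v) as (E & HE).
    destruct (N_subset x (fun z => sat NI ((z : NI) .: v) p) E) as (y & _ & Hy); [|eauto].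
    intros g Hg z Hz. apply (HE g Hg 1) in Hz; [|reflexivity].
    erewrite (sat_below NI p); [exact Hz| |apply free_below_bound]. now intros [|n'] _.
  - apply sat_forall_closure. clear v. intros v. apply sat_replacement. intros HF X.
    destruct (sat_support p v) as (E & HE), (suppN_ex X) as (F & HF').
    destruct (N_comprehension (fun y => exists x, memN x X /\ sat NI ((x : NI) .: y .: v) p)
      (E ++ F)) as (Y & _ & HY); [| |eauto].
    + apply small_image; [|apply small_mem]. intros x y y' H1 H2. eapply HF; eauto.
    + intros g (H1 & H2)%fixes_app y (x & Hx & Hz). exists (actN g x). split.
      * rewrite <- (HF' g H2). now apply actN_mem.
      * apply (HE g H1 2) in Hz; [|reflexivity].
        erewrite (sat_below NI p); [exact Hz| |apply free_below_bound].
        now intros [|[|n']] _.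
Qed.

Lemma NI_ZFA : models NI ZFA.
Proof.
  intros q [r Hr| |] v.
  - now apply NI_zf_axiom.
  - apply sat_empty_set_axiom. apply mem_empty.
  - apply sat_atoms_axiom. cbn. intros z. rewrite mem_atoms. split.
    + intros (r & ->). split.
      * intros H. symmetry in H. now apply setN_empty in H.
      * intros (x & Hx). now apply mem_at in Hx.
    + intros (N1 & N2). apply NNPP. intros C. apply N1. apply N_ext.
      * intros r ->. apply C. eauto.
      * apply setN_empty.
      * intros y. split; intros H; [destruct N2; eauto|now apply mem_empty in H].
Qed.

Instance SetModel_NI : SetModel NI := SetModel_ZFA NI NI_ZFA.

(** * Dedekind-finite sets in the permutation model *)

Lemma mem_act_NI g (x y : NI) : x ∈ y -> (actN g x : NI) ∈ (actN g y : NI).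
Proof. apply actN_mem. Qed.
Lemma mem_actN_NI g (x y : NI) : x ∈ (actN g y : NI) <-> (actN (aut_inv g) x : NI) ∈ y.
Proof. apply mem_actN. Qed.

Lemma actN_upair g (a b : NI) : actN g (upair a b) = upair (actN g a : NI) (actN g b) :> NI.
Proof.
  apply UPair_iff. intros z. split.
  - intros [H|H]%mem_actN_NI%in_upair; [left|right]; rewrite <- H; symmetry; apply actN_invr.
  - intros [->| ->]; apply mem_act_NI, in_upair; auto.
Qed.
Lemma actN_opair g (a b : NI) : actN g (opair a b) = opair (actN g a : NI) (actN g b) :> NI.
Proof. unfold opair, sing. now rewrite !actN_upair. Qed.
Lemma Rel_actN g (r a b : NI) : Rel r a b -> Rel (actN g r : NI) (actN g a : NI) (actN g b : NI).
Proof. rewrite !Rel_iff. intros H. rewrite <- actN_opair. now apply mem_act_NI. Qed.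

Lemma SameColor_actN g (f a b c d : NI) : actN g f = f -> SameColor f a b c d ->
  SameColor f (actN g a : NI) (actN g b : NI) (actN g c : NI) (actN g d : NI).
Proof.
  intros Hf. rewrite !SameColor_iff. intros (k & H1 & H2).
  exists (actN g k). rewrite <- !actN_upair. rewrite <- Hf. split; now apply Rel_actN.
Qed.

Lemma num_numN n : (num n : NI) = numN n.
Proof.
  induction n as [|n IH]; cbn [num].
  - apply ext; [apply Empty_emp|apply IsSet_setN, setN_empty|]. intros z.
    split; intros H; [now apply in_emp in H|now apply mem_empty in H].
  - symmetry. apply Succ_iff. intros z. rewrite IH. apply mem_numN_S.
Qed.

Lemma actN_num g n : actN g (num n : NI) = num n :> NI.
Proof. rewrite num_numN. apply actN_numN. Qed.

Lemma om_num (n : NI) : n ∈ om -> exists k, n = num k.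
Proof.
  destruct N_infinity as (w & _ & Hw). intros Hn.
  assert (H : Inductive_ (w : NI)).
  { apply Inductive_iff. split.
    - apply Hw. exists 0. apply (num_numN 0).
    - intros x (k & ->)%Hw. apply Hw. exists (S k). rewrite <- !num_numN. reflexivity. }
  apply (proj2 Omega_om) in H. destruct H as (_ & H). apply H, Hw in Hn.
  destruct Hn as (k & ->). exists k. symmetry. apply num_numN.
Qed.

Lemma Infinite_moved (Y : NI) : IsSet Y ->
  (forall E, exists y g, fixes g E /\ y ∈ Y /\ (actN g y : NI) ∈ Y /\ actN g y <> y) ->
  Infinite Y.
Proof.
  intros HY H. split; auto. rewrite Finite_iff.
  intros (_ & n & f & Hn & (((HR & HF) & HI) & _)).
  destruct (suppN_ex f) as (E & HE). destruct (H E) as (y & g & Hg & Hy & Hgy & N).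
  destruct (HF y Hy) as (k & Hk & _). assert (Hgk := Rel_actN g _ _ _ Hk).
  rewrite (HE g Hg) in Hgk.
  destruct (Relation_Rel _ _ _ _ _ HR Hk) as (_ & Hkn).
  destruct (om_num k) as (i & ->); [eapply om_mem; eauto|].
  rewrite actN_num in Hgk. apply N. eapply HI; eauto.
Qed.

Lemma move_right E r : exists s, (r < s)%R /\ forall e, In e E -> (r < e)%R -> (s < e)%R.
Proof.
  destruct (gap_right E r) as (v & Hv & H). exists ((r + v) / 2)%R. split; [lra|].
  intros e He Hr. specialize (H e He Hr). lra.
Qed.

Lemma atoms_infinite : Infinite (atomsN : NI).
Proof.
  apply Infinite_moved; [apply IsSet_setN, setN_atoms|].
  intros E. destruct (move_right E 0) as (s & Hs & H).
  set (r := (s / 2)%R).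
  destruct (homogeneous E r s) as (g & Hg & Hgr).
  { intros e He. specialize (H e He).
    destruct (Rle_lt_dec e 0); unfold r; repeat split; try lra; intros; lra. }
  exists (atN r), g. rewrite actN_at, Hgr. repeat split; auto.
  - apply mem_atoms. eauto.
  - apply mem_atoms. eauto.
  - intros E'%atN_inj. unfold r in E'. lra.
Qed.

Lemma atoms_DFinite : DFinite (atomsN : NI).
Proof.
  split; [apply IsSet_setN, setN_atoms|].
  intros (w & f & ->%Omega_iff & (HR & HF) & HI).
  destruct (suppN_ex f) as (E & HE).
  assert (G : forall k, exists r, Rel f (num k) (atN r : NI) /\ In r E).
  { intros k. destruct (HF (num k) (num_om k)) as (y & Hy & U).
    destruct (Relation_Rel _ _ _ _ _ HR Hy) as (_ & (r & ->)%mem_atoms).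
    exists r. split; auto. apply NNPP. intros N.
    destruct (move_right E r) as (s & Hs & H).
    destruct (homogeneous E r s) as (g & Hg & Hgr).
    { intros e He. specialize (H e He). destruct (Rtotal_order e r) as [?|[->|?]].
      - repeat split; intros; lra.
      - contradiction.
      - repeat split; intros; lra. }
    apply (Rel_actN g) in Hy. rewrite (HE g Hg), actN_num, actN_at in Hy.
    apply U, atN_inj in Hy. lra. }
  apply choice in G as (r & Hr).
  assert (I1 : NoDup (map r (seq 0 (S (length E))))).
  { apply NoDup_map_NoDup_ForallPairs; [|apply seq_NoDup].
    intros i j _ _ Hij. apply (num_inj (I := NI)). eapply HI. split; [apply Hr|].
    rewrite Hij. apply Hr. }
  apply (NoDup_incl_length (l' := E)) in I1.
  - rewrite length_map, length_seq in I1. lia.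
  - intros x Hx. apply in_map_iff in Hx as (i & <- & _). apply Hr.
Qed.

Lemma NI_not_DF_eq_F v : ~ sat NI v DF_eq_F.
Proof.
  rewrite sat_DF_eq_F. intros H. apply atoms_infinite, H, atoms_DFinite.
Qed.

(** * Canonical sets in the permutation model *)

(* The pairs (n, x_n) are fixed along with the x_n, so an enumeration chosen outside the
   model belongs to it. *)
Lemma injection_of_fixed (X : NI) E : Infinite X ->
  (forall g, fixes g E -> forall x : NI, x ∈ X -> actN g x = x) ->
  exists j, Injection j (om : NI) X.
Proof.
  intros HX HE.
  assert (G : forall l : list NI, exists x : NI, x ∈ X /\ ~ In x l).
  { intros l. apply NNPP. intros N.
    destruct (Infinite_NoDup X HX (S (length l))) as (k & Hk & HN & HkX).
    apply (NoDup_incl_length (l' := l)) in HN; [lia|].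
    intros z Hz. apply NNPP. intros Hzl. eauto. }
  apply choice in G as (fresh & Hfresh).
  set (lst := fix lst n := match n with 0 => [] | S k => fresh (lst k) :: lst k end).
  set (i := fun n => fresh (lst n)).
  assert (Hi : forall n m, n < m -> In (i n) (lst m)).
  { intros n m. induction 1; cbn; auto. }
  assert (inj : forall n m, i n = i m -> n = m).
  { intros n m Enm. destruct (lt_eq_lt_dec n m) as [[H|H]|H]; auto; exfalso.
    - apply (proj2 (Hfresh (lst m))). fold (i m). rewrite <- Enm. auto.
    - apply (proj2 (Hfresh (lst n))). fold (i n). rewrite Enm. auto. }
  destruct (N_comprehension (fun p : NI => exists n, p = opair (num n : NI) (i n)) E)
    as (j & Hj & Ej).
  - exists nat, (fun n => opair (num n : NI) (i n)). auto.
  - intros g Hg p (n & ->). exists n. rewrite actN_opair, actN_num. f_equal.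
    apply HE; auto. apply Hfresh.
  - assert (ER : forall a b : NI, Rel (j : NI) a b <-> exists n, a = num n /\ b = i n).
    { intros a b. rewrite Rel_iff. cbn. rewrite Ej. split.
      - intros (n & (-> & ->)%opair_inj). eauto.
      - intros (n & -> & ->). eauto. }
    exists j. split; [split; [split|]|].
    + now apply IsSet_setN.
    + intros p Hp. cbn in Hp. apply Ej in Hp. destruct Hp as (n & ->). exists (num n), (i n).
      split; [apply num_om|split; [apply Hfresh|now apply OPair_iff]].
    + intros a Ha. destruct (om_num a Ha) as (n & ->). exists (i n). rewrite ER.
      split; [eauto|]. intros c (m & Em & ->)%ER. apply num_inj in Em as ->. auto.
    + intros a b c ((n & -> & ->)%ER & (m & -> & Em)%ER). now rewrite (inj n m Em).
Qed.

Lemma minimal_support E l (x : HS) : suppN (l ++ E) x -> ~ suppN E x ->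
  exists F a, incl E F /\ suppN (a :: F) x /\ ~ suppN F x.
Proof.
  induction l as [|b l IH]; intros H N; [contradiction|].
  destruct (classic (suppN (l ++ E) x)) as [H'|H']; auto.
  exists (l ++ E), b. split; auto. now apply incl_appr, incl_refl.
Qed.

Section Interval.
Context (E : list R) (a : R) (x : HS).
Hypothesis Hx : suppN (a :: E) x.
Hypothesis HxE : ~ suppN E x.

Lemma a_notin : ~ In a E.
Proof.
  intros Ha. apply HxE. intros g Hg. apply Hx. intros e [<-|He]; auto.
Qed.

(* The interval of [a] in the complement of [E]. *)
Definition J (c : R) : Prop := same_cut E a c.

Lemma J_a : J a.
Proof. intros e He. split; [tauto|]. split; intros ->; now apply a_notin. Qed.

Lemma J_cut c d : J c -> J d -> same_cut E c d.
Proof.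
  intros Hc Hd e He. destruct (Hc e He) as (H1 & _ & H2), (Hd e He) as (H3 & _ & H4).
  split; [tauto|auto].
Qed.

Lemma J_between c d b : J c -> J d -> (c <= b <= d)%R -> J b.
Proof.
  intros Hc Hd Hb e He. destruct (Hc e He) as (H1 & H2 & H3), (Hd e He) as (H4 & _ & H5).
  destruct (Rtotal_order e a) as [H|[H|H]]; [|contradiction|].
  - apply H1 in H as H6. split; [split; intros; lra|split; lra].
  - assert (~ (e < d)%R) by (intros H6%H4; lra).
    split; [split; intros; lra|split; lra].
Qed.

Lemma J_right c : J c -> exists d, J d /\ (c < d)%R.
Proof.
  intros Hc. destruct (move_right E c) as (s & Hs & H). exists s. split; auto.
  intros e He. destruct (Hc e He) as (H1 & H2 & H3). specialize (H e He).
  destruct (Rtotal_order e c) as [F|[F|F]]; [|contradiction|].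
  - split; [split; intros; [lra|tauto]|split; auto; lra].
  - assert (~ (e < a)%R) by (intros H4%H1; lra).
    split; [split; intros; lra|split; auto; lra].
Qed.

Lemma J_act g c : fixes g E -> J c -> J (g c).
Proof.
  intros Hg Hc e He. destruct (Hc e He) as (H1 & H2 & H3).
  assert (H4 := ap_lt g e c). rewrite (Hg e He) in H4.
  split; [tauto|]. split; auto. intros H5. apply H3. apply (ap_inj g). now rewrite (Hg e He).
Qed.

Lemma J_move F c d : J c -> J d ->
  (forall e, In e F -> ((e < c)%R /\ (e < d)%R) \/ ((c < e)%R /\ (d < e)%R)) ->
  exists g, fixes g (E ++ F) /\ ap g c = d.
Proof.
  intros Hc Hd HF. apply homogeneous. intros e [He|He]%in_app_or.
  - exact (J_cut c d Hc Hd e He).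
  - destruct (HF e He) as [(H1 & H2)|(H1 & H2)]; repeat split; intros; lra.
Qed.

(* Otherwise both a and g a support x over E, hence E does. *)
Lemma stabilizer g : fixes g E -> actN g x = x -> ap g a = a.
Proof.
  intros Hg Hgx. apply NNPP. intros N. set (b := ap g a) in *.
  assert (Jb : J b) by (apply J_act; auto using J_a).
  assert (Hb : suppN (b :: E) x).
  { intros h Hh. apply (actN_inj (aut_inv g)). rewrite <- Hgx at 1.
    rewrite <- !actN_comp. rewrite (actN_inv_fix g x Hgx). apply Hx.
    intros e [<-|He]; cbn.
    - fold b. rewrite (Hh b (or_introl eq_refl)). unfold b. apply ai_ap.
    - rewrite (Hg e He), (Hh e (or_intror He)). rewrite <- (Hg e He) at 1. apply ai_ap. }
  apply HxE. intros s Hs.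
  assert (Js : J (s a)) by (apply J_act; auto using J_a).
  assert (two : exists t1 t2, fixes t1 (b :: E) /\ fixes t2 (a :: E) /\ ap t2 (ap t1 a) = ap s a).
  { assert (id : fixes aut_id (a :: E)) by (intros e _; reflexivity).
    assert (toE : forall t c, fixes t (E ++ [c]) -> fixes t (c :: E)).
    { intros t c Ht. eapply fixes_incl; [|exact Ht]. intros e [<-|He]; apply in_or_app; cbn; auto. }
    assert (Jm : J ((a + b) / 2)).
    { destruct (Rtotal_order a b) as [H|[H|H]]; [|congruence|];
        [apply (J_between a b)|apply (J_between b a)]; auto using J_a; lra. }
    destruct (Rtotal_order a b) as [H|[H|H]]; [|congruence|].
    - destruct (Rlt_le_dec (s a) b) as [Hc|Hc].
      + destruct (J_move [b] a (s a)) as (t & Ht & Hta); auto using J_a.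
        { intros e [<-|[]]. auto. }
        exists t, aut_id. repeat split; auto.
      + destruct (J_move [b] a ((a + b) / 2)) as (t & Ht & Hta); auto using J_a.
        { intros e [<-|[]]. right. lra. }
        destruct (J_move [a] ((a + b) / 2) (s a)) as (t' & Ht' & Hta'); auto.
        { intros e [<-|[]]. left. lra. }
        exists t, t'. rewrite Hta. repeat split; auto.
    - destruct (Rlt_le_dec b (s a)) as [Hc|Hc].
      + destruct (J_move [b] a (s a)) as (t & Ht & Hta); auto using J_a.
        { intros e [<-|[]]. auto. }
        exists t, aut_id. repeat split; auto.
      + destruct (J_move [b] a ((a + b) / 2)) as (t & Ht & Hta); auto using J_a.
        { intros e [<-|[]]. left. lra. }
        destruct (J_move [a] ((a + b) / 2) (s a)) as (t' & Ht' & Hta'); auto.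
        { intros e [<-|[]]. right. lra. }
        exists t, t'. rewrite Hta. repeat split; auto. }
  destruct two as (t1 & t2 & Ht1 & Ht2 & Hts).
  set (t := aut_comp t2 t1).
  assert (HtE : fixes t E).
  { apply fixes_comp; (eapply fixes_incl; [|eassumption]); intros e He; now right. }
  assert (Htx : actN t x = x).
  { unfold t. rewrite actN_comp, (Hb t1 Ht1). apply Hx, Ht2. }
  transitivity (actN t x); auto. rewrite <- (actN_invr t (actN s x)). f_equal. rewrite <- actN_comp.
  apply Hx. intros e [<-|He]; cbn.
  - rewrite <- Hts. now rewrite !ai_ap.
  - rewrite (Hs e He). exact (fixes_inv t E HtE e He).
Qed.

Definition moved (c : R) (y : HS) : Prop := exists g, fixes g E /\ ap g a = c /\ actN g x = y.

Lemma moved_ex c : J c -> exists y, moved c y.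
Proof.
  intros Hc. destruct (J_move [] a c) as (g & Hg & Hga); auto using J_a; [intros e []|].
  rewrite app_nil_r in Hg. exists (actN g x), g. auto.
Qed.
Lemma moved_J c y : moved c y -> J c.
Proof. intros (g & Hg & <- & _). apply J_act; auto using J_a. Qed.
Lemma moved_fun c y y' : moved c y -> moved c y' -> y = y'.
Proof.
  intros (g & Hg & Hga & <-) (h & Hh & Hha & <-).
  rewrite <- (actN_invr h (actN g x)). f_equal. rewrite <- actN_comp.
  apply Hx. intros e [<-|He]; cbn.
  - rewrite Hga, <- Hha. apply ai_ap.
  - rewrite (Hg e He). exact (fixes_inv h E Hh e He).
Qed.
Lemma moved_inj c c' y : moved c y -> moved c' y -> c = c'.
Proof.
  intros (g & Hg & <- & Hgx) (h & Hh & <- & Hhx).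
  assert (S : ap (aut_comp (aut_inv g) h) a = a).
  { apply stabilizer.
    - apply fixes_comp; auto using fixes_inv.
    - rewrite actN_comp, Hhx, <- Hgx. apply actN_invl. }
  cbn in S. rewrite <- (ap_ai g (h a)). now rewrite S.
Qed.
Lemma moved_act g c y : fixes g E -> moved c y -> moved (g c) (actN g y).
Proof.
  intros Hg (h & Hh & <- & <-). exists (aut_comp g h).
  split; [now apply fixes_comp|split; [reflexivity|apply actN_comp]].
Qed.

(* The points are moved one at a time. *)
Lemma quadruples (Q : R -> R -> R -> R -> Prop) :
  (forall g, fixes g E -> forall c1 c2 c3 c4, J c1 -> J c2 -> J c3 -> J c4 ->
     Q c1 c2 c3 c4 -> Q (g c1) (g c2) (g c3) (g c4)) ->
  forall c1 c2 c3 c4 d1 d2 d3 d4,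
    J c1 -> J c2 -> J c3 -> J c4 -> (c1 < c2)%R -> (c2 < c3)%R -> (c3 < c4)%R ->
    J d1 -> J d2 -> J d3 -> J d4 -> (d1 < d2)%R -> (d2 < d3)%R -> (d3 < d4)%R ->
    Q c1 c2 c3 c4 -> Q d1 d2 d3 d4.
Proof.
  intros HQ.
  assert (move : forall c1 c2 c3 c4 c d F, J c1 -> J c2 -> J c3 -> J c4 -> J c -> J d ->
    (forall e, In e F -> ((e < c)%R /\ (e < d)%R) \/ ((c < e)%R /\ (d < e)%R)) ->
    Q c1 c2 c3 c4 -> exists g : aut, (forall e, In e F -> g e = e) /\ g c = d /\
      Q (g c1) (g c2) (g c3) (g c4)).
  { intros c1 c2 c3 c4 c d F H1 H2 H3 H4 Hc Hd HF H.
    destruct (J_move F c d Hc Hd HF) as (g & (HgE & HgF)%fixes_app & Hg).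
    exists g. auto. }
  assert (step4 : forall c1 c2 c3 c4 d, J c1 -> J c2 -> J c3 -> J c4 -> J d ->
    (c1 < c2)%R -> (c2 < c3)%R -> (c3 < c4)%R -> (c3 < d)%R -> Q c1 c2 c3 c4 -> Q c1 c2 c3 d).
  { intros c1 c2 c3 c4 d H1 H2 H3 H4 Hd L1 L2 L3 L4 H.
    destruct (move c1 c2 c3 c4 c4 d [c1; c2; c3]) as (g & G1 & G2 & G); auto.
    { intros e [<-|[<-|[<-|[]]]]; left; lra. }
    rewrite G2, !G1 in G by (cbn; auto). exact G. }
  assert (step3 : forall c1 c2 c3 c4 d, J c1 -> J c2 -> J c3 -> J c4 -> J d ->
    (c1 < c2)%R -> (c2 < c3)%R -> (c3 < c4)%R -> (c2 < d)%R -> (d < c4)%R ->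
    Q c1 c2 c3 c4 -> Q c1 c2 d c4).
  { intros c1 c2 c3 c4 d H1 H2 H3 H4 Hd L1 L2 L3 L4 L5 H.
    destruct (move c1 c2 c3 c4 c3 d [c1; c2; c4]) as (g & G1 & G2 & G); auto.
    { intros e [<-|[<-|[<-|[]]]]; [left|left|right]; lra. }
    rewrite G2, !G1 in G by (cbn; auto). exact G. }
  assert (step2 : forall c1 c2 c3 c4 d, J c1 -> J c2 -> J c3 -> J c4 -> J d ->
    (c1 < c2)%R -> (c2 < c3)%R -> (c3 < c4)%R -> (c1 < d)%R -> (d < c3)%R ->
    Q c1 c2 c3 c4 -> Q c1 d c3 c4).
  { intros c1 c2 c3 c4 d H1 H2 H3 H4 Hd L1 L2 L3 L4 L5 H.
    destruct (move c1 c2 c3 c4 c2 d [c1; c3; c4]) as (g & G1 & G2 & G); auto.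
    { intros e [<-|[<-|[<-|[]]]]; [left|right|right]; lra. }
    rewrite G2, !G1 in G by (cbn; auto). exact G. }
  assert (step1 : forall c1 c2 c3 c4 d, J c1 -> J c2 -> J c3 -> J c4 -> J d ->
    (c1 < c2)%R -> (c2 < c3)%R -> (c3 < c4)%R -> (d < c2)%R ->
    Q c1 c2 c3 c4 -> Q d c2 c3 c4).
  { intros c1 c2 c3 c4 d H1 H2 H3 H4 Hd L1 L2 L3 L4 H.
    destruct (move c1 c2 c3 c4 c1 d [c2; c3; c4]) as (g & G1 & G2 & G); auto.
    { intros e [<-|[<-|[<-|[]]]]; right; lra. }
    rewrite G2, !G1 in G by (cbn; auto). exact G. }
  intros c1 c2 c3 c4 d1 d2 d3 d4 C1 C2 C3 C4 Lc1 Lc2 Lc3 D1' D2' D3' D4' Ld1 Ld2 Ld3 H.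
  assert (top : exists m, J m /\ (c4 <= m)%R /\ (d4 <= m)%R).
  { destruct (Rle_lt_dec c4 d4); [exists d4|exists c4]; (split; [auto|split; lra]). }
  destruct top as (m & Jm & M1 & M2).
  destruct (J_right m Jm) as (u1 & U1 & L1), (J_right u1 U1) as (u2 & U2 & L2),
    (J_right u2 U2) as (u3 & U3 & L3), (J_right u3 U3) as (u4 & U4 & L4).
  apply (step4 _ _ _ _ u4) in H; auto; [|lra].
  apply (step3 _ _ _ _ u3) in H; auto; try lra.
  apply (step2 _ _ _ _ u2) in H; auto; try lra.
  apply (step1 _ _ _ _ u1) in H; auto; try lra.
  apply (step1 _ _ _ _ d1) in H; auto; try lra.
  apply (step2 _ _ _ _ d2) in H; auto; try lra.
  apply (step3 _ _ _ _ d3) in H; auto; try lra.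
  apply (step4 _ _ _ _ d4) in H; auto; lra.
Qed.

Lemma canonical_of_orbit (X P C f : NI) : suppN E X -> suppN E f -> (x : NI) ∈ X ->
  MSubsets 2 P X -> Function_ f P C -> Canonical X f.
Proof.
  intros HX Hf HxX HP HfP.
  assert (G : forall c, exists y, J c -> moved c y).
  { intros c. destruct (classic (J c)) as [Hc|Hc].
    - destruct (moved_ex c Hc) as (y & Hy). eauto.
    - exists x. tauto. }
  apply choice in G as (y_ & Hy).
  assert (movedX : forall c y, moved c y -> (y : NI) ∈ X).
  { intros c y (g & Hg & _ & <-). rewrite <- (HX g Hg). now apply mem_act_NI. }
  assert (y_act : forall g c, fixes g E -> J c -> actN g (y_ c) = y_ (g c)).
  { intros g c Hg Hc. apply (moved_fun (g c)); auto using moved_act, J_act. }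
  assert (y_inj : forall c d, J c -> J d -> y_ c = y_ d -> c = d).
  { intros c d Hc Hd Ecd. apply (moved_inj c d (y_ c)); auto. rewrite Ecd. auto. }
  assert (y_eq : forall c y, moved c y -> y = y_ c).
  { intros c y Hcy. apply (moved_fun c); auto. apply Hy. eapply moved_J; eauto. }
  destruct (N_comprehension (fun y => exists c, moved c y) E) as (Y & HY & EY).
  { exists R, y_. intros y (c & Hc). eauto. }
  { intros g Hg y (c & Hc). exists (g c). now apply moved_act. }
  destruct (N_comprehension (fun p : NI => exists c d, J c /\ J d /\ (c < d)%R /\
    p = opair (y_ c : NI) (y_ d)) E) as (O & HO & EO).
  { exists (R * R)%type, (fun c => opair (y_ (fst c) : NI) (y_ (snd c))).
    intros p (c & d & _ & _ & _ & ->). now exists (c, d). }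
  { intros g Hg p (c & d & Hc & Hd & Hcd & ->). exists (g c), (g d).
    rewrite actN_opair, !y_act by auto. auto using J_act, ap_mono. }
  assert (ER : forall u w : NI, Rel (O : NI) u w <->
    exists c d, J c /\ J d /\ (c < d)%R /\ u = y_ c /\ w = y_ d).
  { intros u w. rewrite Rel_iff. cbn. rewrite EO. split.
    - intros (c & d & Hc & Hd & Hcd & (-> & ->)%opair_inj). eauto 8.
    - intros (c & d & Hc & Hd & Hcd & -> & ->). eauto 8. }
  set (Ec := fun c1 d1 c2 d2 =>
    SameColor f (y_ c1 : NI) (y_ d1 : NI) (y_ c2 : NI) (y_ d2 : NI)).
  assert (Eact : forall g, fixes g E -> forall c1 d1 c2 d2, J c1 -> J d1 -> J c2 -> J d2 ->
    (Ec c1 d1 c2 d2 <-> Ec (g c1) (g d1) (g c2) (g d2))).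
  { assert (Eact : forall g, fixes g E -> forall c1 d1 c2 d2, J c1 -> J d1 -> J c2 -> J d2 ->
      Ec c1 d1 c2 d2 -> Ec (g c1) (g d1) (g c2) (g d2)).
    { intros g Hg c1 d1 c2 d2 H1 H2 H3 H4. unfold Ec. rewrite <- !y_act by auto.
      apply SameColor_actN, Hf, Hg. }
    intros g Hg c1 d1 c2 d2 H1 H2 H3 H4. split; [now apply Eact|].
    intros H. apply (Eact (aut_inv g)) in H; auto using fixes_inv, J_act.
    cbn in H. now rewrite !ai_ap in H. }
  destruct (J_right a J_a) as (u1 & U1 & L1), (J_right u1 U1) as (u2 & U2 & L2),
    (J_right u2 U2) as (u3 & U3 & L3), (J_right u3 U3) as (u4 & U4 & L4),
    (J_right u4 U4) as (u5 & U5 & L5).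
  destruct (pattern_ex Ec a u1 u2 u3) as (i & _ & Hi).
  assert (Hpat : forall b c d e, J b -> J c -> J d -> J e -> (b < c)%R -> (c < d)%R -> (d < e)%R ->
    pattern Ec i b c d e).
  { intros b c d e Hb Hc Hd He Hbc Hcd Hde.
    refine (quadruples (pattern Ec i) _ a u1 u2 u3 b c d e _ _ _ _ _ _ _ _ _ _ _ _ _ _ Hi);
      auto using J_a.
    intros g Hg c1 c2 c3 c4 H1 H2 H3 H4. apply pattern_iff; apply Eact; auto. }
  apply (canonical_intro X f (Y : NI) (O : NI)).
  - split; [now apply IsSet_setN|]. intros z Hz. cbn in Hz. apply EY in Hz as (c & Hc). eauto.
  - apply Infinite_moved; [now apply IsSet_setN|]. intros F.
    destruct (move_right (E ++ F) a) as (s & Hs & H).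
    set (r := ((a + s) / 2)%R).
    assert (cut : same_cut (E ++ F) r s).
    { intros e He. specialize (H e He).
      destruct (Rle_lt_dec e a); unfold r; repeat split; try lra; intros; lra. }
    assert (Js : J s).
    { intros e He. assert (He' : In e (E ++ F)) by (apply in_or_app; auto).
      destruct (J_a e He) as (_ & N & _). specialize (H e He').
      destruct (Rtotal_order e a) as [?|[?|?]]; [|contradiction|];
        (split; [split; intros; lra|split; [auto|lra]]). }
    assert (Jr : J r) by (apply (J_between a s); auto using J_a; unfold r; lra).
    destruct (homogeneous _ _ _ cut) as (g & (HgE & HgF)%fixes_app & Hg).
    exists (y_ r), g. rewrite y_act, Hg by auto.
    split; [auto|split; [|split]].
    + apply EY. eauto.
    + apply EY. eauto.
    + intros Esr. apply y_inj in Esr; auto. unfold r in Esr. lra.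
  - split; [split|split; [|split]].
    + now apply IsSet_setN.
    + intros p Hp. cbn in Hp. apply EO in Hp as (c & d & Hc & Hd & Hcd & ->).
      exists (y_ c), (y_ d). split; [apply EY; eauto|split; [apply EY; eauto|]].
      now apply OPair_iff.
    + intros z (c & d & Hc & Hd & Hcd & -> & Ecd)%ER. apply y_inj in Ecd; auto. lra.
    + intros u v w ((c & d & Hc & Hd & Hcd & -> & ->)%ER &
        (c' & d' & Hc' & Hd' & Hcd' & Edc & ->)%ER).
      apply y_inj in Edc as <-; auto. apply ER. exists c, d'.
      split; [auto|split; [auto|split; [lra|auto]]].
    + intros u v (Hu & Hv). cbn in Hu, Hv. apply EY in Hu as (c & Hc), Hv as (d & Hd).
      assert (Jc := moved_J _ _ Hc). assert (Jd := moved_J _ _ Hd).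
      apply y_eq in Hc as ->, Hd as ->. rewrite !ER.
      destruct (Rtotal_order c d) as [H|[->|H]]; auto.
      * left. exists c, d. auto.
      * right; right. exists d, c. auto.
  - apply (canonical_on_transfer (fun c u => J c /\ u = y_ c)
      (fun c d => J c /\ J d /\ (c < d)%R) Ec).
    { intros c u w (_ & ->) (_ & ->). auto. }
    { intros c d u (Hc & ->) (Hd & Ecd). auto. }
    { intros u w (c & d & Hc & Hd & Hcd & -> & ->)%ER. exists c, d. auto 8. }
    { intros c d c' d' u v w z (_ & ->) (_ & ->) (_ & ->) (_ & ->). reflexivity. }
    apply canonical_of_pattern with (Y := J) (i := i); auto.
    + intros b c d. apply Rlt_trans.
    + intros c d _ _. apply Rtotal_order.
    + intros c d Hc Hd Hcd. eapply SameColor_refl; eauto.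
      intros Ecd. apply y_inj in Ecd; auto. lra.
    + intros b c d e. apply SameColor_sym.
    + intros b c d e h k. eapply SameColor_trans; eauto.
    + intros c Hc. destruct (J_right c Hc) as (d & Hd & Hcd). eauto.
    + exists a, u1, u2, u3, u4, u5. auto 12 using J_a.
Qed.
End Interval.

Lemma NI_CRT v : sat NI v CRT.
Proof.
  apply sat_CRT. intros X P C f (HX & HP & _ & Hf).
  destruct (suppN_ex X) as (E1 & H1), (suppN_ex f) as (E2 & H2).
  destruct (classic (forall g, fixes g (E1 ++ E2) -> forall x : NI, x ∈ X -> actN g x = x))
    as [H|H].
  - destruct (injection_of_fixed X _ HX H) as (j & Hj).
    eapply canonical_of_injection; eauto.
  - assert (exists x : NI, x ∈ X /\ ~ suppN (E1 ++ E2) x) as (x & Hx & N).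
    { apply NNPP. intros N. apply H. intros g Hg x Hx. apply NNPP. intros Hgx. apply N.
      exists x. split; auto. }
    destruct (suppN_ex x) as (l & Hl).
    destruct (minimal_support (E1 ++ E2) l x) as (F & a & HF & Ha & HNF); auto.
    { intros g (Hg & _)%fixes_app. auto. }
    apply (canonical_of_orbit F a x Ha HNF X P C f); auto.
    + intros g Hg. apply H1. eapply fixes_incl; [|exact Hg].
      intros e He. apply HF, in_or_app. auto.
    + intros g Hg. apply H2. eapply fixes_incl; [|exact Hg].
      intros e He. apply HF, in_or_app. auto.
Qed.

Theorem ZFA_CRT_not_DF_eq_F : ~ proves ZFA (fImp CRT DF_eq_F).
Proof.
  intros H. apply (NI_not_DF_eq_F (fun _ => emptyN)).
  exact (proves_sound _ _ _ NI_ZFA H (fun _ => emptyN) (NI_CRT _)).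
Qed.

Theorem theorem4p8 :
  proves ZF (fImp (fAnd OP (RT 4 203)) CRT) /\
  strictly_stronger ZFA DF_eq_F CRT.
Proof.
  split; [exact ZF_OP_RT_CRT|]. split; [exact ZFA_DF_eq_F_CRT|].
  intros _. exact ZFA_CRT_not_DF_eq_F.
Qed.
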